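(* Let $(\Omega,\mathcal F,(\mathcal F_t)_{t\ge0},\mathbb P)$ be a filtered probability space satisfying the usual conditions, $B$ an $(\mathcal F_t)$-adapted $d$-dimensional Brownian motion started at $0$, and let $\mathbf I=\{1,\dots,m\}$. For each $i\in\mathbf I$ let $\phi_i:\mathbb R\to(-\infty,+\infty]$ be convex and lower semicontinuous with $\phi_i=+\infty$ on $(-\infty,0)$ and $\phi_i$ of class $C^1$ on $(0,\infty)$; let $n_i$ be pairwise distinct unit vectors of $\mathbb R^d$ and $a_i\in\mathbb R$. Set $\Phi(x)=\sum_{i}\phi_i(x\cdot n_i-a_i)$, $D=\{x: x\cdot n_i>a_i\ \forall i\}$, assumed nonempty. Let $(X,L)$ be the solution of the multivalued SDE associated with $\Phi$ (see context) with $\mathcal F_0$-measurable initial condition $X_0\in\overline D$. For $\mathbf J\subset\mathbf I$ let $H_{\mathbf J}=\{x: x\cdot n_j=a_j\ \forall j\in\mathbf J\}$ and $\sigma_{\mathbf J}=\inf\{t>0: X_t\in H_{\mathbf J}\}$. Then for every $\mathbf J\subset\mathbf I$ with $\mathrm{card}(\mathbf J)\ge2$, $\mathbb P(\sigma_{\mathbf J}=\infty)=1$.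
   Context: A unit vector $n(x)$ is a unit inward normal to $D$ at $x\in\partial D$ if $n(x)\cdot(x-z)\le0$ for all $z\in\overline D$. The solution of the multivalued SDE associated with $\Phi$ (which exists and is unique) is the pair consisting of a continuous $(\mathcal F_t)$-adapted $\overline D$-valued process $X$ and a continuous $(\mathcal F_t)$-adapted nondecreasing process $L$ such that for all $t\ge0$: $X_t=X_0+B_t-\int_0^t\nabla\Phi(X_s)\,ds+\int_0^t n_s\,dL_s$ and $L_t=\int_0^t\mathbf 1_{\{X_s\in\partial D\}}dL_s$, where $n_s$ is $dL_s$-a.e. a unit inward normal to $D$ at $X_s$; here $\nabla\Phi(x)=\sum_i n_i\phi_i'(x\cdot n_i-a_i)$ on $D$. This solution satisfies $\int_0^T\mathbf 1_{\{X_s\in\partial D\}}ds=0$ and $\int_0^T|\nabla\Phi(X_s)|ds<\infty$ for all $T<\infty$. *)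

(* Defs.v *)
From HB Require Import structures.
From mathcomp Require Import all_boot all_order all_algebra.
From mathcomp Require Import all_classical all_reals all_analysis.
Set Implicit Arguments. Unset Strict Implicit. Unset Printing Implicit Defensive.
Import Order.TTheory GRing.Theory Num.Theory.
Import numFieldNormedType.Exports.
Local Open Scope classical_set_scope.
Local Open Scope ring_scope.

Section Geometry.
Context {R : realType} {d m : nat}.

Definition dotv (x y : 'I_d -> R) : R := \sum_(k < d) x k * y k.
Definition unitv (x : 'I_d -> R) : Prop := dotv x x = 1.

Variables (n : 'I_m -> 'I_d -> R) (a : 'I_m -> R).

(** D = {x | x.n_i > a_i for all i};  Dbar = its closure (D nonempty). *)
Definition inD (x : 'I_d -> R) : Prop := forall i, a i < dotv x (n i).
Definition inDbar (x : 'I_d -> R) : Prop := forall i, a i <= dotv x (n i).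
Definition onBd (x : 'I_d -> R) : Prop := inDbar x /\ ~ inD x.

Definition inward_normal (x v : 'I_d -> R) : Prop :=
  unitv v /\ forall z, inDbar z -> dotv v (fun k => x k - z k) <= 0.

Definition inH (J : {set 'I_m}) (x : 'I_d -> R) : Prop :=
  forall j, j \in J -> dotv x (n j) = a j.

End Geometry.

Section Potentials.
Context {R : realType}.

Definition econvex (f : R -> \bar R) : Prop := forall (x y t : R), 0 <= t <= 1 ->
  (f (t * x + (1 - t) * y)%R <= t%:E * f x + (1 - t)%R%:E * f y)%E.

Definition elsc (f : R -> \bar R) : Prop := forall (x a : R),
  (a%:E < f x)%E -> \forall y \near x, (a%:E < f y)%E.

(** derivative of phi on (0,oo), where phi is finite *)
Definition phid (f : R -> \bar R) (x : R) : R := derive1 (fun y => fine (f y)) x.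

Definition admissible_phi (f : R -> \bar R) : Prop :=
  (forall x, f x != -oo%E) /\ econvex f /\ elsc f /\
  (forall x, x < 0 -> f x = +oo%E) /\
  (forall x, 0 < x -> f x \is a fin_num) /\
  (forall x, 0 < x -> derivable (fun y => fine (f y)) x 1 /\
        (phid f y @[y --> x] --> phid f x)).

Definition gradPhi {d m : nat} (n : 'I_m -> 'I_d -> R) (a : 'I_m -> R)
  (phi : 'I_m -> R -> \bar R) (x : 'I_d -> R) : 'I_d -> R :=
  fun k => \sum_(i < m) n i k * phid (phi i) (dotv x (n i) - a i).

End Potentials.

Section Stoch.
Context {R : realType} {dT : measure_display} {T : measurableType dT}.

Definition meas_wrt (G : set (set T)) (f : T -> R) : Prop :=
  forall C : set R, measurable C -> G (f @^-1` C).

Definition filtration (F : R -> set (set T)) : Prop :=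
  [/\ forall t, sigma_algebra setT (F t),
      forall t, F t `<=` measurable &
      forall s t, s <= t -> F s `<=` F t].

(** usual conditions: right continuity and F_0 contains all P-negligible sets
    (hence the probability space is complete) *)
Definition usual_conditions (P : probability T R) (F : R -> set (set T)) : Prop :=
  (forall t, 0 <= t -> forall A, (forall u, t < u -> F u A) -> F t A) /\
  (forall N, measurable N -> P N = 0%E -> forall A, A `<=` N -> F 0 A).

(** (F_t)-adapted d-dimensional Brownian motion started at 0:
    continuous paths, adapted, and for 0 <= s < t the increment B_t - B_s is
    independent of F_s with law N(0, (t-s) I_d), expressed on the generating
    pi-system of boxes. *)
Definition brownian {d : nat} (P : probability T R) (F : R -> set (set T))
  (B : R -> T -> 'I_d -> R) : Prop :=
  [/\ forall t k, 0 <= t -> meas_wrt (F t) (fun w => B t w k),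
      {ae P, forall w, forall k, B 0 w k = 0},
      {ae P, forall w, forall k,
         {within `[0, +oo[%classic, continuous (fun t => B t w k)}} &
      forall (s t : R) (A : set T) (al be : 'I_d -> R), 0 <= s -> s < t ->
        F s A ->
        P (A `&` [set w | forall k, al k <= B t w k - B s w k <= be k]) =
        (P A * (\prod_(k < d)
           \int[lebesgue_measure]_(x in `[al k, be k]) normal_pdf 0 (Num.sqrt (t - s)) x)%:E)%E].

Definition mvsde_solution {d m : nat} (P : probability T R) (F : R -> set (set T))
  (n : 'I_m -> 'I_d -> R) (a : 'I_m -> R) (phi : 'I_m -> R -> \bar R)
  (B X : R -> T -> 'I_d -> R) (L : R -> T -> R) : Prop :=
  [/\ forall t k, 0 <= t -> meas_wrt (F t) (fun w => X t w k),
      forall t, 0 <= t -> meas_wrt (F t) (L t) &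
      {ae P, forall w,
        (forall k, {within `[0, +oo[%classic, continuous (fun t => X t w k)}) /\
            {within `[0, +oo[%classic, continuous (fun t => L t w)} /\
            (forall t, 0 <= t -> inDbar n a (X t w)) /\
            L 0 w = 0 /\
            (forall s t, 0 <= s -> s <= t -> L s w <= L t w) /\
            lebesgue_measure [set s | 0 <= s /\ onBd n a (X s w)] = 0%E /\
            (forall t k, 0 <= t -> lebesgue_measure.-integrable `[0, t]%classic
                                    (fun s => (gradPhi n a phi (X s w) k)%:E)) /\
            exists (nv : R -> 'I_d -> R) (muL : {measure set R -> \bar R}),
              (forall k, measurable_fun setT (fun s => nv s k)) /\
                  muL `]-oo, 0]%classic = 0%E /\
                  (forall s t, 0 <= s -> s <= t -> muL `]s, t]%classic = (L t w - L s w)%:E) /\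
                  (* L_t = int_0^t 1_{X_s in bd D} dL_s *)
                  muL [set s | 0 <= s /\ ~ onBd n a (X s w)] = 0%E /\
                  muL [set s | 0 <= s /\ ~ inward_normal n a (X s w) (nv s)] = 0%E /\
                  (forall t k, 0 <= t ->
                    X t w k = X 0 w k + B t w k
                              - (\int[lebesgue_measure]_(s in `[0, t]) gradPhi n a phi (X s w) k)
                              + (\int[muL]_(s in `[0, t]) nv s k))}].

End Stoch.

(* Main.v *)
Require Import Defs.
From HB Require Import structures.
From mathcomp Require Import all_boot all_order all_algebra.
From mathcomp Require Import ring lra.
From mathcomp Require Import all_classical all_reals all_analysis measurable_realfun.
Import Order.TTheory GRing.Theory Num.Theory.
Set Implicit Arguments. Unset Strict Implicit. Unset Printing Implicit Defensive.
Import numFieldNormedType.Exports.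
Local Open Scope classical_set_scope.
Local Open Scope ring_scope.

(** Idea.  If X hits H_J, let J' be the set of all walls active at the hitting
    time; as D is nonempty, two of their normals are not parallel, so H_J' has
    codimension at least 2.  Let u be the squared distance to H_J' and
    rho = sqrt (u + e^2).  Near H_J' the reflection and the singular part of
    the drift push away from H_J', and the rest of the drift is bounded, so that
    ln rho + K rho is a local submartingale for K large: the trace >= 2 of the
    projection absorbs the second order term of the logarithm.  A path starting
    away from H_J' that reaches H_J' brings this function down to about ln e,
    while it is bounded above and starts above a constant independent of e;
    hence the probability of a hit is O(1 / |ln e|), and e -> 0.  The
    submartingale inequality is obtained without stochastic integrals, by a
    Taylor expansion along the grid of mesh 1/(N+1), stopped on leaving the
    neighbourhood of H_J', and N -> oo. *)

(** * Gaussian moments *)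

(** The obstacle is that [gradPhi] may blow up at a wall and that the variation of X - B has no
    moment bound. Monotonicity of each derivative [phid (phi i)] bounds its push towards the wall,
    so a blow-up at 0 has the favourable sign, and only one-sided bounds on the drift are ever used.
    The uncontrolled variation is handled by stopping once it exceeds a level [Mv]. Levels, starting
    times, margins and bounds are exhausted by countable unions at the very end, which keeps all
    constants of the estimate deterministic. Taking J' to be exactly the active set gives every
    other wall a positive gap near the hitting time. The two limits are ordered: N tends to infinity
    with e fixed, since the Taylor constants degenerate with e, and only then e tends to 0, in a
    bound whose right-hand side no longer contains e. Starting points off H_J' exist just before any
    hitting time because the boundary times are Lebesgue null; this also covers an initial point
    lying on H_J. *)

Section NormalMoments.
Variable R : realType.
Implicit Types (s x : R).
Import HBNNSimple.
Notation mu := (@lebesgue_measure R).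

(* [normal_prob] lives on the Borel structure of half-open intervals; [gauss] is
   the same measure on the default measurable structure of [R]. *)
Definition gauss s : set R -> \bar R := normal_prob 0 s.

HB.instance Definition _ s := isMeasure.Build _ R R (gauss s)
  (measure0 (normal_prob 0 s)) (measure_ge0 (normal_prob 0 s))
  (@measure_semi_sigma_additive _ _ _ (normal_prob 0 s)).

Lemma gauss_setT s : gauss s setT = 1%E.
Proof. exact: (probability_setT (normal_prob 0 s)). Qed.

HB.instance Definition _ s :=
  Measure_isProbability.Build _ _ _ (gauss s) (gauss_setT s).

(** Monotone approximation by simple functions reduces the density formula to indicators, for which
    it is the definition of [normal_prob]. *)
Lemma ge0_integral_gauss s (f : R -> \bar R) :
  measurable_fun [set: R] f -> (forall x, 0 <= f x)%E ->
  (\int[gauss s]_x f x = \int[mu]_x (f x * (normal_pdf 0 s x)%:E))%E.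
Proof.
move=> mf f0; pose h := nnsfun_approx measurableT mf.
have hnd a b (x : R) : (a <= b)%N -> h a x <= h b x.
  by move=> ab; exact/lefP/nd_nnsfun_approx.
have hm n : measurable_fun [set: R] (h n) by exact: measurable_funP.
have mp : measurable_fun [set: R] (fun x => (normal_pdf 0 s x)%:E).
  by apply/measurable_EFinP; apply: measurable_normal_pdf.
transitivity (limn (fun n => \int[gauss s]_x (h n x)%:E)%E).
  rewrite -monotone_convergence//.
  - apply: eq_integral => y _; apply/esym/cvg_lim => //.
    by apply: cvg_nnsfun_approx => // ? _; exact: f0.
  - by move=> n; apply/measurable_EFinP; exact: hm.
  - by move=> n y _; rewrite lee_fin.
  - by move=> y _ a b ab; rewrite lee_fin; exact: hnd.
transitivity (limn (fun n => \int[mu]_x ((h n x)%:E * (normal_pdf 0 s x)%:E))%E);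
    last first.
  rewrite -monotone_convergence//.
  - apply: eq_integral => y _; apply/cvg_lim => //.
    apply: cvgeZr => //.
    exact: (cvg_nnsfun_approx measurableT mf (fun z _ => f0 z) I).
  - by move=> n; apply: emeasurable_funM => //; apply/measurable_EFinP; exact: hm.
  - by move=> n y _; rewrite mule_ge0// lee_fin// normal_pdf_ge0.
  - move=> y _ a b ab; rewrite lee_wpmul2r ?lee_fin ?normal_pdf_ge0//.
    exact: hnd.
congr (limn _); apply/funext => n.
have hset (r : R) : measurable (h n @^-1` [set r]).
  by rewrite -[X in measurable X]setTI; apply: hm.
have hind1 (r : R) : measurable_fun [set: R] (\1_(h n @^-1` [set r]) : R -> R).
  exact: measurable_indic.
have hind (r : R) : measurable_fun [set: R] (fun x : R => (r * \1_(h n @^-1` [set r]) x)%:E).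
  by apply/measurable_EFinP; apply: measurable_funM.
under eq_integral do rewrite fimfunE -fsumEFin//.
rewrite ge0_integral_fsum//; last by move=> y x _; exact: nnfun_muleindic_ge0.
under [RHS]eq_integral => x _.
  rewrite fimfunE -fsumEFin// ge0_mule_fsuml; last by move=> y; exact: nnfun_muleindic_ge0.
  over.
rewrite ge0_integral_fsum//; last 2 first.
- by move=> y; apply: emeasurable_funM => //; exact: hind.
- by move=> y x _; rewrite mule_ge0 ?lee_fin ?normal_pdf_ge0//; exact: (nnfun_muleindic_ge0 (h n)).
apply: eq_fsbigr => r rhn.
have r0 : 0 <= r by move: rhn; rewrite inE => -[t _ <-].
under eq_integral do rewrite EFinM.
rewrite integralZl_indic_nnsfun//.
under [RHS]eq_integral do rewrite EFinM -muleA.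
rewrite ge0_integralZl//; last 2 first.
- by apply: emeasurable_funM => //; apply/measurable_EFinP; exact: hind1.
- by move=> t _; rewrite mule_ge0 ?lee_fin ?normal_pdf_ge0.
congr (_ * _)%E.
rewrite integral_indic// setIT /gauss /normal_prob [LHS]integral_mkcond.
by apply: eq_integral => x _; rewrite epatch_indic muleC.
Qed.

(* [z^2 <= 2 e^z] with [z = x^2/(4 s^2)] trades a polynomial weight for a doubled variance. *)
Lemma normal_pdf_cube s x : 0 < s ->
  `|x| ^+ 3 * normal_pdf 0 s x <= 48 * s ^+ 3 * normal_pdf 0 (Num.sqrt 2 * s) x.
Proof.
move=> s0; have r2 : 0 < Num.sqrt 2 :> R by rewrite sqrtr_gt0.
have r22 : Num.sqrt 2 ^+ 2 = 2 :> R by rewrite sqr_sqrtr.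
have r2le : Num.sqrt 2 <= 2 :> R by nra.
rewrite !normal_pdfE ?gt_eqF ?mulr_gt0// /normal_fun subr0.
have -> : normal_peak (Num.sqrt 2 * s) = (Num.sqrt 2)^-1 * normal_peak s.
  rewrite /normal_peak exprMn -invfM; congr (_^-1).
  by rewrite -!mulrnAr -mulrA sqrtrM ?sqr_ge0// sqrtr_sqr gtr0_norm.
set p := normal_peak s; have p0 : 0 <= p by exact: normal_peak_ge0.
pose r := `|x| / (2 * s).
have r0 : 0 <= r by rewrite divr_ge0// mulr_ge0// ltW.
have xr : `|x| = 2 * s * r by rewrite /r; field; rewrite gt_eqF.
have xx : x ^+ 2 = (2 * s * r) ^+ 2 by rewrite -xr real_normK ?num_real.
have -> : - x ^+ 2 / (s ^+ 2 *+ 2) = - (r ^+ 2 + r ^+ 2).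
  by rewrite xx; field; rewrite gt_eqF.
have -> : - x ^+ 2 / ((Num.sqrt 2 * s) ^+ 2 *+ 2) = - r ^+ 2.
  by rewrite (exprMn _ (Num.sqrt 2) s) r22 xx; field; rewrite gt_eqF.
have rr : r ^+ 3 * expR (- r ^+ 2) <= 2.
  rewrite expRN ler_pdivrMr ?expR_gt0//.
  have := @expR_ge1Dxn R (r ^+ 2) 1 (sqr_ge0 _); rewrite -exprM.
  have : r ^+ 3 <= 1 + r ^+ 4.
    have [r1|r1] := leP r 1.
      by have := @exprn_ile1 _ 3 r r0 r1; have := exprn_ge0 4 r0; lra.
    have : r ^+ 3 <= r ^+ 4 by rewrite ler_weXn2l// ltW.
    lra.
  have -> : (2`! = 2)%N by []. lra.
rewrite opprD expRD xr; set e := expR _ in rr *.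
have e0 : 0 <= e by exact: expR_ge0.
have -> : (2 * s * r) ^+ 3 * (p * (e * e)) = 8 * (s ^+ 3 * p * e) * (r ^+ 3 * e) by ring.
have -> : 48 * s ^+ 3 * ((Num.sqrt 2)^-1 * p * e) = 8 * (s ^+ 3 * p * e) * (6 / Num.sqrt 2).
  by field; rewrite gt_eqF.
apply: ler_wpM2l.
  apply: mulr_ge0 => //; apply: mulr_ge0 => //; apply: mulr_ge0 => //.
  by rewrite exprn_ge0// ltW.
by rewrite (le_trans rr)// ler_pdivlMr//; lra.
Qed.

Lemma normal_cube_moment s : 0 < s ->
  (\int[gauss s]_x (`|x| ^+ 3)%:E <= (48 * s ^+ 3)%:E)%E.
Proof.
move=> s0; have mc : measurable_fun [set: R] (fun x : R => (`|x| ^+ 3)%:E).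
  apply/measurable_EFinP; apply: measurable_funX.
  exact: normr_measurable.
have mp : measurable_fun [set: R] (fun x => (normal_pdf 0 (Num.sqrt 2 * s) x)%:E).
  by apply/measurable_EFinP; apply: measurable_normal_pdf.
have mp' : measurable_fun [set: R] (fun x => (normal_pdf 0 s x)%:E).
  by apply/measurable_EFinP; apply: measurable_normal_pdf.
rewrite ge0_integral_gauss//.
apply: (@le_trans _ _ (\int[mu]_x ((48 * s ^+ 3)%:E * (normal_pdf 0 (Num.sqrt 2 * s) x)%:E))%E).
  apply: ge0_le_integral => //.
  - by move=> x _; rewrite mule_ge0// lee_fin ?exprn_ge0 ?normal_pdf_ge0.
  - by apply: emeasurable_funM; [exact: mc|exact: mp'].
  - by apply: emeasurable_funM; [|exact: mp].
  - by move=> x _; rewrite -!EFinM lee_fin normal_pdf_cube.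
rewrite ge0_integralZl//; last 2 first.
- by move=> x _; rewrite lee_fin normal_pdf_ge0.
- by rewrite lee_fin mulr_ge0// exprn_ge0// ltW.
by rewrite integral_normal_pdf mule1.
Qed.

Lemma gauss_opp s (A : set R) : 0 < s -> measurable A ->
  gauss s (-%R @^-1` A) = gauss s A.
Proof.
move=> s0 mA; rewrite /gauss /normal_prob.
have mp : measurable_fun [set: R] (fun x => (normal_pdf 0 s x)%:E).
  by apply/measurable_EFinP; apply: measurable_normal_pdf.
transitivity (\int[pushforward mu (-%R : _ -> measurableTypeR R)]_(x in A) (normal_pdf 0 s x)%:E)%E.
  rewrite (@ge0_integral_pushforward _ _ _ _ R (-%R : measurableTypeR R -> measurableTypeR R)).
  - apply: eq_integral => x _ /=; congr EFin.
    by rewrite !normal_pdfE ?gt_eqF// /normal_fun !subr0 sqrrN.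
  - exact: oppr_measurable.
  - exact: mA.
  - exact: measurable_funS mp.
  - by move=> y _; rewrite lee_fin normal_pdf_ge0.
by apply: eq_measure_integral => //= B mB BA; exact: lebesgue_measureN.
Qed.

Lemma gauss_cube_integrable s : 0 < s ->
  (gauss s).-integrable setT (fun x => (`|x| ^+ 3)%:E).
Proof.
move=> s0; apply/integrableP; split.
  by apply/measurable_EFinP; apply: measurable_funX; exact: normr_measurable.
under eq_integral do rewrite gee0_abs ?lee_fin ?exprn_ge0//.
exact: le_lt_trans (normal_cube_moment s0) (ltry _).
Qed.

(** Makes the third absolute moment control the first two. *)
Lemma le1Dcube (t : R) : 0 <= t -> t <= 1 + t ^+ 3 /\ t ^+ 2 <= 1 + t ^+ 3.
Proof.
move=> t0; have t3 : 0 <= t ^+ 3 by exact: exprn_ge0.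
have [t1|t1] := leP t 1.
  have : t ^+ 2 <= 1 by exact: exprn_ile1.
  by split; lra.
have : t <= t ^+ 2 by rewrite -[leLHS]expr1 ler_weXn2l// ltW.
have : t ^+ 2 <= t ^+ 3 by rewrite ler_weXn2l// ltW.
by split; lra.
Qed.

Lemma gauss_id_integrable s : 0 < s -> (gauss s).-integrable setT (EFin \o id).
Proof.
move=> s0; apply: (@le_integrable _ _ _ _ _ _ _ (fun x => (1 + `|x| ^+ 3)%:E)) => //.
- by apply/measurable_EFinP.
- move=> x _; rewrite /= lee_fin [leRHS]ger0_norm ?addr_ge0 ?exprn_ge0//.
  by have [] := le1Dcube (normr_ge0 x).
- under eq_fun do rewrite EFinD.
  apply: integrableD => //; last exact: gauss_cube_integrable.
  by apply: finite_measure_integrable_cst.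
Qed.

Lemma gauss_sqr_integrable s : 0 < s -> (gauss s).-integrable setT (fun x => (x ^+ 2)%:E).
Proof.
move=> s0; apply: (@le_integrable _ _ _ _ _ _ _ (fun x => (1 + `|x| ^+ 3)%:E)) => //.
- by apply/measurable_EFinP; exact: measurable_funX.
- move=> x _; rewrite /= lee_fin ger0_norm ?sqr_ge0// [leRHS]ger0_norm ?addr_ge0 ?exprn_ge0//.
  by rewrite -real_normK ?num_real//; have [] := le1Dcube (normr_ge0 x).
- under eq_fun do rewrite EFinD.
  apply: integrableD => //; last exact: gauss_cube_integrable.
  by apply: finite_measure_integrable_cst.
Qed.

Lemma gauss_mean s : 0 < s -> \int[gauss s]_x x = 0.
Proof.
move=> s0; suff: \int[gauss s]_x x = - \int[gauss s]_x x by lra.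
have i1 := gauss_id_integrable s0.
rewrite -mulN1r -RintegralZl//; congr fine.
transitivity (\int[pushforward (gauss s) (-%R : R -> R)]_x x%:E)%E.
  by apply: eq_measure_integral => //= A mA _; rewrite /pushforward gauss_opp.
rewrite integral_pushforward//.
- by apply: eq_integral => x _ /=; rewrite mulN1r.
- rewrite preimage_setT; apply: (eq_integrable _ (fun x => (-1 * x)%:E)) => //.
    by move=> x _ /=; rewrite mulN1r.
  by under eq_fun do rewrite EFinM; exact: integrableZl.
Qed.

Lemma gauss_ball_le (s l : R) : 0 < s -> 0 < l ->
  (gauss s `[(- l)%R, l]%classic <= (normal_peak s * (l + l))%:E)%E.
Proof.
move=> s0 l0; rewrite /gauss /normal_prob.
apply: (@le_trans _ _ (\int[mu]_(x in `[(- l)%R, l]) (normal_peak s)%:E)%E).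
  apply: ge0_le_integral => //.
  - by move=> x _; rewrite lee_fin normal_pdf_ge0.
  - by apply/measurable_EFinP; apply: measurable_funTS; apply: measurable_normal_pdf.
  - by move=> x _; rewrite lee_fin normal_pdf_ub// gt_eqF.
rewrite integral_cst//= lebesgue_measure_itv/= lte_fin.
by rewrite gtrN// -EFinB opprK -EFinM.
Qed.

(** A lower bound suffices, because the variance will only multiply a nonnegative gain. The interval
    of radius [s / 2] has mass at most [normal_peak s * s <= 1 / 2] (as pi >= 2), and outside it the
    square is at least [s ^+ 2 / 4]. The factor 1/8 reappears later as [8^-1]. *)
Lemma gauss_var_ge s : 0 < s -> s ^+ 2 / 8 <= \int[gauss s]_x x ^+ 2.
Proof.
move=> s0; pose l := s / 2.
have l0 : 0 < l by rewrite divr_gt0.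
have ms : measurable `[- l, l]%classic by [].
have peak : normal_peak s * s <= 1 / 2.
  rewrite /normal_peak mulrC ler_pdivrMr ?sqrtr_gt0 ?pmulrn_lgt0 ?mulr_gt0 ?pi_gt0 ?exprn_gt0//.
  rewrite mul1r ler_pdivlMl//.
  have -> : 2 * s = Num.sqrt ((2 * s) ^+ 2).
    by rewrite sqrtr_sqr ger0_norm// mulr_ge0// ltW.
  rewrite ler_wsqrtr// exprMn.
  have h1 : 0 < s ^+ 2 by exact: exprn_gt0.
  have /(ler_wpM2l (ltW h1)) := @pi_ge2 R.
  rewrite -[in X in _ -> _ <= X]mulr_natr; lra.
have N1 : fine (gauss s `[- l, l]%classic) <= 1 / 2.
  have := gauss_ball_le s0 l0.
  rewrite -{1}(@fineK _ (gauss s `[- l, l]%classic))// ?fin_num_measure// lee_fin.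
  move=> /le_trans; apply; rewrite /l; lra.
have ic : (gauss s).-integrable setT (EFin \o (cst 1 : R -> R)).
  exact: finite_measure_integrable_cst.
have ii : (gauss s).-integrable setT (EFin \o (\1_(`[- l, l]%classic) : R -> R)).
  exact: integrable_indic.
have i0 : (gauss s).-integrable setT (EFin \o (fun x => 1 - \1_(`[- l, l]%classic) x : R)).
  exact: (integrableB measurableT ic ii).
have i1 : (gauss s).-integrable setT (EFin \o (fun x => l ^+ 2 * (1 - \1_(`[- l, l]%classic) x))).
  exact: (integrableZl measurableT (l ^+ 2) i0).
apply: (@le_trans _ _ (\int[gauss s]_x (l ^+ 2 * (1 - \1_(`[- l, l]%classic) x)))); last first.
  apply: le_Rintegral => //; first exact: gauss_sqr_integrable.
  move=> x _; rewrite indicE; case: (boolP (x \in _)) => /=.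
    by rewrite subrr mulr0 sqr_ge0.
  rewrite subr0 mulr1 notin_setE/= in_itv/= => /negP; rewrite negb_and -!ltNge.
  case/orP; nra.
rewrite RintegralZl// RintegralB// Rintegral_cst// /Rintegral integral_indic// setIT.
have e1 : fine (gauss s [set: R]) = 1 by rewrite gauss_setT.
rewrite [X in 1 * X - _]e1 mul1r /l expr_div_n; have : 0 <= s ^+ 2 by exact: sqr_ge0.
by move: (fine _) N1 => v; nra.
Qed.

End NormalMoments.

(** * Increments of Brownian motion *)

Section Independence.
Context (R : realType) (dT : measure_display) (T : measurableType dT).
Variable P : probability T R.

Lemma measure_eq_rays (m1 m2 : {measure set R -> \bar R}) :
  (m1 setT < +oo)%E ->
  (forall x, m1 `[x, +oo[%classic = m2 `[x, +oo[%classic) ->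
  forall A, measurable A -> m1 A = m2 A.
Proof.
move=> m1oo m12 A mA.
apply: (@measure_unique _ R R (@RGenCInfty.G R) (fun k => `[- k%:R, +oo[%classic)) => //.
- exact: RGenCInfty.measurableE.
- move=> _ _ [x ->] [y ->]; exists (Num.max x y).
  apply/seteqP; split => z /=; rewrite !in_itv/= !andbT ge_max.
    by case=> -> ->.
  by move=> /andP[].
- by move=> i; exists (- i%:R).
- apply/seteqP; split => // z _; exists (Num.truncn `|z|).+1 => //=.
  rewrite in_itv/= andbT lerNl.
  rewrite (le_trans (ler_norm _))// normrN ltW//.
  exact: truncnS_gt.
- by move=> _ [x ->]; exact: m12.
- move=> k; apply: le_lt_trans m1oo; apply: le_measure => //; rewrite inE//.
Qed.

Section Pair.
Context d1 (E1 : measurableType d1) d2 (E2 : measurableType d2).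
Variables (m1 : probability E1 R) (m2 : probability E2 R).

Lemma Rintegral_prod_mul (f1 : E1 -> R) (f2 : E2 -> R) :
  m1.-integrable setT (EFin \o f1) -> m2.-integrable setT (EFin \o f2) ->
  (m1 \x m2)%E.-integrable setT (fun z => (f1 z.1 * f2 z.2)%:E) /\
  \int[(m1 \x m2)%E]_z (f1 z.1 * f2 z.2) = \int[m1]_x f1 x * \int[m2]_x f2 x.
Proof.
move=> i1 i2.
have mf1 : measurable_fun setT f1 by apply/measurable_EFinP; exact: measurable_int i1.
have mf2 : measurable_fun setT f2 by apply/measurable_EFinP; exact: measurable_int i2.
have ma1 : measurable_fun setT (fun x => `|f1 x|%:E).
  by apply/measurable_EFinP; exact: (measurableT_comp (@normr_measurable R setT) mf1).
have ma2 : measurable_fun setT (fun x => `|f2 x|%:E).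
  by apply/measurable_EFinP; exact: (measurableT_comp (@normr_measurable R setT) mf2).
have mf : measurable_fun setT (fun z : E1 * E2 => (f1 z.1 * f2 z.2)%:E).
  apply/measurable_EFinP; apply: measurable_funM.
    exact: (measurableT_comp mf1).
  exact: (measurableT_comp mf2).
have ii : (m1 \x m2)%E.-integrable setT (fun z => (f1 z.1 * f2 z.2)%:E).
  apply/(integrable12ltyP _ _ mf).
  under eq_integral => x _.
    under eq_integral => y _ do rewrite /= normrM EFinM.
    rewrite ge0_integralZl//=.
    over.
  rewrite /= ge0_integralZr//=; last exact: integral_ge0.
  have /integrableP[_ h1] := i1; have /integrableP[_ h2] := i2.
  have f1n : (\int[m1]_x `|f1 x|%:E)%E \is a fin_num by rewrite ge0_fin_numE// integral_ge0.
  have f2n : (\int[m2]_x `|f2 x|%:E)%E \is a fin_num by rewrite ge0_fin_numE// integral_ge0.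
  by rewrite ltey_eq fin_numM.
split => //.
rewrite /Rintegral -integral12_prod_meas1//=.
under eq_integral => x _.
  rewrite /fubini_F; under eq_integral => y _ do rewrite /= EFinM.
  rewrite integralZl//=.
  over.
have c2 : (\int[m2]_x (f2 x)%:E)%E \is a fin_num by exact: integrable_fin_num.
by rewrite /= -(fineK c2) integralZr//= fineM//; exact: integrable_fin_num.
Qed.

Lemma indep_Rintegral (X1 : T -> E1) (X2 : T -> E2) (f1 : E1 -> R) (f2 : E2 -> R) :
  measurable_fun setT X1 -> measurable_fun setT X2 ->
  measurable_fun setT f1 -> measurable_fun setT f2 ->
  (forall A B, measurable A -> measurable B ->
     P (X1 @^-1` A `&` X2 @^-1` B) = (m1 A * m2 B)%E) ->
  m1.-integrable setT (EFin \o f1) -> m2.-integrable setT (EFin \o f2) ->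
  P.-integrable setT (fun w => (f1 (X1 w) * f2 (X2 w))%:E) /\
  \int[P]_w (f1 (X1 w) * f2 (X2 w)) = \int[m1]_x f1 x * \int[m2]_x f2 x.
Proof.
move=> mX1 mX2 mf1 mf2 ind i1 i2.
have [i12 e12] := Rintegral_prod_mul i1 i2.
have mX : measurable_fun setT (fun w => (X1 w, X2 w)) by exact: measurable_fun_pair.
have mf : measurable_fun setT (fun z : E1 * E2 => (f1 z.1 * f2 z.2)%:E).
  exact: measurable_int i12.
have eqm S : measurable S -> (m1 \x m2)%E S = pushforward P (fun w => (X1 w, X2 w)) S.
  by apply: product_measure_unique => A B mA mB; rewrite -ind.
have ip : (pushforward P (fun w => (X1 w, X2 w))).-integrable setT
    (fun z => (f1 z.1 * f2 z.2)%:E).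
  have /integrableP[_ h] := i12; apply/integrableP; split => //.
  rewrite (eq_measure_integral (m1 \x m2)%E)// => S mS _; exact/esym/eqm.
have iP : P.-integrable setT (fun w => (f1 (X1 w) * f2 (X2 w))%:E).
  have /integrableP[_ h] := ip; apply/integrableP; split.
    exact: (measurableT_comp mf mX).
  by move: h; rewrite ge0_integral_pushforward//; exact: measurableT_comp.
split => //; rewrite -e12 /Rintegral; congr fine.
rewrite (eq_measure_integral (pushforward P (fun w => (X1 w, X2 w)))); last first.
  by move=> S mS _; exact: eqm.
by rewrite integral_pushforward.
Qed.

End Pair.

Section GaussianVector.
Context (d : nat) (V : T -> 'I_d -> R) (s : R) (A : set T).
Hypothesis mA : measurable A.
Hypothesis mV : forall k, measurable_fun setT (fun w => V w k).
Hypothesis boxE : forall al be : 'I_d -> R,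
  P (A `&` [set w | forall k, al k <= V w k <= be k]) =
  (P A * (\prod_(k < d)
     \int[lebesgue_measure]_(x in `[al k, be k]) normal_pdf 0 s x)%:E)%E.

(** [None] leaves a coordinate unconstrained, so that marginal laws come out of the same computation
    as joint ones; the bounded intervals from [lo c j] to [j] increase to [ray c]. *)
Let ray (c : option R) : set R := if c is Some x then `[x, +oo[%classic else setT.
Let lo (c : option R) (j : nat) : R := if c is Some x then x else - j%:R.

Let mray c : measurable (ray c).
Proof. by case: c => [x|] /=; [exact: measurable_itv|exact: measurableT]. Qed.

Let bigcup_ray c : \bigcup_j `[lo c j, j%:R]%classic = ray c.
Proof.
apply/seteqP; split => z /=.
  case=> j _ /=; rewrite in_itv/= => /andP[]; case: c => [x|]//= xz _.
  by rewrite in_itv/= xz.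
move=> cz; exists (Num.truncn `|z|).+1 => //=.
have zj : `|z| <= (Num.truncn `|z|).+1%:R by rewrite ltW// truncnS_gt.
rewrite in_itv/= (le_trans (ler_norm _) zj) andbT.
case: c cz => [x|_]/=; first by rewrite in_itv/= andbT.
by rewrite lerNl (le_trans _ zj)// -normrN ler_norm.
Qed.

Let sub_ray c : {homo (fun j : nat => `[lo c j, j%:R]%classic) : m n / (m <= n)%N >-> (m <= n)%O}.
Proof.
move=> m n mn; apply/subsetPset => z /=; rewrite !in_itv/= => /andP[zl zr].
have mn' : m%:R <= n%:R :> R by rewrite ler_nat.
rewrite (le_trans zr)// andbT; case: c zl => [x|]//=.
by apply: le_trans; rewrite lerN2.
Qed.

Let gauss_ray_cvg c :
  fine (gauss s `[lo c j, j%:R]%classic) @[j --> \oo] --> fine (gauss s (ray c)).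
Proof.
rewrite -bigcup_ray; apply: fine_cvg.
rewrite fineK; last by apply: fin_num_measure; apply: bigcup_measurable.
apply: nondecreasing_cvg_mu => //; try exact: bigcup_measurable.
Qed.

Lemma gauss_rays (c : 'I_d -> option R) :
  P (A `&` [set w | forall k, ray (c k) (V w k)]) =
  (P A * (\prod_(k < d) fine (gauss s (ray (c k))))%:E)%E.
Proof.
pose S j := A `&` [set w | forall k, lo (c k) j <= V w k <= j%:R].
have mS j : measurable (S j).
  apply: measurableI => //.
  rewrite (_ : [set _ | _] = \bigcap_(k in [set: 'I_d])
      ((fun w => V w k) @^-1` `[lo (c k) j, j%:R]%classic)).
    apply: fin_bigcap_measurable => // k _; rewrite -[X in measurable X]setTI.
    exact: mV.
  apply/seteqP; split => w /= h k; first by move=> _; rewrite /= in_itv/=.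
  by have := h k I; rewrite /= in_itv.
have -> : A `&` [set w | forall k, ray (c k) (V w k)] = \bigcup_j S j.
  rewrite /S -setI_bigcupr; congr (_ `&` _); apply/seteqP; split => w /=.
    move=> h.
    have /choice[f fh] : forall k, exists j, `[lo (c k) j, j%:R]%classic (V w k).
      by move=> k; have := h k; rewrite -bigcup_ray => -[j _ ?]; exists j.
    exists (\max_(k < d) f k)%N => //= k.
    have := fh k; rewrite -[X in _ -> is_true X]/(V w k \in `[_, _]).
    have /subsetPset := @sub_ray (c k) (f k) (\max_(k < d) f k)%N (leq_bigmax _).
    by move=> /[apply].
  move=> [j _ /= h] k; rewrite -bigcup_ray; exists j => //=.
  by rewrite in_itv/= h.
have ndS : {homo S : m n / (m <= n)%N >-> (m <= n)%O}.
  move=> m n mn; apply/subsetPset => w [Aw /= h]; split => //= k.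
  have /subsetPset := @sub_ray (c k) m n mn.
  by move=> /(_ (V w k)); rewrite /= !in_itv/=; apply.
have c1 : P (S j) @[j --> \oo] --> P (\bigcup_j S j).
  by apply: nondecreasing_cvg_mu => //; exact: bigcup_measurable.
have c2 : P (S j) @[j --> \oo] --> (P A * (\prod_(k < d) fine (gauss s (ray (c k))))%:E)%E.
  have -> : (fun j => P (S j)) =
      (fun j => P A * (\prod_(k < d) fine (gauss s `[lo (c k) j, j%:R]%classic))%:E)%E.
    by apply/funext => j; rewrite boxE.
  apply: cvgeZl; first exact: fin_num_measure.
  apply: cvg_EFin; first by near=> n; [].
  apply: cvg_big => [|k _]; first exact: mul_continuous.
  exact: gauss_ray_cvg.
exact: (cvg_unique _ c1 c2).
Unshelve. all: by end_near. Qed.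

(** The constant [c] absorbs the probability of the conditioning event and of constraints on another
    coordinate, so the passage from rays to measurable sets can be made one coordinate at a time. *)
Lemma gauss_law_rays (A' : set T) (W : T -> R) (c : \bar R) :
  measurable A' -> measurable_fun setT W -> (0 <= c)%E -> c \is a fin_num ->
  (forall x, P (A' `&` W @^-1` `[x, +oo[%classic) = (c * gauss s `[x, +oo[%classic)%E) ->
  forall U, measurable U -> P (A' `&` W @^-1` U) = (c * gauss s U)%E.
Proof.
move=> mA' mW c0 cfin hr U mU.
pose r := NngNum (fine_ge0 c0).
have rE : c = (r%:num)%:E by rewrite /= fineK.
rewrite setIC rE.
apply: (@measure_eq_rays (pushforward (mrestr P mA') W) (mscale r (gauss s))) => //.
  rewrite /= /pushforward /mrestr preimage_setT setTI.
  exact: le_lt_trans (probability_le1 _ mA') (ltry _).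
by move=> x; rewrite /= /pushforward /mrestr /mscale/= -rE setIC.
Qed.

Lemma gauss_law1 k U : measurable U ->
  P (A `&` (fun w => V w k) @^-1` U) = (P A * gauss s U)%E.
Proof.
move=> mU; apply: gauss_law_rays => //; first exact: fin_num_measure.
move=> x; have := gauss_rays (fun i => if i == k then Some x else None).
rewrite (bigD1 k)//= eqxx big1 ?mulr1; last first.
  by move=> i /negbTE -> /=; rewrite gauss_setT.
rewrite fineK; last by apply: fin_num_measure; exact: mray.
move=> <-; congr (P (_ `&` _)).
apply/seteqP; split => w /=; last by move=> /(_ k); rewrite eqxx.
by move=> h i; case: eqP => // ->.
Qed.

(** Two coordinates suffice, since a second order expansion involves only pairs. Rays are upgraded
    to measurable sets first in coordinate [k], then in [l]; uniqueness of the product measure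
    concludes. *)
Lemma gauss_law2 k l S : k != l -> measurable S ->
  P (A `&` (fun w => (V w k, V w l)) @^-1` S) = (P A * (gauss s \x gauss s) S)%E.
Proof.
move=> kl mS.
have mpre i (U : set R) : measurable U -> measurable ((fun w => V w i) @^-1` U).
  by move=> mU; rewrite -[X in measurable X]setTI; exact: mV.
have PA : P A \is a fin_num by exact: fin_num_measure.
have law x U : measurable U ->
    P (A `&` (fun w => V w l) @^-1` `[x, +oo[%classic `&` (fun w => V w k) @^-1` U) =
    (P A * gauss s `[x, +oo[%classic * gauss s U)%E.
  move=> mU; apply: gauss_law_rays => //.
  - by apply: measurableI => //; exact: mpre.
  - exact: mule_ge0.
  - by rewrite fin_numM// fin_num_measure.
  move=> y; have := gauss_rays (fun i => if i == k then Some y else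
    if i == l then Some x else None).
  have lk : (l == k) = false by rewrite eq_sym (negbTE kl).
  rewrite (bigD1 k)//= eqxx (bigD1 l) ?lk//= ?lk eqxx.
  rewrite big1 ?mulr1; last first.
    by move=> i /andP[/negbTE -> /negbTE ->] /=; rewrite gauss_setT.
  have fx z : gauss s `[z, +oo[%classic \is a fin_num by exact: fin_num_measure.
  rewrite EFinM (fineK (fx y)) (fineK (fx x)).
  move=> e; rewrite muleAC -muleA -e -setIA; congr (P (_ `&` _)).
  apply/seteqP; split => w /=.
    by move=> [wl wk] i; case: eqP => [->//|_]; case: eqP => [->//|].
  move=> h; split; last by have := h k; rewrite eqxx.
  by have := h l; rewrite lk eqxx.
have law2 U W : measurable U -> measurable W ->
    P (A `&` (fun w => V w k) @^-1` U `&` (fun w => V w l) @^-1` W) =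
    (P A * gauss s U * gauss s W)%E.
  move=> mU mW; apply: gauss_law_rays => //.
  - by apply: measurableI => //; exact: mpre.
  - exact: mule_ge0.
  - by rewrite fin_numM// fin_num_measure.
  by move=> x; rewrite setIAC law// muleAC.
have mVV : measurable_fun setT (fun w => (V w k, V w l)) by exact: measurable_fun_pair.
pose r := NngNum (fine_ge0 (measure_ge0 P A)).
have rE : P A = (r%:num)%:E by rewrite /= fineK.
rewrite setIC rE.
pose C : set (set (R * R)) :=
  [set C | exists A, measurable A /\ exists B, measurable B /\ C = A `*` B].
apply: (@measure_unique _ R (R * R)%type C (fun=> setT) _ _ _ _
  (pushforward (mrestr P mA) (fun w => (V w k, V w l))) (mscale r (gauss s \x gauss s)%E)) => //.
- rewrite measurable_prod_measurableType //; congr (<<s _ >>).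
  rewrite predeqE; split => [[U mU [W mW <-]]|[U [mU [W [mW ->]]]]].
    by exists U; split => //; exists W.
  by exists U => //; exists W.
- move=> _ _ [X1 [mX1 [X2 [mX2 ->]]]] [Y1 [mY1 [Y2 [mY2 ->]]]].
  rewrite -setXI; exists (X1 `&` Y1); split; first exact: measurableI.
  by exists (X2 `&` Y2); split => //; exact: measurableI.
- by move=> _; exists setT; split => //; exists setT; split => //; rewrite setXTT.
- by rewrite bigcup_const//; exists 0%N.
- move=> _ [U [mU [W [mW ->]]]].
  rewrite /= /pushforward /mrestr /mscale/= product_measure1E// muleA -rE -law2//.
  by rewrite setIC setIA.
- move=> _; rewrite /= /pushforward /mrestr preimage_setT setTI.
  exact: le_lt_trans (probability_le1 _ mA) (ltry _).
Qed.

End GaussianVector.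

Section BrownianIncrement.
Context (d : nat) (F : R -> set (set T)) (B : R -> T -> 'I_d -> R).
Hypothesis filF : filtration F.
Hypothesis BM : brownian P F B.
Variables (s t : R).
Hypotheses (s0 : 0 <= s) (st : s < t).

Let dB w k := B t w k - B s w k.
Let sg := Num.sqrt (t - s).
Let sg0 : 0 < sg. Proof. by rewrite sqrtr_gt0 subr_gt0. Qed.

Lemma meas_wrt_measurable r (f : T -> R) : meas_wrt (F r) f -> measurable_fun setT f.
Proof. by move=> mf _ C mC; rewrite setTI; case: filF => _ + _; apply; exact: mf. Qed.

Let mdB k : measurable_fun setT (fun w => dB w k).
Proof.
have [aB _ _ _] := BM; apply: measurable_funB.
  exact/(meas_wrt_measurable (aB _ _ (ltW (le_lt_trans s0 st)))).
exact: (meas_wrt_measurable (aB _ _ s0)).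
Qed.

Let box A (FA : F s A) (al be : 'I_d -> R) :
  P (A `&` [set w | forall k, al k <= dB w k <= be k]) =
  (P A * (\prod_(k < d)
     \int[lebesgue_measure]_(x in `[al k, be k]) normal_pdf 0 sg x)%:E)%E.
Proof. by have [_ _ _] := BM; apply. Qed.

Let FT : F s setT.
Proof.
have [/(_ s)[F0 FC _] _ _] := filF.
by rewrite -[X in F s X](setD0) ; exact: FC.
Qed.

Let Fm A : F s A -> measurable A. Proof. by case: filF => _ + _; apply. Qed.

Section weighted.
Variables (xi : T -> R) (C : R).
Hypotheses (mxi : meas_wrt (F s) xi) (bxi : forall w, `|xi w| <= C).

Let mx : measurable_fun setT xi. Proof. exact: meas_wrt_measurable mxi. Qed.

Lemma bounded_integrable (f : T -> R) K : measurable_fun setT f ->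
  (forall w, `|f w| <= K) -> P.-integrable setT (EFin \o f).
Proof.
move=> mf bf; apply: (@le_integrable _ _ _ _ _ _ _ (EFin \o cst K)) => //.
- exact/measurable_EFinP.
- by move=> w _ /=; rewrite lee_fin (le_trans (bf w))// ler_norm.
- exact: finite_measure_integrable_cst.
Qed.

Let X : {mfun T >-> R} := HB.pack xi (isMeasurableFun.Build _ _ _ _ xi mx).

(** Replaces conditional expectations: the product formula over all events of [F s], applied to the
    preimages under [xi], says that [xi] and [Y] are independent. *)
Let ind d2 (E2 : measurableType d2) (m2 : probability E2 R) (Y : T -> E2) (f : E2 -> R) :
  measurable_fun setT Y -> measurable_fun setT f ->
  (forall A U, F s A -> measurable U -> P (A `&` Y @^-1` U) = (P A * m2 U)%E) ->
  m2.-integrable setT (EFin \o f) ->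
  P.-integrable setT (fun w => (xi w * f (Y w))%:E) /\
  \int[P]_w (xi w * f (Y w)) = \int[P]_w xi w * \int[m2]_x f x.
Proof.
move=> mY mf h i2.
have ixi : P.-integrable setT (EFin \o xi) by exact: bounded_integrable bxi.
have i1 : (distribution P X).-integrable setT (EFin \o id).
  by apply: integrable_pushforward => //; exact: EFin_measurable.
have [|i e] := indep_Rintegral (m1 := distribution P X) (m2 := m2) (f1 := id)
    mx mY (@measurable_id _ R setT) mf _ i1 i2.
  by move=> A U mA mU; rewrite h//; exact: mxi.
split => //; rewrite e; congr (_ * _); congr fine.
by rewrite integral_pushforward//; exact: EFin_measurable.
Qed.

Lemma increment_mean k : P.-integrable setT (fun w => (xi w * dB w k)%:E) /\
  \int[P]_w (xi w * dB w k) = 0.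
Proof.
have [|i e] := @ind _ R (gauss sg) (fun w => dB w k) id (mdB k) (@measurable_id _ R setT) _
    (gauss_id_integrable sg0).
  by move=> A U FA mU; apply: gauss_law1 => //; [exact: Fm|exact: box].
by split => //; rewrite e gauss_mean// mulr0.
Qed.

Lemma increment_sqr k : P.-integrable setT (fun w => (xi w * dB w k ^+ 2)%:E) /\
  \int[P]_w (xi w * dB w k ^+ 2) = \int[P]_w xi w * \int[gauss sg]_x x ^+ 2.
Proof.
apply: (@ind _ R (gauss sg) (fun w => dB w k) (fun x => x ^+ 2) (mdB k)).
- exact: measurable_funX.
- by move=> A U FA mU; apply: gauss_law1 => //; [exact: Fm|exact: box].
- exact: gauss_sqr_integrable.
Qed.

Lemma increment_cov k l : k != l ->
  P.-integrable setT (fun w => (xi w * (dB w k * dB w l))%:E) /\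
  \int[P]_w (xi w * (dB w k * dB w l)) = 0.
Proof.
move=> kl; have [ii ee] := Rintegral_prod_mul (gauss_id_integrable sg0) (gauss_id_integrable sg0).
have m1 : measurable_fun setT (fun w => (dB w k, dB w l)) by exact: measurable_fun_pair.
have m2 : measurable_fun [set: R * R] (fun z => z.1 * z.2).
  by apply/measurable_EFinP; exact: measurable_int ii.
have law A U : F s A -> measurable U ->
    P (A `&` (fun w => (dB w k, dB w l)) @^-1` U) = (P A * (gauss sg \x gauss sg) U)%E.
  by move=> FA mU; apply: gauss_law2 => //; [exact: Fm|exact: box].
have [i e] := @ind _ (R * R)%type (gauss sg \x gauss sg)%E _ _ m1 m2 law ii.
by split => //; rewrite e [X in _ * X]ee gauss_mean// !mulr0.
Qed.

End weighted.

Lemma increment_cube k : P.-integrable setT (fun w => (`|dB w k| ^+ 3)%:E) /\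
  \int[P]_w (`|dB w k| ^+ 3) <= 48 * sg ^+ 3.
Proof.
have mc : measurable_fun [set: R] (fun x : R => (`|x| ^+ 3)%:E).
  by apply/measurable_EFinP; apply: measurable_funX; exact: normr_measurable.
have eqm U : measurable U -> pushforward P (fun w => dB w k) U = gauss sg U.
  move=> mU; have := gauss_law1 measurableT mdB (box FT) k mU.
  by rewrite setTI probability_setT mul1e.
have le48 := normal_cube_moment sg0.
have e48 : (\int[P]_w (`|dB w k| ^+ 3)%:E = \int[gauss sg]_x (`|x| ^+ 3)%:E)%E.
  transitivity (\int[pushforward P (fun w => dB w k)]_x (`|x| ^+ 3)%:E)%E; last first.
    by apply: eq_measure_integral => U mU _; exact: eqm.
  by rewrite ge0_integral_pushforward// => y _; rewrite lee_fin exprn_ge0.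
split; last first.
  rewrite /Rintegral e48 -lee_fin fineK//; rewrite ge0_fin_numE.
    exact: le_lt_trans le48 (ltry _).
  by apply: integral_ge0 => x _; rewrite lee_fin exprn_ge0.
apply/integrableP; split; first exact: (measurableT_comp mc).
under eq_integral do rewrite gee0_abs ?lee_fin ?exprn_ge0//.
by rewrite e48; exact: le_lt_trans le48 (ltry _).
Qed.

End BrownianIncrement.
End Independence.

(** * The Lyapunov function *)

Ltac nneg := solve [repeat first [ done | by apply: ltW | by apply: sqr_ge0 | apply: addr_ge0 | apply: mulr_ge0
  | apply: exprn_ge0 | rewrite invr_ge0 | apply: normr_ge0 ]].

Section Lyapunov.
Variable R : realType.
Implicit Types (r e K D z : R).

(** The remainder [g] has derivative [(x - 1) ^+ 2 / x >= 0]. For [z > 0] it is thus nonnegative;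
    the cubic term is needed only for [z < 0], where the intermediate point is at least [e]. *)
Lemma ln_taylor_ge (e z : R) : 0 < e -> e <= 1 -> e <= 1 + z ->
  z - z ^+ 2 / 2 - `|z| ^+ 3 / e <= ln (1 + z).
Proof.
move=> e0 e1 ez.
pose g (x : R) := ln x - (x - 1) + (x - 1) ^+ 2 / 2.
have dg (x : R) : 0 < x -> is_derive x 1 g ((x - 1) ^+ 2 / x).
  move=> x0; have := is_derive1_ln x0 => dl.
  rewrite /g; apply: is_derive_eq.
  rewrite /GRing.scale/=; field; rewrite gt_eqF//.
have cg (a b : R) : 0 < a -> {within `[a, b], continuous g}.
  move=> a0; apply: derivable_within_continuous => x; rewrite in_itv/= => /andP[ax _].
  by have [] := dg x (lt_le_trans a0 ax).
have g1 : g 1 = 0 by rewrite /g ln1 subrr expr0n/= mul0r; ring.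
suff : - (`|z| ^+ 3 / e) <= g (1 + z) by rewrite /g (addrC 1) addrK; lra.
have ze : 0 <= `|z| ^+ 3 / e by rewrite divr_ge0 ?exprn_ge0// ltW.
have [z0|z0|->] := ltrgtP z 0; last first.
- by rewrite addr0 g1 normr0 expr0n/= mul0r oppr0.
- have h1 : 1 < 1 + z by rewrite ltrDl.
  have h2 x : x \in `]1, 1 + z[ -> is_derive x 1 g ((x - 1) ^+ 2 / x).
    by rewrite in_itv/= => /andP[xl _]; apply: dg; lra.
  have [c] := MVT h1 h2 (cg _ _ ltr01); rewrite in_itv/= => /andP[c1 c2] ec.
  rewrite -[g _]subr0 -g1 ec; apply: (@le_trans _ _ 0); first by rewrite oppr_le0.
  by rewrite mulr_ge0 ?divr_ge0 ?sqr_ge0//; lra.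
- have h1 : 1 + z < 1 by lra.
  have zp : 0 < 1 + z by lra.
  have h2 x : x \in `]1 + z, 1[ -> is_derive x 1 g ((x - 1) ^+ 2 / x).
    by rewrite in_itv/= => /andP[xl _]; apply: dg; lra.
  have [c] := MVT h1 h2 (cg _ _ zp); rewrite in_itv/= => /andP[c1 c2] ec.
  have -> : g (1 + z) = - (((c - 1) ^+ 2 / c) * (1 - (1 + z))) by rewrite -ec g1; ring.
  have -> : 1 - (1 + z) = - z by ring.
  rewrite lerN2 (ltr0_norm z0).
  have -> : (- z) ^+ 3 / e = (- z) ^+ 2 / e * (- z) by ring.
  rewrite ler_wpM2r//; first lra.
  have c0 : 0 < c by lra.
  apply: ler_pM; try nneg; last by rewrite lef_pV2 ?posrE//; lra.
  by rewrite -(sqrrN (c - 1)) ler_sqr ?nnegrE; lra.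
Qed.

Definition lyapG K r := ln r + K * r.
(** With [lyapG] regarded as a function of [r ^+ 2], [lyap_alpha] is its first derivative and
    [- lyap_beta] half of its second one. *)
Definition lyap_alpha K r := (r^-1 + K) / (2 * r).
Definition lyap_beta K r := (2 * r^-1 + K) / (8 * r ^+ 3).

(** The expansion is in the increment [D] of the square, because the squared distance is polynomial
    in the displacement whereas the distance is not. *)
Lemma lyapG_taylor (K lo hi : R) : 0 <= K -> 0 < lo -> lo <= hi ->
  exists2 C, 0 <= C & forall r r' D, lo <= r <= hi -> lo <= r' <= hi -> D = r' ^+ 2 - r ^+ 2 ->
  lyap_alpha K r * D - lyap_beta K r * D ^+ 2 - C * `|D| ^+ 3 <= lyapG K r' - lyapG K r.
Proof.
move=> K0 lo0 lohi; have hi0 : 0 < hi by lra.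
(* The first summand bounds the remainder of the logarithm, the other three the cubic terms of [i1],
   [i2], [i3]. Division by [(2 * lo) ^+ 3] passes from [e] to [D]. *)
pose Y := hi / lo / lo ^+ 3 + (lo^-1 + K) * (4 * hi) / (8 * lo ^+ 3) + 1 / (2 * lo ^+ 3)
  + hi / (8 * lo ^+ 4).
have Y0 : 0 <= Y by rewrite /Y; nneg.
exists (Y / (2 * lo) ^+ 3).
  by rewrite divr_ge0// exprn_ge0// mulr_ge0// ltW.
move=> r r' D /andP[lr rh] /andP[lr' rh'] DE.
have r0 : 0 < r by lra. have r'0 : 0 < r' by lra.
pose e := r' - r.
have De : D = 2 * r * e + e ^+ 2 by rewrite DE /e; ring.
have eD : `|e| <= `|D| / (2 * lo).
  rewrite ler_pdivlMr ?mulr_gt0//.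
  have -> : D = e * (r' + r) by rewrite DE /e; ring.
  by rewrite normrM ler_wpM2l// ger0_norm; lra.
have eh : `|e| <= hi by rewrite /e ler_norml; apply/andP; split; lra.
have e3 : 0 <= `|e| ^+ 3 by exact: exprn_ge0.
have eD3 : `|e| ^+ 3 <= `|D| ^+ 3 / (2 * lo) ^+ 3.
  by rewrite -expr_div_n lerXn2r// nnegrE// divr_ge0// mulr_ge0// ltW.
suff main : lyap_alpha K r * D - lyap_beta K r * D ^+ 2 - Y * `|e| ^+ 3 <= lyapG K r' - lyapG K r.
  apply: le_trans main; rewrite lerB// -mulrA ler_wpM2l//.
  by rewrite mulrC.
have lnE : ln r' - ln r = ln (1 + e / r).
  by rewrite -ln_div ?posrE//; congr ln; rewrite /e; field; rewrite gt_eqF.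
have q1 : lo / hi <= 1 by rewrite ler_pdivrMr ?mul1r.
have q2 : lo / hi <= 1 + e / r.
  have -> : 1 + e / r = r' / r by rewrite /e; field; rewrite gt_eqF.
  by rewrite ler_pdivrMr// mulrAC ler_pdivlMr// ler_pM// ltW.
have := ln_taylor_ge (divr_gt0 lo0 hi0) q1 q2; rewrite -lnE.
rewrite normrM normrV ?unitfE ?gt_eqF// (gtr0_norm r0) exprMn exprVn invf_div.
have ih : `|e| ^+ 3 / r ^+ 3 * (hi / lo) <= `|e| ^+ 3 * (hi / lo / lo ^+ 3).
  rewrite -mulrA ler_wpM2l// mulrC ler_wpM2l ?divr_ge0 ?(ltW lo0) ?(ltW hi0)//.
  by rewrite lef_pV2 ?posrE ?exprn_gt0// lerXn2r ?nnegrE ?(ltW lo0) ?(ltW r0).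
have bnd (A M : R) : `|A| <= M -> - (`|e| ^+ 3 * M) <= e ^+ 3 * A.
  move=> AM; rewrite lerNl -mulrN; apply: le_trans (ler_norm _) _.
  by rewrite normrM normrX normrN ler_wpM2l.
have rV : r^-1 <= lo^-1 by rewrite lef_pV2 ?posrE.
have rX p : (r ^+ p)^-1 <= (lo ^+ p)^-1.
  by rewrite lef_pV2 ?posrE ?exprn_gt0// lerXn2r ?nnegrE ?(ltW lo0) ?(ltW r0).
have i1 : - (`|e| ^+ 3 * ((lo^-1 + K) * (4 * hi) / (8 * lo ^+ 3))) <=
    e ^+ 3 * ((r^-1 + K) * (3 * r + r') / (8 * r ^+ 3)).
  apply: bnd; rewrite ger0_norm; last by nneg.
  rewrite !(invfM 8); apply: ler_pM; try nneg.
    by apply: ler_pM; try nneg; lra.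
  by rewrite ler_wpM2l.
have i2 : - (`|e| ^+ 3 * (1 / (2 * lo ^+ 3))) <= e ^+ 3 * (1 / (2 * r ^+ 3)).
  apply: bnd; rewrite ger0_norm; last by nneg.
  by rewrite !mul1r !(invfM 2) ler_wpM2l.
have i3 : - (`|e| ^+ 3 * (hi / (8 * lo ^+ 4))) <= e ^+ 3 * (e / (8 * r ^+ 4)).
  apply: bnd; rewrite normrM; apply: ler_pM; try nneg; rewrite //.
  rewrite ger0_norm; last by nneg.
  by rewrite !(invfM 8) ler_wpM2l.
(* An exact identity: the second order expansions in [e] and in [D] differ only by terms divisible
   by [e ^+ 3]. *)
have id : (e / r - (e / r) ^+ 2 / 2) + K * (r' - r) =
    lyap_alpha K r * D - lyap_beta K r * D ^+ 2 +
    (e ^+ 3 * ((r^-1 + K) * (3 * r + r') / (8 * r ^+ 3)) + e ^+ 3 * (1 / (2 * r ^+ 3))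
     + e ^+ 3 * (e / (8 * r ^+ 4))).
  rewrite De /lyap_alpha /lyap_beta; have -> : r' = r + e by rewrite /e; ring.
  by field; rewrite gt_eqF.
rewrite /lyapG /Y; lra.
Qed.


Lemma lyapG_le (K r r' : R) : 0 <= K -> 0 < r -> r <= r' -> lyapG K r <= lyapG K r'.
Proof.
move=> K0 r0 rr; rewrite /lyapG lerD ?ler_wpM2l// ler_ln ?posrE//.
exact: lt_le_trans rr.
Qed.

Lemma lyapG_lip (K e r r' : R) : 0 <= K -> 0 < e -> e <= r -> e <= r' ->
  `|lyapG K r' - lyapG K r| <= (e^-1 + K) * `|r' - r|.
Proof.
move=> K0 e0; wlog : r r' / r <= r'.
  move=> H er er'; have [rr|rr] := leP r r'; first exact: H.
  by rewrite distrC (distrC r'); apply: H => //; exact: ltW.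
move=> rr er er'.
have r0 : 0 < r by lra. have r'0 : 0 < r' by lra.
rewrite !ger0_norm ?subr_ge0 ?lyapG_le//.
have h : ln r' - ln r <= (r' - r) / e.
  rewrite -ln_div ?posrE//; apply: (@le_trans _ _ (r' / r - 1)).
    have := @le_ln1Dx R (r' / r - 1); rewrite [1 + _]addrC subrK; apply.
    by rewrite ltrBrDl subrr divr_gt0.
  have -> : r' / r - 1 = (r' - r) / r by field; rewrite gt_eqF.
  by rewrite ler_wpM2l ?subr_ge0// lef_pV2 ?posrE.
rewrite /lyapG mulrDl; move: h; rewrite (mulrC _ e^-1); lra.
Qed.

(* The generator applied to [lyapG] of the regularized distance dominates the worst drift. *)
Lemma lyap_drift (K r u tr c C1 : R) : 0 < r -> 0 <= u <= r ^+ 2 -> 2 <= tr ->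
  0 < c -> 0 <= K -> 0 <= C1 -> K * r <= 1 -> 4 * C1 <= c * K ->
  2 * lyap_alpha K r * C1 * r <= c * (lyap_alpha K r * tr - 4 * lyap_beta K r * u) /\
  0 <= lyap_alpha K r * tr - 4 * lyap_beta K r * u.
Proof.
move=> r0 /andP[u0 ur] tr2 c0 K0 C10 Kr cK.
have V0 : 0 < r^-1 by rewrite invr_gt0.
have a0 : 0 <= lyap_alpha K r by rewrite /lyap_alpha; nneg.
have b0 : 0 <= lyap_beta K r by rewrite /lyap_beta; nneg.
have h1 : lyap_alpha K r * 2 <= lyap_alpha K r * tr by rewrite ler_wpM2l.
have h2 : lyap_beta K r * u <= lyap_beta K r * r ^+ 2 by rewrite ler_wpM2l.
(* At trace 2 the contributions of the logarithm cancel exactly, as in the plane, and what the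
   linear term [K * r] adds remains. This is the place where codimension at least 2 enters; the
   surplus of order [K / r] then beats the drift. *)
have e1 : lyap_alpha K r * 2 - 4 * (lyap_beta K r * r ^+ 2) = K / (2 * r).
  by rewrite /lyap_alpha /lyap_beta; field; rewrite gt_eqF.
have Kr0 : 0 <= K / (2 * r) by nneg.
split; last by lra.
have : c * (K / (2 * r)) <= c * (lyap_alpha K r * tr - 4 * lyap_beta K r * u).
  by rewrite ler_pM2l//; lra.
apply: le_trans.
have -> : 2 * lyap_alpha K r * C1 * r = (C1 + C1 * (K * r)) / r.
  by rewrite /lyap_alpha; field; rewrite gt_eqF.
have -> : c * (K / (2 * r)) = (c * K / 2) / r by field; rewrite gt_eqF.
rewrite ler_pM2r//.
have : C1 * (K * r) <= C1 * 1 by rewrite ler_wpM2l.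
lra.
Qed.

Section Vector.
Variable d : nat.
Implicit Types (y v a b : 'I_d -> R).

Definition norm1 v : R := \sum_k `|v k|.

Lemma norm1_ge0 v : 0 <= norm1 v. Proof. exact: sumr_ge0. Qed.

Lemma norm1D v a : norm1 (v + a) <= norm1 v + norm1 a.
Proof. by rewrite -big_split/=; apply: ler_sum => k _; exact: ler_normD. Qed.

Lemma norm1Z (c : R) v : norm1 (fun k => c * v k) = `|c| * norm1 v.
Proof. by rewrite mulr_sumr; apply: eq_bigr => k _; rewrite normrM. Qed.

Lemma normr_norm1 v k : `|v k| <= norm1 v.
Proof. by rewrite /norm1 (bigD1 k)//= lerDl sumr_ge0. Qed.

Lemma dotvC y v : dotv y v = dotv v y.
Proof. by apply: eq_bigr => k _; rewrite mulrC. Qed.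

Lemma dotvDl y v a : dotv (y + v) a = dotv y a + dotv v a.
Proof. by rewrite -big_split/=; apply: eq_bigr => k _; rewrite mulrDl. Qed.

Lemma dotvDr y v a : dotv a (y + v) = dotv a y + dotv a v.
Proof. by rewrite dotvC dotvDl !(dotvC a). Qed.

Lemma dotvv_ge0 v : 0 <= dotv v v.
Proof. by apply: sumr_ge0 => k _; rewrite -expr2 sqr_ge0. Qed.

Lemma dotv_norm1 y v (M : R) : (forall k, `|y k| <= M) -> `|dotv y v| <= M * norm1 v.
Proof.
move=> yM; rewrite mulr_sumr; apply: le_trans (ler_norm_sum _ _ _) _.
by apply: ler_sum => k _; rewrite normrM ler_wpM2r.
Qed.

Lemma coord_le_sqrt y (M : R) k : 0 <= M -> dotv y y <= M ^+ 2 -> `|y k| <= M.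
Proof.
move=> M0 yM; rewrite -(ler_pXn2r (n := 2))// ?nnegrE// real_normK ?num_real//.
apply: le_trans yM; rewrite /dotv (bigD1 k)//= -expr2 lerDl.
by apply: sumr_ge0 => j _; rewrite -expr2 sqr_ge0.
Qed.

Lemma dotvv_norm1 v : dotv v v <= norm1 v ^+ 2.
Proof.
rewrite expr2; apply: le_trans (ler_norm _) _.
by apply: dotv_norm1 => k; exact: normr_norm1.
Qed.

Definition rho (e : R) y := Num.sqrt (dotv y y + e ^+ 2).

Lemma rho_sqr e y : rho e y ^+ 2 = dotv y y + e ^+ 2.
Proof. by rewrite sqr_sqrtr// addr_ge0 ?dotvv_ge0 ?sqr_ge0. Qed.

Lemma rho_ge e y : 0 < e -> e <= rho e y.
Proof.
move=> e0; rewrite -(ler_pXn2r (n := 2))// ?nnegrE ?sqrtr_ge0 ?(ltW e0)// rho_sqr.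
by rewrite lerDr dotvv_ge0.
Qed.

Lemma coord_le_rho e y k : `|y k| <= rho e y.
Proof.
by apply: coord_le_sqrt; [exact: sqrtr_ge0|rewrite rho_sqr lerDl sqr_ge0].
Qed.

Lemma dotv_rho e y v : `|dotv y v| <= rho e y * norm1 v.
Proof. by apply: dotv_norm1 => k; exact: coord_le_rho. Qed.

Lemma dotvvD y v : dotv (y + v) (y + v) = dotv y y + (2 * dotv y v + dotv v v).
Proof. by rewrite dotvDl !dotvDr (dotvC v y); ring. Qed.

Lemma rho_sqrD e y v : rho e (y + v) ^+ 2 - rho e y ^+ 2 = 2 * dotv y v + dotv v v.
Proof. by rewrite !rho_sqr dotvvD; ring. Qed.

Lemma rho_lip e y v : 0 < e -> `|rho e (y + v) - rho e y| <= norm1 v.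
Proof.
move=> e0; have h1 := rho_ge y e0; have h2 := rho_ge (y + v) e0.
have s0 : 0 < rho e (y + v) + rho e y by lra.
rewrite -(ler_pM2l s0) -{1}(gtr0_norm s0) -normrM.
have -> : (rho e (y + v) + rho e y) * (rho e (y + v) - rho e y) =
    dotv (y + v) v + dotv y v.
  have -> : (rho e (y + v) + rho e y) * (rho e (y + v) - rho e y) =
    rho e (y + v) ^+ 2 - rho e y ^+ 2 by ring.
  by rewrite rho_sqrD dotvDl; ring.
apply: le_trans (ler_normD _ _) _; rewrite mulrDl.
by apply: lerD; exact: dotv_rho.
Qed.


Lemma min_lip (x y c : R) : `|Num.min x c - Num.min y c| <= `|x - y|.
Proof.
have h1 := ler_norm (x - y); have h2 : y - x <= `|x - y| by rewrite distrC ler_norm.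
have h3 := normr_ge0 (x - y).
by rewrite ler_norml; have [|] := leP x c; have [|] := leP y c => *; apply/andP; split; lra.
Qed.

Section Truncated.
Variables (K c0 e : R).
Hypotheses (K0 : 0 <= K) (c00 : 0 < c0) (e0 : 0 < e) (ec0 : e <= c0).

(* [e] regularizes the logarithm at the origin; the cut-off at [c0] makes [lyap] bounded. *)
Definition lyap y := lyapG K (Num.min (rho e y) c0).

Lemma lyap_ge y : lyapG K e <= lyap y.
Proof. by apply: lyapG_le => //; rewrite le_min rho_ge. Qed.

Lemma lyap_le y : lyap y <= lyapG K c0.
Proof.
apply: lyapG_le => //; last by rewrite ge_min lexx orbT.
by rewrite lt_min c00 (lt_le_trans e0)// rho_ge.
Qed.

Lemma lyap_in y : rho e y <= c0 -> lyap y = lyapG K (rho e y).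
Proof. by move=> h; rewrite /lyap min_l. Qed.

Ltac slra := move: K0 c00 e0 ec0; lra.

Let amax : R := (e^-1 + K) / (2 * e).
Let bmax : R := (2 * e^-1 + K) / (8 * e ^+ 3).

Let amax0 : 0 <= amax. Proof. by rewrite /amax; nneg. Qed.
Let bmax0 : 0 <= bmax. Proof. by rewrite /bmax; nneg. Qed.

Lemma lyap_alpha_bound r : e <= r -> 0 <= lyap_alpha K r <= amax.
Proof.
move=> er; have r0 : 0 < r by slra.
rewrite /lyap_alpha; apply/andP; split; first by nneg.
have rV : r^-1 <= e^-1 by rewrite lef_pV2 ?posrE.
apply: ler_pM; try nneg; first slra.
by rewrite lef_pV2 ?posrE ?mulr_gt0// ler_wpM2l.
Qed.

Lemma lyap_beta_bound r : e <= r -> 0 <= lyap_beta K r <= bmax.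
Proof.
move=> er; have r0 : 0 < r by slra.
rewrite /lyap_beta; apply/andP; split; first by nneg.
have rV : r^-1 <= e^-1 by rewrite lef_pV2 ?posrE.
apply: ler_pM; try nneg; first slra.
by rewrite lef_pV2 ?posrE ?mulr_gt0 ?exprn_gt0// ler_wpM2l// lerXn2r ?nnegrE ?(ltW e0) ?(ltW r0).
Qed.

(** Displacements with [norm1 v <= c0 / 2] stay below the cut-off, where [lyapG_taylor] applies
    (error [C1]). For larger ones [norm1 v ^+ 3] is bounded below, and the cubic error dominates
    both the range of [lyap] and the polynomial terms (error [C2]). *)
Lemma lyap_taylor : exists2 C, 0 <= C & forall y v, rho e y <= c0 / 2 ->
  lyap y + lyap_alpha K (rho e y) * (2 * dotv y v + dotv v v)
    - 4 * lyap_beta K (rho e y) * dotv y v ^+ 2 - C * norm1 v ^+ 3 <= lyap (y + v).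
Proof.
have [C C0 HC] := lyapG_taylor K0 e0 ec0.
pose C1 := bmax * (5 * c0) + C * (27 * c0 ^+ 3).
pose GG := lyapG K c0 - lyapG K e.
have GG0 : 0 <= GG by rewrite subr_ge0 lyapG_le.
pose C2 := GG * (8 / c0 ^+ 3) + amax * (8 / c0 + 2 / c0).
have C10 : 0 <= C1 by rewrite /C1; nneg.
have C20 : 0 <= C2 by rewrite /C2; nneg.
exists (C1 + C2); first exact: addr_ge0.
move=> y v ry; set N := norm1 v; have N0 : 0 <= N by exact: norm1_ge0.
set p := dotv y v; set q := dotv v v; set r := rho e y in ry *.
have er : e <= r by exact: rho_ge.
have rc : r <= c0 by slra.
have pN : `|p| <= c0 * N.
  by apply: le_trans (dotv_rho e y v) _; rewrite ler_wpM2r.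
have q0 : 0 <= q by exact: dotvv_ge0.
have qN : q <= N ^+ 2 by exact: dotvv_norm1.
have /andP[al0 al1] := lyap_alpha_bound er.
have /andP[be0 be1] := lyap_beta_bound er.
rewrite (lyap_in rc) -/r.
have N3 : 0 <= N ^+ 3 by exact: exprn_ge0.
have [Nc|Nc] := leP N (c0 / 2).
  have rc' : rho e (y + v) <= c0.
    have := rho_lip y v e0; rewrite -/r -/N ler_norml => /andP[_]; slra.
  have er' : e <= rho e (y + v) by exact: rho_ge.
  rewrite (lyap_in rc').
  have := HC r (rho e (y + v)) (2 * p + q); rewrite er rc er' rc' rho_sqrD => /(_ isT isT erefl).
  have D3 : `|2 * p + q| ^+ 3 <= 27 * c0 ^+ 3 * N ^+ 3.
    have -> : 27 * c0 ^+ 3 * N ^+ 3 = (3 * c0 * N) ^+ 3 by ring.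
    rewrite lerXn2r ?nnegrE//; first by nneg.
    apply: le_trans (ler_normD _ _) _; rewrite normrM (ger0_norm q0) ger0_norm//.
    have : N ^+ 2 <= c0 * N by rewrite expr2 ler_wpM2r//; slra.
    slra.
  have D2 : (2 * p + q) ^+ 2 <= 4 * p ^+ 2 + 5 * c0 * N ^+ 3.
    have -> : (2 * p + q) ^+ 2 = 4 * p ^+ 2 + (4 * (p * q) + q * q) by ring.
    have pq : p * q <= (c0 * N) * N ^+ 2.
      apply: le_trans (ler_norm _) _; rewrite normrM (ger0_norm q0).
      by apply: ler_pM.
    have qq : q * q <= (c0 * N) * N ^+ 2.
      apply: ler_pM => //; apply: le_trans qN _.
      by rewrite expr2 ler_wpM2r//; slra.
    have -> : 5 * c0 * N ^+ 3 = 4 * (c0 * N * N ^+ 2) + c0 * N * N ^+ 2 by ring.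
    slra.
  have h1 := ler_wpM2l C0 D3.
  have h2 := ler_wpM2l be0 D2.
  have h3 : lyap_beta K r * (5 * c0 * N ^+ 3) <= bmax * (5 * c0 * N ^+ 3).
    by rewrite ler_wpM2r//; nneg.
  have h4 : 0 <= C2 * N ^+ 3 by exact: mulr_ge0.
  rewrite /C1; slra.
have Nc3 : 1 <= 8 / c0 ^+ 3 * N ^+ 3.
  have -> : 8 / c0 ^+ 3 * N ^+ 3 = (N / (c0 / 2)) ^+ 3 by field; rewrite gt_eqF.
  by rewrite exprn_ege1// ler_pdivlMr ?divr_gt0// mul1r ltW.
have NN : N ^+ 2 <= 2 / c0 * N ^+ 3.
  have -> : 2 / c0 * N ^+ 3 = N ^+ 2 * (N / (c0 / 2)) by field; rewrite gt_eqF.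
  by rewrite ler_peMr ?sqr_ge0// ler_pdivlMr ?divr_gt0// mul1r ltW.
have cN : c0 * N <= 2 * N ^+ 2 by rewrite expr2 mulrA ler_wpM2r//; slra.
have h1 : lyapG K r - lyap (y + v) <= GG * (8 / c0 ^+ 3 * N ^+ 3).
  apply: (@le_trans _ _ GG); last by rewrite ler_peMr.
  by rewrite /GG lerB ?lyap_ge// lyapG_le//; slra.
have h2 : lyap_alpha K r * (2 * p + q) <= amax * ((8 / c0 + 2 / c0) * N ^+ 3).
  have pp := le_trans (ler_norm p) pN.
  apply: (@le_trans _ _ (lyap_alpha K r * ((8 / c0 + 2 / c0) * N ^+ 3))); last first.
    by rewrite ler_wpM2r//; nneg.
  rewrite ler_wpM2l//.
  have -> : (8 / c0 + 2 / c0) * N ^+ 3 = 5 * (2 / c0 * N ^+ 3) by field; rewrite gt_eqF.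
  slra.
have h3 : 0 <= 4 * lyap_beta K r * p ^+ 2.
  by apply: mulr_ge0; [apply: mulr_ge0|exact: sqr_ge0].
have h4 : 0 <= C1 * N ^+ 3 by exact: mulr_ge0.
rewrite /C2; slra.
Qed.

Lemma lyap_lip y a : `|lyap (y + a) - lyap y| <= (e^-1 + K) * norm1 a.
Proof.
have h1 : e <= Num.min (rho e (y + a)) c0 by rewrite le_min rho_ge.
have h2 : e <= Num.min (rho e y) c0 by rewrite le_min rho_ge.
apply: le_trans (lyapG_lip K0 e0 h2 h1) _.
rewrite ler_wpM2l//; first by nneg.
apply: le_trans (rho_lip y a e0).
exact: min_lip.
Qed.

(** Here [b] is the Brownian and [a] the finite variation part of a step. The slope is frozen at
    [y], before the Brownian move; the price is [norm1 a] times the size of the step, which sums to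
    a vanishing quantity along a path of finite variation. *)
Lemma lyap_drift_step : exists2 C, 0 <= C & forall y b a, rho e y <= c0 / 2 ->
  2 * lyap_alpha K (rho e y) * dotv y a - C * norm1 a * (norm1 a + norm1 b)
    <= lyap (y + b + a) - lyap (y + b).
Proof.
pose Cl := e^-1 + K.
have Cl0 : 0 <= Cl by rewrite /Cl; nneg.
pose C1 := c0 * ((2 * e^-1 + K) / e ^+ 2) + 2 * amax.
pose C2 := (Cl + 2 * amax * c0) * (2 / c0).
have C10 : 0 <= C1 by rewrite /C1; nneg.
have C20 : 0 <= C2 by rewrite /C2; nneg.
exists (C1 + C2); first exact: addr_ge0.
move=> y b a; set r := rho e y; set A := norm1 a; set N := norm1 b => rc2.
have A0 : 0 <= A by exact: norm1_ge0.
have N0 : 0 <= N by exact: norm1_ge0.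
have er : e <= r by exact: rho_ge.
have rc : r <= c0 by slra.
have /andP[al0 al1] := lyap_alpha_bound er.
have pA : `|dotv y a| <= c0 * A.
  by apply: le_trans (dotv_rho e y a) _; rewrite ler_wpM2r.
have AN0 : 0 <= A * (A + N) by rewrite mulr_ge0// addr_ge0.
(* For a long step the factor [(A + N) / (c0 / 2)] exceeds 1, so the Lipschitz bound already has the
   form of the error. *)
have [AN|AN] := leP (A + N) (c0 / 2); last first.
  have := lyap_lip (y + b) a; rewrite -/Cl -/A ler_norml => /andP[h1 _].
  have h2 : 2 * lyap_alpha K r * dotv y a <= 2 * amax * c0 * A.
    have -> : 2 * lyap_alpha K r * dotv y a = 2 * (lyap_alpha K r * dotv y a) by ring.
    have -> : 2 * amax * c0 * A = 2 * (amax * (c0 * A)) by ring.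
    rewrite ler_wpM2l//; apply: le_trans (ler_norm _) _.
    by rewrite normrM (ger0_norm al0); apply: ler_pM.
  have h3 : (Cl + 2 * amax * c0) * A <= C2 * A * (A + N).
    have -> : C2 * A * (A + N) = (Cl + 2 * amax * c0) * (A * ((A + N) / (c0 / 2))).
      by rewrite /C2; field; rewrite gt_eqF.
    rewrite ler_wpM2l//; first by nneg.
    by rewrite ler_peMr// ler_pdivlMr ?divr_gt0// mul1r ltW.
  have h4 : 0 <= C1 * (A * (A + N)) by exact: mulr_ge0.
  slra.
set r1 := rho e (y + b); set r2 := rho e (y + b + a).
have er1 : e <= r1 by exact: rho_ge.
have er2 : e <= r2 by exact: rho_ge.
have d1 : `|r1 - r| <= N by exact: rho_lip.
have d2 : `|r2 - r1| <= A by exact: rho_lip.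
have rc1 : r1 <= c0 by move: d1; rewrite ler_norml => /andP[_]; slra.
have rc2' : r2 <= c0.
  by move: d1 d2; rewrite !ler_norml => /andP[_ ?] /andP[_ ?]; slra.
rewrite (lyap_in rc1) (lyap_in rc2') -/r1 -/r2.
have r0 : 0 < r by slra. have r10 : 0 < r1 by slra. have r20 : 0 < r2 by slra.
have s20 : 0 < r2 + r1 by slra.
set p := dotv y a in pA *; pose q := 2 * dotv b a + dotv a a.
have eD : (r2 - r1) * (r2 + r1) = 2 * p + q.
  have -> : (r2 - r1) * (r2 + r1) = r2 ^+ 2 - r1 ^+ 2 by ring.
  by rewrite rho_sqrD dotvDl /q /p; ring.
have qA : `|q| <= 2 * (A * (A + N)).
  have h1 : `|dotv b a| <= N * A by apply: dotv_norm1 => k; exact: normr_norm1.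
  have h2 : dotv a a <= A * A by rewrite -expr2; exact: dotvv_norm1.
  apply: le_trans (ler_normD _ _) _; rewrite normrM (ger0_norm (dotvv_ge0 a)) ger0_norm//.
  have := mulr_ge0 A0 A0; slra.
have lnle : (r2 - r1) / r2 <= ln r2 - ln r1.
  rewrite -ln_div ?posrE//.
  have -> : r2 / r1 = (r1 / r2)^-1 by rewrite invf_div.
  rewrite lnV ?posrE ?divr_gt0// lerNr.
  have := @le_ln1Dx R (r1 / r2 - 1); rewrite [1 + _]addrC subrK => H.
  apply: le_trans (H _) _; first by rewrite ltrBrDl subrr divr_gt0.
  by rewrite mulrBl divff ?gt_eqF// opprB.
(* By concavity of [ln], [c2] bounds the chord slope of [lyapG] in the squared radius from below or
   above according to the sign of the increment; either way the product inequality [low] holds. It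
   remains to compare [2 * c2] with the derivative at [r]. *)
pose c2 := (r2^-1 + K) / (r2 + r1).
have c20 : 0 <= c2 by rewrite /c2; nneg.
have c2m : c2 <= amax.
  rewrite /c2 /amax; apply: ler_pM; try nneg.
    by rewrite lerD2r lef_pV2 ?posrE.
  by rewrite lef_pV2 ?posrE ?mulr_gt0//; slra.
have low : c2 * (2 * p + q) <= lyapG K r2 - lyapG K r1.
  have -> : c2 * (2 * p + q) = (r2 - r1) / r2 + K * (r2 - r1).
    by rewrite -eD /c2; field; rewrite !gt_eqF.
  rewrite /lyapG; move: lnle; lra.
have V2 : r2^-1 <= e^-1 by rewrite lef_pV2 ?posrE.
have V : r^-1 <= e^-1 by rewrite lef_pV2 ?posrE.
have V21 : (r2 + r1)^-1 <= (2 * e)^-1 by rewrite lef_pV2 ?posrE ?mulr_gt0//; slra.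
have diff : `|2 * c2 - 2 * lyap_alpha K r| <= (2 * e^-1 + K) / e ^+ 2 * (A + N).
  have -> : 2 * c2 - 2 * lyap_alpha K r =
      (r - r2) * (r2^-1 * r^-1) * (2 * (r2 + r1)^-1)
      + (r^-1 + K) * ((r - r2) + (r - r1)) * ((r2 + r1)^-1 * r^-1).
    by rewrite /c2 /lyap_alpha; field; rewrite !gt_eqF.
  have nr2 : `|r - r2| <= A + N.
    have -> : r - r2 = - (r2 - r1) - (r1 - r) by ring.
    by apply: le_trans (ler_normB _ _) _; rewrite normrN lerD.
  have nr1 : `|r - r1| <= A + N by rewrite distrC; move: A0; lra.
  have AN1 : 0 <= A + N by exact: addr_ge0.
  apply: (@le_trans _ _ ((A + N) * (e^-1 * e^-1) * (2 * (2 * e)^-1)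
      + (e^-1 + K) * ((A + N) + (A + N)) * ((2 * e)^-1 * e^-1))); last first.
    by rewrite le_eqVlt; apply/orP; left; apply/eqP; field; rewrite gt_eqF.
  apply: le_trans (ler_normD _ _) _; rewrite !normrM.
  apply: lerD.
    apply: ler_pM; try nneg.
      apply: ler_pM => //; try nneg.
      by rewrite !ger0_norm; try nneg; apply: ler_pM; try nneg.
    by rewrite !ger0_norm; try nneg; rewrite ler_wpM2l.
  apply: ler_pM; try nneg.
    apply: ler_pM; try nneg.
      by rewrite ger0_norm; try nneg; rewrite lerD2r.
    by apply: le_trans (ler_normD _ _) _; apply: lerD.
  by rewrite !ger0_norm; try nneg; apply: ler_pM; try nneg.
have h1 : - (C1 * (A * (A + N)) ) <= c2 * (2 * p + q) - 2 * lyap_alpha K r * p.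
  have -> : c2 * (2 * p + q) - 2 * lyap_alpha K r * p =
    (2 * c2 - 2 * lyap_alpha K r) * p + c2 * q by ring.
  rewrite lerNl; apply: le_trans (ler_norm _) _.
  rewrite normrN; apply: le_trans (ler_normD _ _) _.
  have -> : C1 * (A * (A + N)) =
      (2 * e^-1 + K) / e ^+ 2 * (A + N) * (c0 * A) + amax * (2 * (A * (A + N))).
    by rewrite /C1; ring.
  rewrite (normrM _ p) (normrM c2); apply: lerD; first by apply: ler_pM.
  by rewrite (ger0_norm c20); apply: ler_pM.
have h4 : 0 <= C2 * (A * (A + N)) by exact: mulr_ge0.
slra.
Qed.

End Truncated.
End Vector.
End Lyapunov.

(** * Projections and the geometry of the walls *)

Section Projection.
Variables (R : realType) (d m : nat).
Implicit Types (Q : 'I_d -> 'I_d -> R) (v y : 'I_d -> R).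

Definition app Q v : 'I_d -> R := fun k => \sum_l Q k l * v l.

Lemma mul_rV_tr_eq0 p (v : 'rV[R]_p) : v *m v^T = 0 -> v = 0.
Proof.
move=> /matrixP/(_ 0 0); rewrite !mxE => h; apply/rowP => k; rewrite mxE.
have : \sum_j v 0 j ^+ 2 = 0.
  by rewrite -[RHS]h; apply: eq_bigr => j _; rewrite !mxE.
by move/psumr_eq0P => /(_ (fun i _ => sqr_ge0 _) k isT) /eqP; rewrite sqrf_eq0 => /eqP.
Qed.

(** If [v] is in the kernel, then [v *m N] has squared length [v *m N *m N^T *m v^T = 0]. *)
Lemma gram_unit p q (N : 'M[R]_(p, q)) : row_free N -> N *m N^T \in unitmx.
Proof.
move=> fN; rewrite -row_free_unit -kermx_eq0; apply/eqP/row_matrixP => i.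
rewrite row0; set v := row i _.
have hv : v *m (N *m N^T) = 0 by rewrite /v -row_mul mulmx_ker row0.
have : v *m N = 0.
  by apply: mul_rV_tr_eq0; rewrite trmx_mul mulmxA -(mulmxA v) hv mul0mx.
by move=> h; apply: (row_free_inj fN); rewrite h mul0mx.
Qed.

(** [Q] projects onto the span of the normals in [J], by the Gram formula for a row basis [N] of the
    matrix [M] whose rows outside [J] are zeroed. Its trace is the rank of [M]; if this were at most
    1, two of the unit normals would be equal or opposite. *)
Lemma orthogonal_projection (n : 'I_m -> 'I_d -> R) (J : {set 'I_m}) :
  exists Q, [/\ forall k l, Q k l = Q l k,
    forall k l, \sum_j Q k j * Q j l = Q k l,
    forall j, j \in J -> app Q (n j) = n j,
    forall v, (forall j, j \in J -> dotv v (n j) = 0) -> app Q v = 0 &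
    forall i j, i \in J -> j \in J -> unitv (n i) -> unitv (n j) ->
      n i <> n j -> n i <> - n j -> 2 <= \sum_k Q k k].
Proof.
pose M : 'M[R]_(m, d) := \matrix_(i, k) (if i \in J then n i k else 0).
pose N := row_base M; pose G := N *m N^T.
have Gu : G \in unitmx by exact: gram_unit (row_base_free M).
pose Q := N^T *m invmx G *m N.
have GT : G^T = G by rewrite /G trmx_mul trmxK.
have QT : Q^T = Q.
  have e1 : (N^T *m invmx G)^T = (invmx G)^T *m N by rewrite trmx_mul trmxK.
  by rewrite /Q trmx_mul e1 trmx_inv GT mulmxA.
have NQ : N *m Q = N by rewrite /Q mulmxA mulmxA -/G mulmxV// mul1mx.
have QQ : Q *m Q = Q.
  by rewrite {1}/Q -mulmxA NQ.
have Mrow i v : (forall k, v k = (if i \in J then n i k else 0)) -> row i M = \row_k v k.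
  by move=> h; apply/rowP => k; rewrite !mxE h.
have QM : M *m Q = M.
  have /submxP[D ->] : (M <= N)%MS by rewrite eq_row_base.
  by rewrite -mulmxA NQ.
exists (fun k l => Q k l); split.
- by move=> k l; rewrite -[in LHS]QT mxE.
- by move=> k l; rewrite -[in RHS]QQ mxE.
- move=> j jJ; apply/funext => k; rewrite /app.
  have /matrixP/(_ j k) := QM; rewrite mxE [RHS]mxE jJ => <-.
  by apply: eq_bigr => l _; rewrite [M _ _]mxE jJ mulrC -[in LHS]QT [Q^T _ _]mxE.
- move=> v hv; apply/funext => k; rewrite /app.
  have Mv : M *m (\col_l v l) = 0.
    apply/colP => i; rewrite !mxE; case: (boolP (i \in J)) => iJ.
      rewrite -[RHS](hv i iJ); apply: eq_bigr => l _.
      by rewrite !mxE iJ mulrC.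
    by rewrite big1// => l _; rewrite !mxE (negbTE iJ) mul0r.
  have /submxP[D ND] : (N <= M)%MS by rewrite eq_row_base.
  have : Q *m (\col_l v l) = 0.
    have Nv : N *m (\col_l v l) = 0 by rewrite ND -mulmxA Mv mulmx0.
    by rewrite /Q -mulmxA Nv mulmx0.
  move=> /colP/(_ k); rewrite mxE [RHS]mxE => h; rewrite -[RHS]h.
  by apply: eq_bigr => l _; rewrite [X in _ = _ * X]mxE.
move=> i j iJ jJ ui uj nij nij'.
have -> : \sum_k Q k k = \tr Q by [].
(* Cyclicity turns the trace of the projection into that of the identity of size the rank. *)
rewrite /Q mxtrace_mulC mulmxA -/G mulmxV// mxtrace1.
rewrite ler_nat leqNgt; apply/negP => rk.
have mrow l : l \in J -> row l M = \row_k n l k.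
  by move=> lJ; apply: Mrow => k; rewrite lJ.
have nz l : l \in J -> unitv (n l) -> row l M != 0.
  move=> lJ; rewrite /unitv /dotv => ul; apply/eqP => h.
  have : \sum_(k < d) n l k * n l k = 0.
    apply: big1 => k _; move/rowP: h => /(_ k); rewrite mrow// !mxE => ->.
    by rewrite mul0r.
  by rewrite ul => /eqP; rewrite oner_eq0.
have r1 : \rank (row i M) = 1%N by rewrite rank_rV nz.
have sub : (M <= row i M)%MS.
  have := mxrank_leqif_sup (row_sub i M) => -[le1 eq1].
  by rewrite -eq1 eqn_leq le1 r1 -ltnS rk.
have /sub_rVP[c hc] : (row j M <= row i M)%MS by exact: submx_trans (row_sub j M) sub.
have nc k : n j k = c * n i k.
  by move/rowP: hc => /(_ k); rewrite mrow// mrow// !mxE.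
have c2 : c ^+ 2 = 1.
  move: uj; rewrite /unitv /dotv; under eq_bigr do rewrite !nc mulrACA -expr2.
  by rewrite -mulr_sumr [X in _ * X]ui mulr1.
move/eqP: c2; rewrite sqrf_eq1 => /orP[|] /eqP ce.
  by apply: nij; apply/funext => k; rewrite nc ce mul1r.
by apply: nij'; apply/funext => k; rewrite fctE nc ce mulN1r opprK.
Qed.

End Projection.

Section ProjectionFacts.
Variables (R : realType) (d : nat) (Q : 'I_d -> 'I_d -> R).
Hypothesis Qsym : forall k l, Q k l = Q l k.
Hypothesis Qidem : forall k l, \sum_j Q k j * Q j l = Q k l.
Implicit Types v y : 'I_d -> R.

Lemma appD v y : app Q (v + y) = app Q v + app Q y.
Proof.
apply/funext => k; transitivity (app Q v k + app Q y k); last by [].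
by rewrite /app -big_split/=; apply: eq_bigr => l _; rewrite -mulrDr.
Qed.

Lemma appB v y : app Q (v - y) = app Q v - app Q y.
Proof.
apply/funext => k; transitivity (app Q v k - app Q y k); last by [].
by rewrite /app -sumrB/=; apply: eq_bigr => l _; rewrite -mulrBr.
Qed.

Lemma dotv_app v y : dotv (app Q v) y = dotv v (app Q y).
Proof.
rewrite /dotv /app; under eq_bigr do rewrite mulr_suml.
under [RHS]eq_bigr do rewrite mulr_sumr.
rewrite exchange_big/=; apply: eq_bigr => k _; apply: eq_bigr => l _.
by rewrite Qsym mulrA (mulrC (Q _ _)).
Qed.

Lemma app_app v : app Q (app Q v) = app Q v.
Proof.
apply/funext => k; rewrite /app; under eq_bigr do rewrite mulr_sumr.
rewrite exchange_big/=; apply: eq_bigr => l _; rewrite -[in RHS]Qidem mulr_suml.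
by apply: eq_bigr => j _; rewrite mulrA.
Qed.

Lemma dotv_app_app v : dotv (app Q v) (app Q v) = \sum_k \sum_l Q k l * (v k * v l).
Proof.
rewrite dotv_app app_app /dotv; apply: eq_bigr => k _; rewrite /app mulr_sumr.
by apply: eq_bigr => l _; rewrite mulrCA.
Qed.

Lemma norm1_app v : norm1 (app Q v) <= (\sum_k \sum_l `|Q k l|) * norm1 v.
Proof.
rewrite mulr_suml; apply: ler_sum => k _; apply: le_trans (ler_norm_sum _ _ _) _.
rewrite mulr_suml; apply: ler_sum => l _; rewrite normrM ler_wpM2l//.
exact: normr_norm1.
Qed.

End ProjectionFacts.

(** * Monotonicity of the derivatives of the convex potentials *)

Section ConvexDerivative.
Variable R : realType.
Implicit Types (f : R -> \bar R) (x y : R).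

Lemma admissible_slope f x y z : admissible_phi f -> 0 < x -> x < z -> z < y ->
  (fine (f z) - fine (f x)) * (y - x) <= (fine (f y) - fine (f x)) * (z - x) /\
  (fine (f y) - fine (f x)) * (y - z) <= (fine (f y) - fine (f z)) * (y - x).
Proof.
move=> [_ [cf [_ [_ [ff _]]]]] x0 xz zy.
have yx : 0 < y - x by lra.
pose t := (y - z) / (y - x).
have t01 : 0 <= t <= 1.
  apply/andP; split; first by rewrite divr_ge0; lra.
  by rewrite ler_pdivrMr//; lra.
have := cf x y t t01.
have -> : t * x + (1 - t) * y = z by rewrite /t; field; rewrite gt_eqF.
have fx : f x \is a fin_num by apply: ff.
have fy : f y \is a fin_num by apply: ff; lra.
have fz : f z \is a fin_num by apply: ff; lra.
rewrite -(fineK fx) -(fineK fy) -(fineK fz) -!EFinM -EFinD lee_fin /=.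
set gx := fine (f x); set gy := fine (f y); set gz := fine (f z) => h.
have h2 : gz * (y - x) <= gx * (y - z) + gy * (z - x).
  rewrite -(ler_pM2r yx) in h; apply: le_trans h _.
  by rewrite le_eqVlt; apply/orP; left; apply/eqP; rewrite /t; field; rewrite gt_eqF.
by split; lra.
Qed.

(** All that is needed of convexity: the derivative is bounded on intervals away from 0, and near 0
    it can be unbounded only below. Both derivatives are one-sided limits of slopes, compared with
    the slope of the chord from [x] to [y]. *)
Lemma phid_mono f x y : admissible_phi f -> 0 < x -> x <= y -> phid f x <= phid f y.
Proof.
move=> af x0; rewrite le_eqVlt => /predU1P[->//|xy].
have y0 : 0 < y by lra.
pose g z := fine (f z).
have [_ [_ [_ [_ [_ df]]]]] := af.
have slope z : 0 < z -> h^-1 *: (g (h + z) - g z) @[h --> 0^'] --> phid f z.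
  move=> z0; have [dz _] := df z z0.
  have -> : (fun h => h^-1 *: (g (h + z) - g z)) =
      (fun h => h^-1 *: ((g \o shift z) (h *: 1) - g z)).
    by apply/funext => h; rewrite /= [h *: 1]mulr1.
  rewrite /phid derive1E; exact: dz.
have yx : 0 < y - x by lra.
apply: (@le_trans _ _ ((g y - g x) / (y - x))).
  apply: (cvgr_to_le (cvg_dnbhs_at_right (slope x x0))).
  near=> h.
  have h0 : 0 < h by near: h; exact: nbhs_right_gt.
  have hy : h < y - x by near: h; exact: nbhs_right_lt.
  have hx1 : x < h + x by lra.
  have hx2 : h + x < y by lra.
  have [+ _] := admissible_slope af x0 hx1 hx2.
  rewrite -/(g (h + x)) -/(g x) -/(g y) addrK => hs.
  by rewrite [leLHS]mulrC ler_pdivrMr// mulrAC ler_pdivlMr.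
apply: (cvgr_to_ge (cvg_dnbhs_at_left (slope y y0))).
near=> h.
have h0 : h < 0 by near: h; exact: nbhs_left_lt.
have hy : - (y - x) < h by near: h; apply: nbhs_left_gt; lra.
have hx1 : x < h + y by lra.
have hx2 : h + y < y by lra.
have [_] := admissible_slope af x0 hx1 hx2.
rewrite -/(g (h + y)) -/(g x) -/(g y) => hs.
have -> : h^-1 *: (g (h + y) - g y) = (g y - g (h + y)) / (- h).
  by rewrite /GRing.scale/=; field; rewrite lt_eqF.
rewrite ler_pdivrMr// mulrAC ler_pdivlMr ?oppr_gt0//.
by move: hs; rewrite opprD addrCA subrr addr0.
Unshelve. all: by end_near. Qed.

End ConvexDerivative.

(** * Action of normals and drift on the component transversal to a face *)

Section DriftGeometry.
Variables (R : realType) (d m : nat) (n : 'I_m -> 'I_d -> R) (a : 'I_m -> R).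
Variable J : {set 'I_m}.

(** For small [s], the point [x + s * y] is still in the closed domain: it moves away from the walls
    of [J], and the other walls leave the margin [eta]. It is the test point in the definition of
    the normal. *)
Lemma inward_normal_push (eta : R) (x y v : 'I_d -> R) : 0 < eta -> inDbar n a x ->
  (forall i, i \notin J -> eta <= dotv x (n i) - a i) ->
  (forall j, j \in J -> dotv y (n j) = dotv x (n j) - a j) ->
  inward_normal n a x v -> 0 <= dotv v y.
Proof.
move=> eta0 Dx hx hy [_ hv].
pose S := 1 + \sum_i `|dotv y (n i)|.
have S0 : 0 < S by rewrite ltr_wpDr// sumr_ge0.
pose s := eta / S.
have s0 : 0 < s by exact: divr_gt0.
have Dz : inDbar n a (x + (fun k => s * y k)).
  move=> i; rewrite dotvDl.
  have -> : dotv (fun k => s * y k) (n i) = s * dotv y (n i).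
    by rewrite /dotv mulr_sumr; apply: eq_bigr => k _; rewrite mulrA.
  have [iJ|iJ] := boolP (i \in J).
    rewrite hy//; have := Dx i => h.
    have : 0 <= s * (dotv x (n i) - a i) by rewrite mulr_ge0 ?subr_ge0// ltW.
    lra.
  have h1 := hx i iJ.
  have h2 : `|dotv y (n i)| <= S.
    rewrite /S (bigD1 i)//= addrCA lerDl addr_ge0// sumr_ge0//.
  have h3 : s * `|dotv y (n i)| <= eta.
    apply: le_trans (_ : s * S <= _); first by rewrite ler_wpM2l// ltW.
    by rewrite /s divfK// gt_eqF.
  have := ler_norm (- dotv y (n i)); rewrite normrN => h4.
  have := ler_wpM2l (ltW s0) h4; lra.
have := hv _ Dz.
have -> : dotv v (fun k => x k - (x + (fun k0 => s * y k0)) k) = - (s * dotv v y).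
  rewrite /dotv mulr_sumr -sumrN; apply: eq_bigr => k _; rewrite fctE; ring.
by rewrite oppr_le0 pmulr_rge0.
Qed.

Variable phi : 'I_m -> R -> \bar R.
Hypothesis Hphi : forall i, admissible_phi (phi i).

(** Walls of [J] enter with the weight [dotv y (n i) = xi >= 0], so an upper bound of the derivative
    suffices there; for the others the distance lies between [eta] and [M], where the derivative is
    bounded on both sides. *)
Lemma drift_bound (eta M : R) : 0 < eta -> eta <= M ->
  exists2 C, 0 <= C & forall (x y : 'I_d -> R) r, inDbar n a x ->
  (forall i, i \notin J -> eta <= dotv x (n i) - a i) ->
  (forall i, dotv x (n i) - a i <= M) ->
  (forall j, j \in J -> dotv y (n j) = dotv x (n j) - a j) ->
  (forall i, `|dotv y (n i)| <= r) ->
  dotv y (gradPhi n a phi x) <= C * r.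
Proof.
move=> eta0 etaM.
pose c i := `|phid (phi i) eta| + `|phid (phi i) M|.
have c0 i : 0 <= c i by rewrite addr_ge0.
exists (\sum_i c i); first exact: sumr_ge0.
move=> x y r Dx hx hM hy hr.
have -> : dotv y (gradPhi n a phi x) =
    \sum_i dotv y (n i) * phid (phi i) (dotv x (n i) - a i).
  rewrite /dotv /gradPhi; under eq_bigr do rewrite mulr_sumr.
  rewrite exchange_big/=; apply: eq_bigr => i _; rewrite mulr_suml.
  by apply: eq_bigr => k _; rewrite mulrA.
rewrite mulr_suml; apply: ler_sum => i _.
set xi := dotv x (n i) - a i.
have r0 : 0 <= r by exact: le_trans (hr i).
have xi0 : 0 <= xi by rewrite subr_ge0; exact: Dx.
have up : 0 < xi -> phid (phi i) xi <= c i.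
  move=> xip; apply: le_trans (phid_mono (Hphi i) xip (hM i)) _.
  by rewrite /c; have := ler_norm (phid (phi i) M); have := normr_ge0 (phid (phi i) eta); lra.
have [iJ|iJ] := boolP (i \in J).
  rewrite hy// -/xi; have := hr i; rewrite hy// -/xi ger0_norm// => xr.
  (* On the wall itself the zero weight cancels whatever default value [phid] takes at 0. *)
  move: xi0; rewrite le_eqVlt => /predU1P[<-|xip].
    by rewrite mul0r mulr_ge0.
  apply: (@le_trans _ _ (xi * c i)); first by rewrite ler_wpM2l ?up// ltW.
  by rewrite mulrC ler_wpM2l.
have ex := hx i iJ.
have lo := phid_mono (Hphi i) eta0 ex.
have hi := up (lt_le_trans eta0 ex).
apply: le_trans (ler_norm _) _; rewrite normrM mulrC; apply: ler_pM => //.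
rewrite ler_norml hi andbT; apply: le_trans lo; rewrite /c.
have := ler_norm (- phid (phi i) eta); rewrite normrN.
by have := normr_ge0 (phid (phi i) M); rewrite -/xi; lra.
Qed.

End DriftGeometry.

(** * The finite variation part of a path *)

Definition driftinc (R : realType) (d : nat) (x b : R -> 'I_d -> R) (s t : R) : 'I_d -> R :=
  fun k => (x t k - x s k) - (b t k - b s k).

Lemma clock_arith (R : realType) (o l1 l2 i1 i2 i3 c : R) :
  - (o * l1) <= i1 -> i2 <= c + o * i3 -> o * l1 <= o * l2 ->
  - c - o * (i3 + l2) <= i1 - i2.
Proof. lra. Qed.

Section PathData.
Variables (R : realType) (d m : nat) (n : 'I_m -> 'I_d -> R) (a : 'I_m -> R).
Variable phi : 'I_m -> R -> \bar R.
Notation leb := (@lebesgue_measure R).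

Lemma finite_pos_lb (g : 'I_m -> R) : (forall i, 0 < g i) ->
  exists2 c, 0 < c & forall i, c <= g i.
Proof.
move=> g0; pose S := 1 + \sum_i (g i)^-1.
have S0 : 0 < S by rewrite ltr_wpDr// sumr_ge0// => i _; rewrite invr_ge0 ltW.
exists S^-1; first by rewrite invr_gt0.
move=> i; rewrite -[leRHS]invrK lef_pV2 ?posrE ?invr_gt0//.
rewrite /S (bigD1 i)//= addrCA lerDl addr_ge0// sumr_ge0// => j _.
by rewrite invr_ge0 ltW.
Qed.

Lemma dotvZl (c : R) (x y : 'I_d -> R) : dotv (fun k => c * x k) y = c * dotv x y.
Proof. by rewrite /dotv mulr_sumr; apply: eq_bigr => k _; rewrite mulrA. Qed.

Lemma dotvBl (x y z : 'I_d -> R) : dotv (fun k => x k - y k) z = dotv x z - dotv y z.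
Proof. by rewrite /dotv -sumrB; apply: eq_bigr => k _; rewrite mulrBl. Qed.

(* Makes membership in the normal cone a countable condition, hence measurable. *)
Lemma inDbar_rat (x0 z v x : 'I_d -> R) : inD n a x0 -> inDbar n a z ->
  0 < dotv v (fun k => x k - z k) ->
  exists q : {ffun 'I_d -> rat}, inDbar n a (fun k => ratr (q k)) /\
    0 < dotv v (fun k => x k - ratr (q k)).
Proof.
move=> D0 Dz; rewrite dotvC dotvBl => vz.
pose w k := x0 k - z k.
(* Moving [z] towards the interior point [x0] by this fraction makes all wall inequalities strict
   and costs at most half of the margin in direction [v]; a nearby rational point then inherits both
   properties. *)
pose t := (dotv x v - dotv z v) / (2 * (dotv x v - dotv z v + `|dotv w v|)).
have den : 0 < dotv x v - dotv z v + `|dotv w v| by rewrite ltr_wpDr.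
have t0 : 0 < t by rewrite divr_gt0// mulr_gt0.
have t1 : t < 1.
  by rewrite ltr_pdivrMr ?mulr_gt0//; have := normr_ge0 (dotv w v); lra.
pose zt k := z k + t * w k.
have ztE y : dotv zt y = dotv z y + t * dotv w y.
  by rewrite -dotvZl /zt /dotv -big_split/=; apply: eq_bigr => k _; rewrite mulrDl.
have zv : 0 < dotv x v - dotv zt v.
  rewrite ztE; have : t * dotv w v <= (dotv x v - dotv z v) / 2.
    apply: (@le_trans _ _ (t * (dotv x v - dotv z v + `|dotv w v|))).
      rewrite ler_wpM2l ?(ltW t0)//; have := ler_norm (dotv w v); lra.
    by rewrite /t le_eqVlt; apply/orP; left; apply/eqP; field; rewrite gt_eqF.
  lra.
have Dzt i : 0 < dotv zt (n i) - a i.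
  rewrite ztE /w dotvBl; have := Dz i; have := D0 i => h1 h2.
  have -> : dotv z (n i) + t * (dotv x0 (n i) - dotv z (n i)) - a i =
    (1 - t) * (dotv z (n i) - a i) + t * (dotv x0 (n i) - a i) by ring.
  apply: ltr_wpDl; last by rewrite mulr_gt0 ?subr_gt0.
  by rewrite mulr_ge0 ?subr_ge0// ltW.
have [c c0 cD] := finite_pos_lb Dzt.
pose N := 1 + norm1 v + \sum_i norm1 (n i).
have N0 : 0 < N.
  by rewrite /N -addrA ltr_wpDr// addr_ge0 ?norm1_ge0// sumr_ge0// => i _; exact: norm1_ge0.
pose del := Num.min c (dotv x v - dotv zt v) / (2 * N).
have del0 : 0 < del by rewrite divr_gt0 ?mulr_gt0// lt_min c0.
have /choice[q hq] : forall k, exists q : rat, `|ratr q - zt k| <= del.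
  move=> k; have /rat_in_itvoo[q] : zt k < zt k + del by rewrite ltrDl.
  by rewrite in_itv/= => /andP[q1 q2]; exists q; rewrite ger0_norm; lra.
exists [ffun k => q k].
have near y : norm1 y <= N ->
    `|dotv (fun k => ratr ([ffun k => q k] k)) y - dotv zt y| <=
      Num.min c (dotv x v - dotv zt v) / 2.
  move=> yN; rewrite -dotvBl; apply: le_trans (dotv_norm1 _ (M := del) _) _.
    by move=> k; rewrite ffunE.
  apply: (@le_trans _ _ (del * N)); first by rewrite ler_wpM2l// ltW.
  by rewrite /del le_eqVlt; apply/orP; left; apply/eqP; field; rewrite gt_eqF.
split.
  move=> i; have /near : norm1 (n i) <= N.
    rewrite /N (bigD1 i)//= addrCA lerDl !addr_ge0 ?norm1_ge0// sumr_ge0// => j _.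
    exact: norm1_ge0.
  rewrite ler_norml => /andP[h _]; have := cD i.
  have : Num.min c (dotv x v - dotv zt v) <= c by rewrite ge_min lexx.
  lra.
rewrite dotvC dotvBl; have /near : norm1 v <= N.
  rewrite /N addrAC lerDr addr_ge0// sumr_ge0// => j _; exact: norm1_ge0.
rewrite ler_norml => /andP[_ h].
have : Num.min c (dotv x v - dotv zt v) <= dotv x v - dotv zt v by rewrite ge_min lexx orbT.
lra.
Qed.

Section RintegralSum.
Context (dd : measure_display) (T : measurableType dd) (mu : {measure set T -> \bar R}).

Lemma Rintegral_sum (D : set T) (I : Type) (s : seq I) (f : I -> T -> R) : measurable D ->
  (forall i, mu.-integrable D (EFin \o f i)) ->
  mu.-integrable D (fun x => (\sum_(i <- s) f i x)%:E) /\
  \int[mu]_(x in D) (\sum_(i <- s) f i x) = \sum_(i <- s) \int[mu]_(x in D) f i x.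
Proof.
move=> mD fi; elim: s => [|i s [IH1 IH2]].
  rewrite big_nil; split.
    by apply: (eq_integrable mD (cst 0%E)) => [x _|]; [rewrite big_nil|exact: integrable0].
  under eq_Rintegral do rewrite big_nil.
  by rewrite /Rintegral integral0.
split.
  apply: (eq_integrable mD ((EFin \o f i) \+ (fun x => (\sum_(i <- s) f i x)%:E))%E).
    by move=> x _; rewrite big_cons EFinD.
  exact: integrableD.
under eq_Rintegral do rewrite big_cons.
by rewrite RintegralD// IH2 big_cons.
Qed.

Lemma integrable_EFinZl (D : set T) (f : T -> R) (c : R) : measurable D ->
  mu.-integrable D (EFin \o f) -> mu.-integrable D (EFin \o (fun x => c * f x)).
Proof. move=> mD fi; exact: (integrableZl mD c fi). Qed.

End RintegralSum.

Variables (x b : R -> 'I_d -> R) (L : R -> R) (nv : R -> 'I_d -> R).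
Variable muL : {measure set R -> \bar R}.
Variable xD : 'I_d -> R.
Hypothesis DxD : inD n a xD.
Hypothesis cx : forall k, {within `[0, +oo[%classic, continuous (fun t => x t k)}.
Hypothesis Dx : forall t, 0 <= t -> inDbar n a (x t).
Hypothesis igrad : forall t k, 0 <= t -> leb.-integrable `[0, t]%classic
  (fun s => (gradPhi n a phi (x s) k)%:E).
Hypothesis mnv : forall k, measurable_fun setT (fun s => nv s k).
Hypothesis muL0 : muL `]-oo, 0]%classic = 0%E.
Hypothesis muLE : forall s t, 0 <= s -> s <= t -> muL `]s, t]%classic = (L t - L s)%:E.
Hypothesis normalL : muL [set s | 0 <= s /\ ~ inward_normal n a (x s) (nv s)] = 0%E.
Hypothesis eqx : forall t k, 0 <= t -> x t k = x 0 k + b t k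
  - (\int[leb]_(s in `[0, t]) gradPhi n a phi (x s) k)
  + (\int[muL]_(s in `[0, t]) nv s k).

Let P0 : set R := `[0, +oo[%classic.

Let mx k : measurable_fun P0 (fun s => x s k).
Proof.
rewrite /P0; apply: subspace_continuous_measurable_fun; first exact: measurable_itv.
exact: (cx (k := k)).
Qed.

Let badN := [set s | 0 <= s /\ ~ inward_normal n a (x s) (nv s)].

(** Needed to discard this null set from integrals against [muL]: failing to be a normal means
    failing to be a unit vector or being refuted by one of countably many rational points. *)
Lemma measurable_not_inward : measurable badN.
Proof.
pose S1 := P0 `&` (fun s => dotv (nv s) (nv s)) @^-1` (~` [set 1]).
pose S2 (q : {ffun 'I_d -> rat}) := if `[< inDbar n a (fun k => ratr (q k)) >]
  then P0 `&` (fun s => dotv (nv s) (fun k => x s k - ratr (q k))) @^-1` `]0, +oo[%classic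
  else set0.
have -> : badN = S1 `|` \bigcup_(q in [set: {ffun 'I_d -> rat}]) S2 q.
  apply/seteqP; split => s.
    move=> [s0 hN]; have [u1|u1] := pselect (unitv (nv s)); last first.
      by left; split; [rewrite /P0/= in_itv/= s0|].
    have [z [Dz]] : exists z, inDbar n a z /\ 0 < dotv (nv s) (fun k => x s k - z k).
      apply: contrapT => h; apply: hN; split => // z Dz.
      by rewrite leNgt; apply/negP => h2; apply: h; exists z.
    move=> /(inDbar_rat DxD Dz)[q [Dq hq]]; right; exists q => //.
    rewrite /S2; case: asboolP => // _; split; first by rewrite /P0/= in_itv/= s0.
    by rewrite /= in_itv/= andbT.
  move=> [[+ u1]|[q _]]; first by rewrite /P0/= in_itv/= andbT => s0; split => // -[].
  rewrite /S2; case: asboolP => // Dq [+]; rewrite /P0/= !in_itv/= !andbT => s0 h.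
  by split => // -[_ /(_ _ Dq)]; rewrite leNgt h.
have mP0 : measurable P0 by exact: measurable_itv.
apply: measurableU.
  have md : measurable_fun P0 (fun s => dotv (nv s) (nv s)).
    by apply: measurable_sum => k; apply: measurable_funM; exact: measurable_funTS.
  by apply: md => //; apply: measurableC.
rewrite (_ : \bigcup_(q in _) _ =
    \bigcup_(i : nat) (if unpickle i is Some q then S2 q else set0)); last first.
  apply/seteqP; split => s; first by move=> [q _ hq]; exists (pickle q) => //; rewrite pickleK.
  by move=> [i _]; case: unpickle => // q hq; exists q.
apply: bigcupT_measurable => i; case: unpickle => // q; rewrite /S2; case: asboolP => // _.
have md : measurable_fun P0 (fun s => dotv (nv s) (fun k => x s k - ratr (q k))).
  apply: measurable_sum => k; apply: measurable_funM; first exact: measurable_funTS.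
  exact: measurable_funB.
by apply: md.
Qed.

Let muL_00 : muL `[0, 0]%classic = 0%E.
Proof.
apply/eqP; rewrite eq_le measure_ge0 andbT -muL0 le_measure ?inE//.
by move=> z /=; rewrite !in_itv/= => /andP[].
Qed.

Let itvU (s t : R) : 0 <= s -> s <= t ->
  `[0, t]%classic = `[0, s]%classic `|` `]s, t]%classic.
Proof.
by move=> s0 st; rewrite -itv_bndbnd_setU// bnd_simp.
Qed.

Let muL_itv t : 0 <= t -> muL `[0, t]%classic = (L t - L 0)%:E.
Proof.
move=> t0; rewrite (itvU (lexx 0) t0) measureU//=; last first.
  apply/seteqP; split => // z /=; rewrite !in_itv/= => -[/andP[_ z0] /andP[]].
  by rewrite ltNge z0.
by rewrite [X in (X + _)%E]muL_00 add0e muLE.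
Qed.

Let nv_le1 s k : ~ badN s -> 0 <= s -> `|nv s k| <= 1.
Proof.
move=> nb s0; have [u1 _] : inward_normal n a (x s) (nv s).
  by apply: contrapT => h; apply: nb.
by apply: coord_le_sqrt => //; rewrite u1 expr1n.
Qed.

Let inv_nv t k : 0 <= t -> muL.-integrable `[0, t]%classic (EFin \o (fun s => nv s k)).
Proof.
move=> t0; have mE : measurable_fun `[0, t]%classic (EFin \o (fun s => nv s k)).
  by apply/measurable_EFinP; exact: measurable_funTS.
apply/integrableP; split => //.
have mDN : measurable (`[0, t]%classic `\` badN).
  by apply: measurableD => //; exact: measurable_not_inward.
have mabs : measurable_fun `[0, t]%classic (fun s => `|(EFin \o (fun s => nv s k)) s|%E).
  exact: measurableT_comp.
rewrite (ge0_negligible_integral measurable_not_inward)//.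
apply: (@le_lt_trans _ _ (\int[muL]_(s in `[0%R, t]%classic `\` badN) 1)%E).
  apply: ge0_le_integral => //; first by apply: measurable_funS mabs => //; exact: subDsetl.
  move=> s [/=]; rewrite in_itv/= => /andP[s0 _] nb; rewrite lee_fin.
  exact: nv_le1.
rewrite integral_cst ?mul1e; last by apply: measurableD => //; exact: measurable_not_inward.
apply: (@le_lt_trans _ _ (muL `[0%R, t]%classic)).
  by rewrite le_measure ?inE//; exact: subDsetl.
by rewrite muL_itv// ltry.
Qed.

Let D' := driftinc x b.

Lemma path_increment s t k : 0 <= s -> s <= t ->
  D' s t k = \int[muL]_(r in `]s, t]) nv r k - \int[leb]_(r in `]s, t]) gradPhi n a phi (x r) k.
Proof.
move=> s0 st; have t0 := le_trans s0 st.
have e1 : \int[leb]_(r in `[0, t]) gradPhi n a phi (x r) k -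
    \int[leb]_(r in `[0, s]) gradPhi n a phi (x r) k =
    \int[leb]_(r in `]s, t]) gradPhi n a phi (x r) k.
  by apply: Rintegral_itvB; rewrite ?bnd_simp//; exact: igrad.
have e2 : \int[muL]_(r in `[0, t]) nv r k =
    \int[muL]_(r in `[0, s]) nv r k + \int[muL]_(r in `]s, t]) nv r k.
  rewrite (itvU s0 st) Rintegral_setU//; first by rewrite -itvU//; exact: inv_nv.
  apply/disj_setPS => z [/=]; rewrite !in_itv/= => /andP[_ zs] /andP[].
  by rewrite ltNge zs.
rewrite /D' /driftinc (eqx k t0) (eqx k s0) -e1 e2; ring.
Qed.

Let sub0 (s t : R) : 0 <= s -> (`]s, t] `<=` `[0, t])%classic.
Proof.
move=> s0 z /=; rewrite !in_itv/= => /andP[sz ->].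
by rewrite (le_trans s0 (ltW sz)).
Qed.

Let igradst s t k : 0 <= s -> s <= t ->
  leb.-integrable `]s, t]%classic (EFin \o (fun r => gradPhi n a phi (x r) k)).
Proof.
move=> s0 st; apply: (integrableS _ _ _ (igrad k (le_trans s0 st))) => //.
exact: sub0.
Qed.

Let invst s t k : 0 <= s -> s <= t ->
  muL.-integrable `]s, t]%classic (EFin \o (fun r => nv r k)).
Proof.
move=> s0 st; apply: (integrableS _ _ (sub0 s0)) => //.
exact: inv_nv (le_trans s0 st).
Qed.

Let L_mono s t : 0 <= s -> s <= t -> 0 <= L t - L s.
Proof. by move=> s0 st; rewrite -lee_fin -muLE. Qed.

Let muL_lower s t (f : R -> R) o : 0 <= s -> s <= t -> 0 <= o ->
  muL.-integrable `]s, t]%classic (EFin \o f) ->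
  (forall r, s < r <= t -> ~ badN r -> - o <= f r) ->
  - (o * (L t - L s)) <= \int[muL]_(r in `]s, t]) f r.
Proof.
move=> s0 st o0 fi fo; have mN := measurable_not_inward.
have mDN : measurable (`]s, t]%classic `\` badN) by exact: measurableD.
have ltmu : (muL (`]s, t]%classic `\` badN) <= (L t - L s)%:E)%E.
  by rewrite -muLE// le_measure ?inE//; exact: subDsetl.
rewrite /Rintegral (negligible_integral mN _ fi)//.
apply: (@le_trans _ _ (\int[muL]_(r in `]s, t]%classic `\` badN) (- o))).
  rewrite Rintegral_cst// mulNr lerN2 ler_wpM2l//.
  rewrite -lee_fin fineK// ge0_fin_numE//; exact: le_lt_trans ltmu (ltry _).
apply: le_Rintegral => //.
- apply/integrableP; split; first exact: measurable_cst.
  rewrite integral_cst// lte_mul_pinfty ?lee_fin//.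
  exact: le_lt_trans ltmu (ltry _).
- by apply: (integrableS _ _ _ fi) => //; exact: subDsetl.
- by move=> r [/=]; rewrite in_itv/=; exact: fo.
Qed.

Let g1 r := norm1 (gradPhi n a phi (x r)).

Let ig1 s t : 0 <= s -> s <= t ->
  leb.-integrable `]s, t]%classic (EFin \o g1) /\
  \int[leb]_(r in `]s, t]) g1 r =
    \sum_k \int[leb]_(r in `]s, t]) `|gradPhi n a phi (x r) k|.
Proof.
move=> s0 st; apply: Rintegral_sum => // k.
exact: integrable_norm (igradst k s0 st).
Qed.

Let ig10 t : 0 <= t -> leb.-integrable `[0, t]%classic (EFin \o g1).
Proof.
move=> t0; have [] // := @Rintegral_sum _ _ leb `[0, t]%classic _ (index_enum 'I_d)
  (fun k r => `|gradPhi n a phi (x r) k|) _ _ => k.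
exact: integrable_norm (igrad k t0).
Qed.

(** One clock for drift and reflection. Each of the [d] coordinates of a unit normal contributes at
    most dL; [d.+1] instead of [d] keeps the factor at least 1, which [clock_drift] uses. *)
Definition clock t := \int[leb]_(r in `[0, t]) g1 r + d.+1%:R * L t.

Let clockB s t : 0 <= s -> s <= t ->
  clock t - clock s = \int[leb]_(r in `]s, t]) g1 r + d.+1%:R * (L t - L s).
Proof.
move=> s0 st; have t0 := le_trans s0 st.
have -> : \int[leb]_(r in `]s, t]) g1 r =
    \int[leb]_(r in `[0, t]) g1 r - \int[leb]_(r in `[0, s]) g1 r.
  by symmetry; apply: Rintegral_itvB; rewrite ?bnd_simp//; exact: ig10.
by rewrite /clock; ring.
Qed.

Lemma clock_variation s t : 0 <= s -> s <= t -> norm1 (D' s t) <= clock t - clock s.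
Proof.
move=> s0 st; rewrite clockB// (ig1 s0 st).2.
have dL : \sum_(k < d) (L t - L s) <= d.+1%:R * (L t - L s).
  by rewrite sumr_const card_ord -[leLHS]mulr_natl ler_wpM2r ?L_mono// ler_nat.
apply: le_trans (lerD (lexx _) dL); rewrite -big_split/=; apply: ler_sum => k _.
rewrite path_increment// addrC.
apply: le_trans (ler_normB _ _) _; apply: lerD; last first.
  by apply: le_normr_Rintegral => //; exact: igradst.
have h1 := @muL_lower s t (fun r => nv r k) 1 s0 st ler01 (invst k s0 st).
have iN : muL.-integrable `]s, t]%classic (EFin \o (fun r => -1 * nv r k)).
  exact: (integrableZl _ (-1) (invst k s0 st)).
have h2 := @muL_lower s t (fun r => -1 * nv r k) 1 s0 st ler01 iN.
have hr r : s < r <= t -> ~ badN r -> `|nv r k| <= 1.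
  by move=> /andP[sr _] nb; apply: nv_le1 => //; exact: le_trans s0 (ltW sr).
rewrite ler_norml; apply/andP; split.
  by rewrite -[X in - X]mul1r; apply: h1 => r rr nb; have := hr r rr nb; rewrite ler_norml => /andP[].
have e3 : \int[muL]_(r in `]s, t]) (-1 * nv r k) = -1 * \int[muL]_(r in `]s, t]) nv r k.
  by rewrite RintegralZl//; exact: invst.
have : - (1 * (L t - L s)) <= \int[muL]_(r in `]s, t]) (-1 * nv r k).
  by apply: h2 => r rr nb; have := hr r rr nb; rewrite ler_norml => /andP[]; lra.
rewrite e3; lra.
Qed.

(** The slack [o] allows a vector [c] frozen at time [s], while the geometric estimates hold for the
    transversal component at the running time [r]. *)
Lemma clock_drift s t (c : 'I_d -> R) C0 o : 0 <= s -> s <= t -> 0 <= o ->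
  (forall r, s < r <= t -> dotv c (gradPhi n a phi (x r)) <= C0 + o * g1 r) ->
  (forall r, s < r <= t -> inward_normal n a (x r) (nv r) -> - o <= dotv c (nv r)) ->
  - (C0 * (t - s)) - o * (clock t - clock s) <= dotv c (D' s t).
Proof.
move=> s0 st o0 hg hn.
have ic k : leb.-integrable `]s, t]%classic (EFin \o (fun r => c k * gradPhi n a phi (x r) k)).
  by apply: integrable_EFinZl => //; exact: igradst.
have icn k : muL.-integrable `]s, t]%classic (EFin \o (fun r => c k * nv r k)).
  by apply: integrable_EFinZl => //; exact: invst.
have [i1 e1] : leb.-integrable `]s, t]%classic
    (EFin \o (fun r => dotv c (gradPhi n a phi (x r)))) /\
    \int[leb]_(r in `]s, t]) dotv c (gradPhi n a phi (x r)) =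
    \sum_k \int[leb]_(r in `]s, t]) (c k * gradPhi n a phi (x r) k).
  exact: Rintegral_sum.
have [i2 e2] : muL.-integrable `]s, t]%classic (EFin \o (fun r => dotv c (nv r))) /\
    \int[muL]_(r in `]s, t]) dotv c (nv r) =
    \sum_k \int[muL]_(r in `]s, t]) (c k * nv r k).
  exact: Rintegral_sum.
have -> : dotv c (D' s t) = \int[muL]_(r in `]s, t]) dotv c (nv r)
    - \int[leb]_(r in `]s, t]) dotv c (gradPhi n a phi (x r)).
  rewrite e2 e1 -sumrB; apply: eq_bigr => k _.
  rewrite path_increment// mulrBr RintegralZl//; last exact: invst.
  by rewrite RintegralZl//; exact: igradst.
have h1 : - (o * (L t - L s)) <= \int[muL]_(r in `]s, t]) dotv c (nv r).
  apply: muL_lower => // r rr nb; apply: hn => //; apply: contrapT => h; apply: nb.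
  by split => //; case/andP: rr => sr _; exact: le_trans s0 (ltW sr).
have [ig _] := ig1 s0 st.
have icst : leb.-integrable `]s, t]%classic (EFin \o (fun=> C0)).
  apply/integrableP; split; first exact: measurable_cst.
  rewrite integral_cst// lte_mul_pinfty ?lee_fin//=.
  by rewrite lebesgue_measure_itv/=; case: ifP => _; rewrite -?EFinB ltry.
have iog : leb.-integrable `]s, t]%classic (EFin \o (fun r => o * g1 r)).
  exact: (integrableZl _ o ig).
have h2 : \int[leb]_(r in `]s, t]) dotv c (gradPhi n a phi (x r)) <=
    C0 * (t - s) + o * \int[leb]_(r in `]s, t]) g1 r.
  apply: (@le_trans _ _ (\int[leb]_(r in `]s, t]) (C0 + o * g1 r))).
    apply: le_Rintegral => //.
    exact: (integrableD _ icst iog).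
  rewrite RintegralD// Rintegral_cst// RintegralZl//.
  have -> // : fine (leb `]s, t]%classic) = t - s.
  rewrite lebesgue_measure_itv/= lte_fin; case: ltP => [_|ts]/=; first by [].
  by have -> : t = s; [apply/eqP; rewrite eq_le ts st|rewrite subrr].
rewrite clockB//; have := L_mono s0 st => hL.
have h3 : o * (L t - L s) <= o * (d.+1%:R * (L t - L s)).
  by rewrite ler_wpM2l// ler_peMl// ler1n.
exact: clock_arith h1 h2 h3.
Qed.

Hypothesis bd0 : leb [set s | 0 <= s /\ onBd n a (x s)] = 0%E.

(** A Lebesgue null set contains no open interval. This supplies the starting times at which the
    path is off every wall. *)
Lemma interior_times_dense s t : 0 <= s -> s < t -> exists2 r, s < r < t & inD n a (x r).
Proof.
move=> s0 st; apply: contrapT => h.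
have mP0 : measurable P0 by exact: measurable_itv.
have bdE : [set s | 0 <= s /\ onBd n a (x s)] =
    \bigcup_i (if insub i is Some j
      then P0 `&` (fun s => dotv (x s) (n j)) @^-1` `]-oo, a j]%classic else set0).
  apply/seteqP; split => r.
    move=> [r0 [Dr nD]]; have [j hj] : exists j, dotv (x r) (n j) <= a j.
      apply: contrapT => hn; apply: nD => j; rewrite ltNge; apply/negP => hj.
      by apply: hn; exists j.
    exists (j : nat) => //; rewrite valK; split; first by rewrite /P0/= in_itv/= r0.
    by rewrite /= in_itv.
  move=> [i _]; case: insubP => // j _ _ [+]; rewrite /P0/= !in_itv/= andbT => r0 hj.
  split => //; split; first exact: Dx.
  by move=> /(_ j); rewrite ltNge hj.
have mbd : measurable [set s | 0 <= s /\ onBd n a (x s)].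
  rewrite bdE; apply: bigcupT_measurable => i; case: insub => // j.
  have md : measurable_fun P0 (fun s => dotv (x s) (n j)).
    by apply: measurable_sum => k; apply: measurable_funM => //; exact: mx.
  by apply: md.
have sub : `]s, t[%classic `<=` [set s | 0 <= s /\ onBd n a (x s)].
  move=> r /=; rewrite in_itv/= => /andP[sr rt].
  have r0 : 0 <= r by exact: le_trans s0 (ltW sr).
  split => //; split; first exact: Dx.
  by move=> Dr; apply: h; exists r => //; rewrite sr rt.
have : (leb `]s, t[%classic <= 0)%E.
  by rewrite -bd0; apply: le_measure => //; rewrite inE.
rewrite lebesgue_measure_itv/= lte_fin st -EFinB lee_fin; lra.
Qed.

End PathData.

(* All that is used of the equation along a path: [W] dominates the variation of
   X - B, and bounding c.gradPhi from above and c.normal from below along the path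
   bounds c.(X - B) from below. *)
Definition good_path (R : realType) (d m : nat) (n : 'I_m -> 'I_d -> R) (a : 'I_m -> R)
    (phi : 'I_m -> R -> \bar R) (x b : R -> 'I_d -> R) : Prop :=
  [/\ forall k, {within `[0, +oo[%classic, continuous (fun t => x t k)},
    forall k, {within `[0, +oo[%classic, continuous (fun t => b t k)},
    forall t, 0 <= t -> inDbar n a (x t),
    forall s t, 0 <= s -> s < t -> exists2 r, s < r < t & inD n a (x r) &
    exists W : R -> R,
      (forall s t, 0 <= s -> s <= t -> norm1 (driftinc x b s t) <= W t - W s) /\
      (forall s t (c : 'I_d -> R) C0 o, 0 <= s -> s <= t -> 0 <= o ->
        (forall r, s < r <= t ->
          dotv c (gradPhi n a phi (x r)) <= C0 + o * norm1 (gradPhi n a phi (x r))) ->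
        (forall r v, s < r <= t -> inward_normal n a (x r) v -> - o <= dotv c v) ->
        - (C0 * (t - s)) - o * (W t - W s) <= dotv c (driftinc x b s t))].

Lemma mvsde_good_path (R : realType) (dT : measure_display) (T : measurableType dT)
  (P : probability T R) (F : R -> set (set T)) (d m : nat)
  (B : R -> T -> 'I_d -> R)
  (phi : 'I_m -> R -> \bar R) (n : 'I_m -> 'I_d -> R) (a : 'I_m -> R)
  (X : R -> T -> 'I_d -> R) (L : R -> T -> R) :
  brownian P F B -> (exists x, inD n a x) -> mvsde_solution P F n a phi B X L ->
  {ae P, forall w, good_path n a phi (fun t => X t w) (fun t => B t w)}.
Proof.
move=> [_ _ cB _] [xD DxD] [_ _ sol].
apply: filterS2 cB sol => w cb [cx [cL [Dx [_ [_ [bd0 [igrad]]]]]]].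
move=> [nv [muL [mnv [muL0 [muLE [_ [normalL eqx]]]]]]].
split => //; first exact: interior_times_dense bd0.
exists (clock n a phi (fun t => X t w) (fun t => L t w)); split.
  by move=> s t s0 st; apply: (clock_variation (muL := muL) DxD) => //; exact: eqx.
move=> s t c C0 o s0 st o0 hg hn.
apply: (clock_drift (muL := muL) (nv := nv) DxD) => //.
by move=> r sr; exact: hn.
Qed.

(** * One step of the discretization *)

Section LyapMeasurable.
Context (R : realType) (dE : measure_display) (E : measurableType dE).

Lemma measurable_inv_pos (f : E -> R) : measurable_fun setT f -> (forall w, 0 < f w) ->
  measurable_fun setT (fun w => (f w)^-1).
Proof.
move=> mf f0.
have -> : (fun w => (f w)^-1) = (fun w => (f w) `^ (-1)).
  by apply/funext => w; rewrite powR_inv1// ltW.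
exact: (measurableT_comp (@measurable_powR R (-1)) mf).
Qed.

Variables (d : nat) (Y : E -> 'I_d -> R).
Hypothesis mY : forall k, measurable_fun setT (fun w => Y w k).

Lemma measurable_dotv (Z : E -> 'I_d -> R) : (forall k, measurable_fun setT (fun w => Z w k)) ->
  measurable_fun setT (fun w => dotv (Y w) (Z w)).
Proof. by move=> mZ; apply: measurable_sum => k; exact: measurable_funM. Qed.

Lemma measurable_norm1 : measurable_fun setT (fun w => norm1 (Y w)).
Proof.
apply: measurable_sum => k; exact: (measurableT_comp (@normr_measurable R setT) (mY k)).
Qed.

Lemma measurable_app (Q : 'I_d -> 'I_d -> R) k : measurable_fun setT (fun w => app Q (Y w) k).
Proof.
by apply: measurable_sum => l; apply: measurable_funM => //; exact: measurable_cst.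
Qed.

Lemma measurable_rho e : measurable_fun setT (fun w => rho e (Y w)).
Proof.
have ms : measurable_fun [set: R] (@Num.sqrt R).
  by apply: continuous_measurable_fun; exact: sqrt_continuous.
apply: (measurableT_comp ms); apply: measurable_funD; last exact: measurable_cst.
exact: measurable_dotv.
Qed.

Variables (K c0 e : R).
Hypotheses (e0 : 0 < e).

Let rho0 w : 0 < rho e (Y w). Proof. by apply: lt_le_trans e0 _; exact: rho_ge. Qed.
Let mr := measurable_rho e.

Lemma measurable_lyap : measurable_fun setT (fun w => lyap K c0 e (Y w)).
Proof.
have mm : measurable_fun setT (fun w => Num.min (rho e (Y w)) c0).
  by apply: measurable_minr => //; exact: measurable_cst.
apply: measurable_funD; first exact: (measurableT_comp (@measurable_ln R) mm).
by apply: measurable_funM => //; exact: measurable_cst.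
Qed.

Lemma measurable_lyap_alpha : measurable_fun setT (fun w => lyap_alpha K (rho e (Y w))).
Proof.
apply: measurable_funM.
  by apply: measurable_funD; [exact: measurable_inv_pos|exact: measurable_cst].
apply: measurable_inv_pos => [|w]; last by rewrite mulr_gt0.
by apply: measurable_funM => //; exact: measurable_cst.
Qed.

Lemma measurable_lyap_beta : measurable_fun setT (fun w => lyap_beta K (rho e (Y w))).
Proof.
apply: measurable_funM.
  apply: measurable_funD; last exact: measurable_cst.
  by apply: measurable_funM; [exact: measurable_cst|exact: measurable_inv_pos].
apply: measurable_inv_pos => [|w]; last by rewrite mulr_gt0// exprn_gt0.
by apply: measurable_funM; [exact: measurable_cst|exact: measurable_funX].
Qed.

End LyapMeasurable.

(** Makes the closure properties of measurable functions available for adapted ones. *)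
Lemma meas_wrtP (R : realType) (dT : measure_display) (T : measurableType dT)
  (G : set (set T)) (f : T -> R) : sigma_algebra setT G ->
  meas_wrt G f <-> measurable_fun setT (f : g_sigma_algebraType G -> R).
Proof.
move=> sG; have GE : G = <<s G >> by rewrite sigma_algebra_id.
split=> [mf _ C mC|mf C mC].
  by rewrite setTI [measurable _](_ : _ = <<s G >> (f @^-1` C))// -GE; exact: mf.
by rewrite GE; have := mf measurableT C mC; rewrite setTI.
Qed.

Lemma norm1_cube (R : realType) d (v : 'I_d -> R) : norm1 v ^+ 3 <= d%:R ^+ 3 * \sum_k `|v k| ^+ 3.
Proof.
case: d v => [|d] v; first by rewrite /norm1 !big_ord0 expr0n/= mul0r.
pose k0 := [arg max_(k > ord0) `|v k|]%O.
have km k : `|v k| <= `|v k0|.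
  by rewrite /k0; case: arg_maxP => // i _ /(_ k isT).
apply: (@le_trans _ _ ((d.+1%:R * `|v k0|) ^+ 3)).
  rewrite lerXn2r ?nnegrE ?norm1_ge0 ?mulr_ge0//.
  apply: le_trans (_ : \sum_(k < d.+1) `|v k0| <= _); first exact: ler_sum.
  by rewrite sumr_const card_ord mulr_natl.
rewrite exprMn ler_wpM2l ?exprn_ge0// (bigD1 k0)//= lerDl sumr_ge0// => i _.
Qed.

Section OneStep.
Context (R : realType) (dT : measure_display) (T : measurableType dT).
Variable P : probability T R.
Context (d : nat) (F : R -> set (set T)) (B : R -> T -> 'I_d -> R).
Hypothesis filF : filtration F.
Hypothesis BM : brownian P F B.

(** The expectation in a second order expansion: centred linear terms and mixed products vanish, and
    the squares leave the trace of the coefficients. *)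
Lemma increment_quadratic (s t : R) (c1 : 'I_d -> T -> R) (c2 : 'I_d -> 'I_d -> T -> R) (C : R) :
  0 <= s -> s < t ->
  (forall k, meas_wrt (F s) (c1 k)) -> (forall k l, meas_wrt (F s) (c2 k l)) ->
  (forall k w, `|c1 k w| <= C) -> (forall k l w, `|c2 k l w| <= C) ->
  let dB w k := B t w k - B s w k in
  P.-integrable setT (fun w => (\sum_k c1 k w * dB w k
    + \sum_k \sum_l c2 k l w * (dB w k * dB w l))%:E) /\
  \int[P]_w (\sum_k c1 k w * dB w k + \sum_k \sum_l c2 k l w * (dB w k * dB w l))
    = (\int[gauss (Num.sqrt (t - s))]_x x ^+ 2) * \int[P]_w (\sum_k c2 k k w).
Proof.
move=> s0 st m1 m2 b1 b2 dB.
have [i1 e1] := Rintegral_sum (mu := P) (D := setT) (index_enum 'I_d) measurableT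
  (fun k => (increment_mean filF BM s0 st (m1 k) (b1 k) k).1).
have H2 k l : P.-integrable setT (fun w => (c2 k l w * (dB w k * dB w l))%:E) /\
    \int[P]_w (c2 k l w * (dB w k * dB w l)) =
    if l == k then \int[P]_w c2 k k w * \int[gauss (Num.sqrt (t - s))]_x x ^+ 2 else 0.
  have [->|lk] := eqVneq l k.
    exact: (increment_sqr filF BM s0 st (m2 k k) (b2 k k) k).
  by apply: (increment_cov filF BM s0 st (m2 k l) (b2 k l)); rewrite eq_sym.
have S2 k := Rintegral_sum (mu := P) (D := setT) (index_enum 'I_d) measurableT
  (fun l => (H2 k l).1).
have [i2 e2] := Rintegral_sum (mu := P) (D := setT) (index_enum 'I_d) measurableT
  (fun k => (S2 k).1).
split.
  exact: (@eq_integrable _ _ _ _ _ measurableT _ _ _ (integrableD measurableT i1 i2)).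
rewrite RintegralD// e1 e2.
rewrite big1 ?add0r; last by move=> k _; exact: (increment_mean filF BM s0 st (m1 k) (b1 k) k).2.
have ic k : P.-integrable setT (EFin \o c2 k k).
  exact: (bounded_integrable P (meas_wrt_measurable filF (m2 k k)) (b2 k k)).
rewrite (Rintegral_sum (mu := P) (D := setT) (index_enum 'I_d) measurableT ic).2 mulr_sumr.
apply: eq_bigr => k _; rewrite (S2 k).2 (bigD1 k)//= (H2 k k).2 eqxx big1 ?addr0 1?mulrC//.
by move=> l /negbTE lk; rewrite (H2 k l).2 lk.
Qed.


Variables (Q : 'I_d -> 'I_d -> R).
Hypothesis Qsym : forall k l, Q k l = Q l k.
Hypothesis Qidem : forall k l, \sum_j Q k j * Q j l = Q k l.
Variables (K c0 e : R).
Hypotheses (K0 : 0 <= K) (c00 : 0 < c0) (e0 : 0 < e) (ec0 : e <= c0).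

(** For [y] in the range of [Q] and below the cut-off, this is half the Laplacian of [lyap] along
    that range. *)
Definition lyap_gain (y : 'I_d -> R) : R :=
  lyap_alpha K (rho e y) * (\sum_k Q k k) - 4 * lyap_beta K (rho e y) * dotv y y.

Lemma lyap_taylor_app : exists2 C, 0 <= C & forall y v, rho e y <= c0 / 2 -> app Q y = y ->
  (\sum_k (lyap_alpha K (rho e y) * 2 * y k) * v k
   + \sum_k \sum_l (lyap_alpha K (rho e y) * Q k l
       - 4 * lyap_beta K (rho e y) * (y k * y l)) * (v k * v l))
   - C * \sum_k `|v k| ^+ 3 <= lyap K c0 e (y + app Q v) - lyap K c0 e y.
Proof.
have [C C0 HC] := lyap_taylor d K0 c00 e0 ec0.
pose q := \sum_k \sum_l `|Q k l|.
have q0 : 0 <= q by apply: sumr_ge0 => k _; exact: sumr_ge0.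
exists (C * (q ^+ 3 * d%:R ^+ 3)); first by nneg.
move=> y v ry Qy; have := HC y (app Q v) ry.
have h3 : C * norm1 (app Q v) ^+ 3 <= C * (q ^+ 3 * d%:R ^+ 3) * \sum_k `|v k| ^+ 3.
  rewrite -(mulrA C) ler_wpM2l//; apply: (@le_trans _ _ ((q * norm1 v) ^+ 3)).
    rewrite lerXn2r ?nnegrE ?norm1_ge0 ?mulr_ge0 ?norm1_ge0//.
    exact: norm1_app.
  by rewrite exprMn -[leRHS]mulrA ler_wpM2l ?exprn_ge0// norm1_cube.
rewrite (dotv_app_app Qsym Qidem) -(dotv_app Qsym) Qy.
set al := lyap_alpha _ _; set be := lyap_beta _ _.
have -> : \sum_k al * 2 * y k * v k = al * (2 * dotv y v).
  by rewrite /dotv !mulr_sumr; apply: eq_bigr => k _; ring.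
have -> : \sum_k \sum_l (al * Q k l - 4 * be * (y k * y l)) * (v k * v l) =
    al * (\sum_k \sum_l Q k l * (v k * v l)) - 4 * be * dotv y v ^+ 2.
  rewrite expr2 /dotv mulr_suml !mulr_sumr -sumrB; apply: eq_bigr => k _.
  rewrite !mulr_sumr -sumrB; apply: eq_bigr => l _; ring.
move: h3; lra.
Qed.

Lemma lyap_range (y z : 'I_d -> R) :
  `|lyap K c0 e z - lyap K c0 e y| <= lyapG K c0 - lyapG K e.
Proof.
have h1 := lyap_ge K0 e0 ec0 y; have h2 := lyap_le K0 c00 e0 y.
have h3 := lyap_ge K0 e0 ec0 z; have h4 := lyap_le K0 c00 e0 z.
by rewrite ler_norml; move: h1 h2 h3 h4; lra.
Qed.

(** Concerns the Brownian part of a step only. The cubic remainder costs the power 3/2 of the mesh,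
    so it still vanishes after summation over all steps. *)
Lemma lyap_one_step : exists2 C, 0 <= C &
  forall (s t : R) (G : set T) (Y : T -> 'I_d -> R), 0 <= s -> s < t -> F s G ->
  (forall k, meas_wrt (F s) (fun w => Y w k)) ->
  (forall k, measurable_fun setT (fun w => B t w k - B s w k)) ->
  (forall w, app Q (Y w) = Y w) -> (forall w, G w -> rho e (Y w) <= c0 / 2) ->
  (\int[gauss (Num.sqrt (t - s))]_x x ^+ 2) * (\int[P]_w (\1_G w * lyap_gain (Y w)))
    - C * Num.sqrt (t - s) ^+ 3 <=
  \int[P]_w (\1_G w * (lyap K c0 e (Y w + app Q (fun k => B t w k - B s w k))
                        - lyap K c0 e (Y w))).
Proof.
have [C C0 HC] := lyap_taylor_app.
exists (C * (d%:R * 48)); first by nneg.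
move=> s t G Y s0 st FG mY mdB QY rG.
pose dB w k := B t w k - B s w k.
have [sF Fm _] := filF.
have mY' k : measurable_fun setT (fun w : g_sigma_algebraType (F s) => Y w k).
  by apply/meas_wrtP => //; exact: mY.
have mG' : measurable (G : set (g_sigma_algebraType (F s))).
  by rewrite [measurable _](_ : _ = <<s F s >> G)// sigma_algebra_id.
have m1G : measurable_fun setT (fun w : g_sigma_algebraType (F s) => (\1_G w : R)).
  exact: measurable_indic.
pose al w := lyap_alpha K (rho e (Y w)); pose be w := lyap_beta K (rho e (Y w)).
pose c1 k w := \1_G w * (al w * 2 * Y w k).
pose c2 k l w := \1_G w * (al w * Q k l - 4 * be w * (Y w k * Y w l)).
pose amax := (e^-1 + K) / (2 * e); pose bmax := (2 * e^-1 + K) / (8 * e ^+ 3).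
pose q := \sum_k \sum_l `|Q k l|.
have q0 : 0 <= q by apply: sumr_ge0 => k _; exact: sumr_ge0.
have amax0 : 0 <= amax by rewrite /amax; nneg.
have bmax0 : 0 <= bmax by rewrite /bmax; nneg.
pose CC := amax * 2 * c0 + amax * q + 4 * bmax * (c0 * c0).
have mc1 k : meas_wrt (F s) (c1 k).
  apply/meas_wrtP => //; apply: measurable_funM => //; apply: measurable_funM => //.
  by apply: measurable_funM; [exact: measurable_lyap_alpha|exact: measurable_cst].
have mc2 k l : meas_wrt (F s) (c2 k l).
  apply/meas_wrtP => //; apply: measurable_funM => //; apply: measurable_funB.
    by apply: measurable_funM; [exact: measurable_lyap_alpha|exact: measurable_cst].
  apply: measurable_funM; last exact: measurable_funM.
  by apply: measurable_funM; [exact: measurable_cst|exact: measurable_lyap_beta].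
have indG w (x M : R) : 0 <= M -> (G w -> `|x| <= M) -> `|\1_G w * x| <= M.
  move=> M0 h; rewrite indicE; case: (boolP (w \in G)) => wG /=.
    by rewrite mul1r h//; exact: set_mem.
  by rewrite mul0r normr0.
have er w : e <= rho e (Y w) by exact: rho_ge.
have abd w : `|al w| <= amax.
  by have /andP[h1 h2] := lyap_alpha_bound K0 c00 e0 ec0 (er w); rewrite ger0_norm.
have bbd w : `|be w| <= bmax.
  by have /andP[h1 h2] := lyap_beta_bound K0 c00 e0 ec0 (er w); rewrite ger0_norm.
have ybd w k : G w -> `|Y w k| <= c0.
  move=> Gw; apply: le_trans (coord_le_rho e _ k) _; apply: le_trans (rG _ Gw) _.
  by rewrite ler_pdivrMr// ler_peMr ?(ltW c00)// ler1n.
have CC1 : amax * 2 * c0 <= CC.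
  by rewrite /CC -addrA lerDl; nneg.
have CC2 : amax * q + 4 * bmax * (c0 * c0) <= CC.
  by rewrite /CC -addrA lerDr; nneg.
have CC0 : 0 <= CC by rewrite /CC; nneg.
have bc1 k w : `|c1 k w| <= CC.
  apply: indG => // Gw; apply: le_trans CC1.
  rewrite normrM (normrM (al w)) (ger0_norm (_ : 0 <= 2 :> R))//.
  by apply: ler_pM; rewrite ?ler_wpM2r ?mulr_ge0 ?ybd.
have bc2 k l w : `|c2 k l w| <= CC.
  apply: indG => // Gw; apply: le_trans CC2; apply: le_trans (ler_normB _ _) _.
  apply: lerD.
    rewrite normrM; apply: ler_pM => //.
    rewrite /q (bigD1 k)//= (bigD1 l)//= -addrA lerDl.
    by apply: addr_ge0; [exact: sumr_ge0|apply: sumr_ge0 => ? _; exact: sumr_ge0].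
  rewrite normrM (normrM 4) (ger0_norm (_ : 0 <= 4 :> R))//.
  apply: ler_pM => //; first by rewrite ler_wpM2l.
  by rewrite normrM; apply: ler_pM; rewrite ?ybd.
have [iq eq_] := increment_quadratic s0 st mc1 mc2 bc1 bc2.
have [i3 e3] := Rintegral_sum (mu := P) (D := setT) (index_enum 'I_d) measurableT
  (fun k => (increment_cube filF BM s0 st k).1).
have -> : \int[P]_w (\1_G w * lyap_gain (Y w)) = \int[P]_w (\sum_k c2 k k w).
  apply: eq_Rintegral => w _; rewrite -mulr_sumr; congr (_ * _).
  by rewrite /lyap_gain sumrB -mulr_sumr -mulr_sumr.
rewrite -eq_.
set S3 := fun w => \sum_k `|dB w k| ^+ 3.
have iC3 : P.-integrable setT (EFin \o (fun w => C * S3 w)) by exact: integrable_EFinZl.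
have l3 : \int[P]_w (C * S3 w) <= C * (d%:R * 48) * Num.sqrt (t - s) ^+ 3.
  rewrite RintegralZl// -!mulrA ler_wpM2l// e3.
  apply: le_trans (_ : \sum_(k < d) 48 * Num.sqrt (t - s) ^+ 3 <= _).
    by apply: ler_sum => k _; exact: (increment_cube filF BM s0 st k).2.
  by rewrite sumr_const card_ord [leRHS]mulr_natl.
apply: le_trans (lerB (lexx _) l3) _.
rewrite -RintegralB//; apply: le_Rintegral => //.
- exact: (@eq_integrable _ _ _ _ _ measurableT _ _ _ (integrableB measurableT iq iC3)).
- have GG w v : `|lyap K c0 e (Y w + v) - lyap K c0 e (Y w)| <= lyapG K c0 - lyapG K e.
    exact: lyap_range.
  apply: (bounded_integrable P (K := lyapG K c0 - lyapG K e)).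
    have mYw k : measurable_fun setT (fun w => Y w k) by exact: meas_wrt_measurable (mY k).
    apply: measurable_funM; first by apply: measurable_indic; exact: Fm FG.
    apply: measurable_funB; apply: measurable_lyap => // k.
    by apply: measurable_funD => //; exact: measurable_app.
  by move=> w; apply: indG => //; rewrite subr_ge0 lyapG_le.
move=> w _; rewrite /c1 /c2 /S3 indicE; case: (boolP (w \in G)) => wG /=; last first.
  have C3 : 0 <= C * \sum_k `|dB w k| ^+ 3.
    by rewrite mulr_ge0// sumr_ge0// => k _; rewrite exprn_ge0.
  rewrite mul0r [X in X + _ - _]big1 ?[X in _ + X - _]big1 ?add0r ?oppr_le0//.
    by move=> k _; rewrite big1// => l _; rewrite !mul0r.
  by move=> k _; rewrite !mul0r.
have := HC (Y w) (dB w) (rG _ (set_mem wG)) (QY w).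
rewrite mul1r; congr (_ <= _); congr (_ + _ - _).
  by apply: eq_bigr => k _; rewrite mul1r.
by apply: eq_bigr => k _; apply: eq_bigr => l _; rewrite mul1r.
Qed.

End OneStep.

(** * The stopped sum along a grid *)

Section StoppedSums.
Variable R : realType.
Implicit Types (g : nat -> bool) (f x v : nat -> R).

Lemma decreasing_pred g : (forall i, g i.+1 -> g i) ->
  forall k i, (i <= k)%N -> g k -> g i.
Proof.
move=> gd; elim=> [|k IH] i; first by rewrite leqn0 => /eqP->.
by rewrite leq_eqVlt ltnS => /predU1P[->//|ik] /gd; exact: IH.
Qed.

(** For decreasing [g] with [g 0], this is [f] at the first index where [g] fails, or at [N] if
    there is none before; it is 0 when [g 0] fails. The telescoping form lets expectations be taken
    step by step. *)
Definition stopped g f N : R := (g 0)%N%:R * f 0%N + \sum_(i < N) (g i)%:R * (f i.+1 - f i).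

Lemma stopped_recr g f N : stopped g f N.+1 = stopped g f N + (g N)%:R * (f N.+1 - f N).
Proof. by rewrite /stopped big_ord_recr/= addrA. Qed.

Lemma stopped_eq g f N j : (0 < j <= N)%N -> (forall i, (i < j)%N -> g i) ->
  (forall i, (j <= i < N)%N -> ~~ g i) -> stopped g f N = f j.
Proof.
move=> /andP[j0 jN] gT gF; elim: N jN gF => [|N IH] jN gF; first by case: j j0 jN {gT gF}.
rewrite stopped_recr; move: jN; rewrite leq_eqVlt ltnS => /predU1P[jE|jN]; last first.
  rewrite (negbTE (gF N _)) ?jN//= mul0r addr0 IH// => i /andP[ji iN].
  by rewrite gF// ji ltnW.
have fN k : (k <= N)%N -> stopped g f k = f k.
  elim: k => [|k IHk] kN; first by rewrite /stopped big_ord0 gT ?jE// mul1r addr0.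
  by rewrite stopped_recr IHk ?(ltnW kN)// gT ?jE ?mul1r 1?addrC ?subrK// ltnS ltnW.
by rewrite fN// gT ?jE// mul1r addrC subrK.
Qed.

Lemma stopped_le g f N C : (forall i, g i.+1 -> g i) -> 0 <= C -> (forall i, f i <= C) ->
  stopped g f N <= C.
Proof.
move=> gd C0 fC.
have gle := decreasing_pred gd.
elim: N => [|N IH].
  by rewrite /stopped big_ord0 addr0; case: (g 0%N); rewrite ?mul1r ?mul0r.
have [gN|gN] := boolP (g N); last by rewrite stopped_recr (negbTE gN) mul0r addr0.
have gi i : (i < N.+1)%N -> g i by rewrite ltnS => iN; exact: gle gN.
rewrite (@stopped_eq _ _ _ N.+1) ?leqnn// => i.
by move=> /andP[a b]; have := leq_ltn_trans a b; rewrite ltnn.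
Qed.

(** At an index [i] where [g] still holds, [V] controls the variation only up to the start of step
    [i]; the last step taken may be large and is paid for by [r]. *)
Lemma stopped_sum_ge g x v N (C V r : R) : (forall i, g i.+1 -> g i) -> 0 <= C -> 0 <= r -> 0 <= V ->
  (forall i, 0 <= v i) -> (forall i, g i -> \sum_(j < i) v j <= V) ->
  (forall i, g i -> - (C * v i) <= x i) -> (forall i, g i -> - r <= x i) ->
  - (C * V + r) <= \sum_(i < N) (g i)%:R * x i.
Proof.
move=> gd C0 r0 V0 v0 gV xv xr.
have gle := decreasing_pred gd.
elim: N => [|N IH]; first by rewrite big_ord0 oppr_le0 addr_ge0// mulr_ge0.
rewrite big_ord_recr/=; have [gN|gN] := boolP (g N); last by rewrite mul0r addr0.
have h1 : - (C * \sum_(j < N) v j) <= \sum_(i < N) (g i)%:R * x i.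
  rewrite mulr_sumr -sumrN; apply: ler_sum => i _.
  have gi : g i by apply: gle gN; exact: ltnW.
  by rewrite gi mul1r xv.
have h2 := xr _ gN; have h3 := ler_wpM2l C0 (gV _ gN).
rewrite mul1r; lra.
Qed.

End StoppedSums.

Section Grid.
Variable R : realType.

Definition grid (q : R) (N i : nat) : R := q + i%:R / N.+1%:R.

Lemma grid0 q N : grid q N 0 = q. Proof. by rewrite /grid mul0r addr0. Qed.

Lemma gridS q N i : grid q N i.+1 - grid q N i = N.+1%:R^-1.
Proof. by rewrite /grid -(@natr1 _ i) opprD addrACA subrr add0r -mulrBl addrAC subrr add0r mul1r. Qed.

Lemma grid_lt q N i : grid q N i < grid q N i.+1.
Proof. by rewrite -subr_gt0 gridS invr_gt0 ltr0n. Qed.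

Lemma grid_ge q N i : q <= grid q N i.
Proof. by rewrite /grid lerDl divr_ge0. Qed.

Lemma grid_le q N i j : (i <= j)%N -> grid q N i <= grid q N j.
Proof. by move=> ij; rewrite /grid lerD2l ler_wpM2r ?invr_ge0// ler_nat. Qed.

End Grid.

Lemma Rintegral_prob_cst (R : realType) (dT : measure_display) (T : measurableType dT)
  (P : probability T R) (r : R) : \int[P]_w (cst r w) = r.
Proof.
transitivity (fine (\int[P]_w (cst r%:E w))%E); first by [].
by rewrite integral_cst//= probability_setT mule1.
Qed.

(** * The hitting probability, from the stopped Lyapunov function *)

Section Hitting.
Context (R : realType) (dT : measure_display) (T : measurableType dT).
Variable P : probability T R.
Context (d : nat) (F : R -> set (set T)) (B X : R -> T -> 'I_d -> R).
Hypothesis filF : filtration F.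
Hypothesis BM : brownian P F B.
Hypothesis XA : forall t k, 0 <= t -> meas_wrt (F t) (fun w => X t w k).
Variables (Q : 'I_d -> 'I_d -> R) (x0 : 'I_d -> R).
Hypothesis Qsym : forall k l, Q k l = Q l k.
Hypothesis Qidem : forall k l, \sum_j Q k j * Q j l = Q k l.
Variables (K c0 e r0 Mv q : R).
Hypotheses (K0 : 0 <= K) (c00 : 0 < c0) (e0 : 0 < e) (ec0 : e <= c0) (r00 : 0 < r0)
  (Mv0 : 0 <= Mv) (q0 : 0 <= q).
Variable Gd : R -> set T.
Hypothesis GdF : forall t, 0 <= t -> F t (Gd t).

(* The component of X_t - x0 orthogonal to H_J, when [Q] projects onto the span of the normals in J. *)
Definition trans t w : 'I_d -> R := app Q (X t w - x0).

Hypothesis Gd_rho : forall t w, Gd t w -> rho e (trans t w) <= c0 / 2.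
Hypothesis Gd_gain : forall t w, Gd t w -> 0 <= lyap_gain Q K e (trans t w).

Notation t_ := (grid q).
Let f t w := lyap K c0 e (trans t w).
Definition binc N i w : 'I_d -> R := fun k => B (t_ N i.+1) w k - B (t_ N i) w k.
Definition ainc N i w : 'I_d -> R := driftinc (X^~ w) (B^~ w) (t_ N i) (t_ N i.+1).

(* The grid points 0, ..., i lie in the region [Gd], the walk starts at distance
   >= [r0], and the variation of X - B so far is at most [Mv]: this last condition
   makes [excess_sum] bounded below uniformly in N. *)
Fixpoint stay N i : set T :=
  (if i is j.+1 then stay N j else [set w | r0 ^+ 2 <= dotv (trans q w) (trans q w)])
  `&` (Gd (t_ N i) `&` [set w | \sum_(j < i) norm1 (ainc N j w) <= Mv]).

(** Splits a step: up to [fmid] only the Brownian increment acts and expectations are used; from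
    [fmid] on the drift and reflection are estimated path by path. *)
Definition fmid N i w := lyap K c0 e (trans (t_ N i) w + app Q (binc N i w)).

Definition stopval N w := stopped (fun i => w \in stay N i) (fun i => f (t_ N i) w) N.+1.

Definition gvar N : R := \int[gauss (Num.sqrt N.+1%:R^-1)]_x x ^+ 2.

(* The increment of [f] over a step, its Brownian part [fmid - f] being replaced by a
   lower bound of its conditional expectation, up to O(h^(3/2)). *)
Definition excess N i w := lyap_gain Q K e (trans (t_ N i) w) * gvar N
   + (f (t_ N i.+1) w - fmid N i w).

Definition excess_sum N w := \sum_(i < N.+1) (w \in stay N i)%:R * excess N i w.

Lemma trans_step N i w :
  trans (t_ N i.+1) w = trans (t_ N i) w + app Q (binc N i w) + app Q (ainc N i w).
Proof.
rewrite /trans -addrA -!appD; congr app; apply/funext => k.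
by rewrite /binc /ainc /driftinc !fctE; ring.
Qed.

Lemma app_trans t w : app Q (trans t w) = trans t w.
Proof. exact: app_app. Qed.

Let tge N i : 0 <= t_ N i. Proof. by apply: le_trans q0 _; exact: grid_ge. Qed.

Let BA t k : 0 <= t -> meas_wrt (F t) (fun w => B t w k).
Proof. by case: BM => + _ _ _; exact. Qed.

Let sF t : sigma_algebra setT (F t). Proof. by case: filF. Qed.

Let later (s t : R) (g : T -> R) : s <= t -> meas_wrt (F s) g -> meas_wrt (F t) g.
Proof. by move=> st mg C mC; case: filF => _ _ /(_ _ _ st); apply; exact: mg. Qed.

Notation fsig t := (g_sigma_algebraType (F t)).

Let inF t (A : set T) : measurable (A : set (fsig t)) <-> F t A.
Proof. by rewrite [measurable _](_ : _ = <<s F t >> A)// sigma_algebra_id. Qed.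

Let Fmeas t (A : set T) : F t A -> measurable A. Proof. by case: filF => _ + _; exact. Qed.

Let mtrans t k : 0 <= t -> measurable_fun setT (fun w : fsig t => trans t w k).
Proof.
move=> t0; apply: measurable_app => l; apply: measurable_funB; last exact: measurable_cst.
by apply/meas_wrtP => //; exact: XA.
Qed.

Let mainc N i t k : t_ N i.+1 <= t -> measurable_fun setT (fun w : fsig t => ainc N i w k).
Proof.
move=> it; have it' := le_trans (ltW (grid_lt q N i)) it.
have mX s : 0 <= s -> s <= t -> measurable_fun setT (fun w : fsig t => X s w k).
  by move=> s0 st; apply/meas_wrtP => //; apply: later st _; exact: XA.
have mB s : 0 <= s -> s <= t -> measurable_fun setT (fun w : fsig t => B s w k).
  by move=> s0 st; apply/meas_wrtP => //; apply: later st _; exact: BA.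
by apply: measurable_funB; apply: measurable_funB; [exact: mX|exact: mX|exact: mB|exact: mB].
Qed.

Lemma stay_adapted N i : F (t_ N i) (stay N i).
Proof.
have mt j : (j <= i)%N -> measurable_fun setT (fun w : fsig (t_ N i) =>
    \sum_(l < j) norm1 (ainc N l w)).
  move=> ji; rewrite (_ : (fun _ => _) = fun w : fsig (t_ N i) =>
      \sum_(l <- enum 'I_j) norm1 (ainc N l w)); last first.
    by apply/funext => w; rewrite big_enum.
  apply: measurable_sum => l; apply: measurable_norm1 => k; apply: mainc.
  by apply: grid_le; exact: leq_trans (ltn_ord l) ji.
have mB j : (j <= i)%N -> F (t_ N i) (Gd (t_ N j) `&`
    [set w | \sum_(l < j) norm1 (ainc N l w) <= Mv]).
  move=> ji; apply/inF; apply: measurableI.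
    apply/inF; case: filF => _ _ /(_ _ _ (grid_le q N ji)); apply; exact: GdF.
  rewrite [X in measurable X](_ : _ = setT `&`
      (fun w => \sum_(l < j) norm1 (ainc N l w)) @^-1` `]-oo, Mv]%classic).
    exact: mt.
  by rewrite setTI; apply/seteqP; split => w /=; rewrite in_itv.
have : forall j, (j <= i)%N -> F (t_ N i) (stay N j); last by apply.
elim=> [_|j IH ji]; last first.
  by apply/inF; apply: measurableI; apply/inF; [exact: IH (ltnW ji)|exact: mB].
apply/inF; apply: measurableI; apply/inF; last exact: mB.
have /= qt : q <= t_ N i by exact: grid_ge.
case: filF => _ _ /(_ _ _ qt); apply.
have mq : measurable_fun setT (fun w : fsig q => dotv (trans q w) (trans q w)).
  by apply: measurable_dotv => k; exact: mtrans.
apply/inF; rewrite [X in measurable X](_ : _ = setT `&`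
    (fun w => dotv (trans q w) (trans q w)) @^-1` `[r0 ^+ 2, +oo[%classic).
  exact: mq.
by rewrite setTI; apply/seteqP; split => w /=; rewrite in_itv/= andbT.
Qed.

Lemma stay_dec N i w : w \in stay N i.+1 -> w \in stay N i.
Proof. by rewrite !inE => -[]. Qed.

Lemma stayP N i w : r0 ^+ 2 <= dotv (trans q w) (trans q w) ->
  (forall j, (j <= i)%N -> Gd (t_ N j) w /\ \sum_(l < j) norm1 (ainc N l w) <= Mv) ->
  w \in stay N i.
Proof.
move=> h0 h; rewrite inE; elim: i h => [|i IH] h; first by split => //; exact: h.
by split; [apply: IH => j ji; apply: h; exact: leqW|exact: h].
Qed.

Lemma stay_in N i w : w \in stay N i -> Gd (t_ N i) w /\ \sum_(l < i) norm1 (ainc N l w) <= Mv.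
Proof. by rewrite inE; case: i => [|i] -[]. Qed.


Let mX t k : 0 <= t -> measurable_fun setT (fun w => X t w k).
Proof. by move=> t0; exact: (meas_wrt_measurable filF (XA k t0)). Qed.

Let mB t k : 0 <= t -> measurable_fun setT (fun w => B t w k).
Proof. by move=> t0; exact: (meas_wrt_measurable filF (BA k t0)). Qed.

Let mtrans' t k : 0 <= t -> measurable_fun setT (fun w => trans t w k).
Proof.
move=> t0; apply: measurable_app => l; apply: measurable_funB; last exact: measurable_cst.
exact: mX.
Qed.

Let mf t : 0 <= t -> measurable_fun setT (f t).
Proof. by move=> t0; apply: measurable_lyap => // k; exact: mtrans'. Qed.

Let mbinc N i k : measurable_fun setT (fun w => binc N i w k).
Proof. by apply: measurable_funB; exact: mB. Qed.

Let mfmid N i : measurable_fun setT (fmid N i).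
Proof.
apply: measurable_lyap => // k; apply: measurable_funD; first exact: mtrans'.
by apply: measurable_app => l; exact: mbinc.
Qed.

Let mgain t : 0 <= t -> measurable_fun setT (fun w => lyap_gain Q K e (trans t w)).
Proof.
move=> t0; have mt k : measurable_fun setT (fun w => trans t w k) by exact: mtrans'.
apply: measurable_funB.
  by apply: measurable_funM; [exact: measurable_lyap_alpha|exact: measurable_cst].
apply: measurable_funM; last exact: measurable_dotv.
by apply: measurable_funM; [exact: measurable_cst|exact: measurable_lyap_beta].
Qed.

Let rg := lyapG K c0 - lyapG K e.
Let rg0 : 0 <= rg. Proof. by rewrite subr_ge0 lyapG_le. Qed.

Let gmax := (e^-1 + K) / (2 * e) * `|\sum_k Q k k|.

Let gain_le t w : Gd t w -> `|lyap_gain Q K e (trans t w)| <= gmax.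
Proof.
move=> G; rewrite ger0_norm ?Gd_gain// /lyap_gain /gmax.
have er : e <= rho e (trans t w) by exact: rho_ge.
have /andP[a0 a1] := lyap_alpha_bound K0 c00 e0 ec0 er.
have /andP[b0 _] := lyap_beta_bound K0 c00 e0 ec0 er.
have h1 : 0 <= 4 * lyap_beta K (rho e (trans t w)) * dotv (trans t w) (trans t w).
  by rewrite mulr_ge0 ?dotvv_ge0// mulr_ge0.
have h2 : lyap_alpha K (rho e (trans t w)) * (\sum_k Q k k) <=
    (e^-1 + K) / (2 * e) * `|\sum_k Q k k|.
  apply: le_trans (_ : lyap_alpha K (rho e (trans t w)) * `|\sum_k Q k k| <= _).
    by rewrite ler_wpM2l// ler_norm.
  by rewrite ler_wpM2r.
by apply: le_trans h2; rewrite gerBl.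
Qed.

Let mstay N i : measurable (stay N i).
Proof. by apply: Fmeas; exact: stay_adapted. Qed.

Let istay N i (g : T -> R) c : measurable_fun setT g -> 0 <= c ->
  (forall w, w \in stay N i -> `|g w| <= c) ->
  measurable_fun setT (fun w => (w \in stay N i)%:R * g w) /\
  P.-integrable setT (EFin \o (fun w => (w \in stay N i)%:R * g w)).
Proof.
move=> mg cge0 gc.
have mI : measurable_fun setT (\1_(stay N i) : T -> R) by exact: measurable_indic.
have m1 : measurable_fun setT (fun w => (w \in stay N i)%:R * g w).
  rewrite (_ : (fun w => _) = (fun w => \1_(stay N i) w * g w)); last first.
    by apply/funext => w; rewrite indicE.
  exact: measurable_funM.
split => //.
apply: (bounded_integrable P (K := c)) => // w.
by have [wS|_] := boolP (w \in stay N i); rewrite ?mul1r ?gc// mul0r normr0.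
Qed.

Lemma gvar_ge N : N.+1%:R^-1 / 8 <= gvar N.
Proof.
have s0 : 0 < Num.sqrt (N.+1%:R^-1 : R) by rewrite sqrtr_gt0 invr_gt0.
by have := gauss_var_ge s0; rewrite sqr_sqrtr.
Qed.

Lemma gvar0 N : 0 <= gvar N.
Proof. by apply: le_trans (gvar_ge N); rewrite divr_ge0. Qed.

(** The bound independent of [N] serves as the dominating constant for dominated convergence. The
    level [Mv] controls the steps before the last, the range [rg] of [lyap] the last one. *)
Lemma excess_sum_ge : exists2 C, 0 <= C & forall N w, - C <= excess_sum N w.
Proof.
pose qq := \sum_k \sum_l `|Q k l|.
have qq0 : 0 <= qq by apply: sumr_ge0 => k _; exact: sumr_ge0.
pose Cl := e^-1 + K.
have Cl0 : 0 <= Cl by rewrite addr_ge0// invr_ge0 ltW.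
exists (Cl * qq * Mv + rg) => [|N w]; first by rewrite addr_ge0// mulr_ge0// mulr_ge0.
apply: (stopped_sum_ge (g := fun i => w \in stay N i) (v := fun i => norm1 (ainc N i w)) (x := fun i => excess N i w)) => //.
- by move=> i; exact: stay_dec.
- exact: mulr_ge0.
- by move=> i; exact: norm1_ge0.
- by move=> i /stay_in[].
- move=> i /stay_in[Gi _]; have g0 := mulr_ge0 (Gd_gain Gi) (gvar0 N).
  have := lyap_lip K0 e0 ec0 (trans (t_ N i) w + app Q (binc N i w)) (app Q (ainc N i w)).
  rewrite -trans_step -/(fmid N i w) -/(f _ w) ler_norml => /andP[h _].
  have h2 : Cl * norm1 (app Q (ainc N i w)) <= Cl * qq * norm1 (ainc N i w).
    by rewrite -mulrA ler_wpM2l// norm1_app.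
  by rewrite /excess; move: g0 h h2; rewrite -/Cl; lra.
- move=> i /stay_in[Gi _]; have g0 := mulr_ge0 (Gd_gain Gi) (gvar0 N).
  have := lyap_range K0 c00 e0 ec0 (trans (t_ N i) w + app Q (binc N i w)) (trans (t_ N i.+1) w).
  rewrite -/(fmid N i w) -/(f _ w) -/rg ler_norml => /andP[h _].
  by rewrite /excess; move: g0 h; lra.
Qed.

Lemma stopval_le N w : stopval N w <= Num.max 0 (lyapG K c0).
Proof.
apply: stopped_le => [i||i]; first exact: stay_dec.
  by rewrite le_max lexx.
by rewrite le_max (lyap_le K0 c00 e0) orbT.
Qed.

(** The discrete submartingale inequality. A walk that starts contributes at least
    [lyapG K (Num.min r0 c0)], one that does not contributes 0, whence the maximum with 0. *)
Lemma stopval_integral : exists2 C, 0 <= C & forall N,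
  [/\ measurable_fun setT (stopval N), measurable_fun setT (excess_sum N),
    P.-integrable setT (EFin \o stopval N), P.-integrable setT (EFin \o excess_sum N) &
  \int[P]_w excess_sum N w - Num.max 0 (- lyapG K (Num.min r0 c0)) - C * Num.sqrt N.+1%:R^-1
    <= \int[P]_w stopval N w].
Proof.
have [C C0 HC] := lyap_one_step filF BM Qsym Qidem K0 c00 e0 ec0.
exists C => // N.
set sg := Num.sqrt _; set A0 := Num.max _ _.
pose one i w : R := (w \in stay N i)%:R.
have rgle (y z : 'I_d -> R) : `|lyap K c0 e z - lyap K c0 e y| <= rg by exact: (lyap_range K0 c00 e0 ec0).
pose fd i w := f (t_ N i.+1) w - f (t_ N i) w.
pose fb i w := fmid N i w - f (t_ N i) w.
pose fa i w := f (t_ N i.+1) w - fmid N i w.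
pose fg i w := lyap_gain Q K e (trans (t_ N i) w).
have [m0 i0] : measurable_fun setT (fun w => one 0%N w * f (t_ N 0%N) w) /\
    P.-integrable setT (EFin \o (fun w => one 0%N w * f (t_ N 0%N) w)).
  apply: (istay (c := `|lyapG K c0| + `|lyapG K e|)) => // [|w _]; first exact: mf.
  have h1 := lyap_ge K0 e0 ec0 (trans (t_ N 0) w).
  have h2 := lyap_le K0 c00 e0 (trans (t_ N 0) w).
  rewrite ler_norml; apply/andP; split.
    apply: le_trans h1; have := ler_norm (- lyapG K e); rewrite normrN.
    by have := normr_ge0 (lyapG K c0); lra.
  apply: le_trans h2 _; have := ler_norm (lyapG K c0).
  by have := normr_ge0 (lyapG K e); lra.
have [md idd] : (forall i, measurable_fun setT (fun w => one i w * fd i w)) /\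
    (forall i, P.-integrable setT (EFin \o (fun w => one i w * fd i w))).
  by apply/all_and2 => i; apply: (istay (c := rg)) => // [|w _];
    [apply: measurable_funB; exact: mf|exact: rgle].
have [mb ib] : (forall i, measurable_fun setT (fun w => one i w * fb i w)) /\
    (forall i, P.-integrable setT (EFin \o (fun w => one i w * fb i w))).
  by apply/all_and2 => i; apply: (istay (c := rg)) => // [|w _];
    [apply: measurable_funB; [exact: mfmid|exact: mf]|exact: rgle].
have [ma ia] : (forall i, measurable_fun setT (fun w => one i w * fa i w)) /\
    (forall i, P.-integrable setT (EFin \o (fun w => one i w * fa i w))).
  by apply/all_and2 => i; apply: (istay (c := rg)) => // [|w _];
    [apply: measurable_funB; [exact: mf|exact: mfmid]|exact: rgle].
have [mg ig] : (forall i, measurable_fun setT (fun w => one i w * fg i w)) /\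
    (forall i, P.-integrable setT (EFin \o (fun w => one i w * fg i w))).
  apply/all_and2 => i; apply: (istay (c := gmax)) => // [||w wS].
  - exact: mgain.
  - by rewrite /gmax mulr_ge0// divr_ge0 ?addr_ge0 ?invr_ge0 ?mulr_ge0// ltW.
  - by apply: gain_le; have [] := stay_in wS.
have Ex i w : one i w * excess N i w = gvar N * (one i w * fg i w) + one i w * fa i w.
  by rewrite /excess /fg /fa; ring.
have igg i : P.-integrable setT (EFin \o (fun w => gvar N * (one i w * fg i w))).
  by apply: integrable_EFinZl.
have ix i : P.-integrable setT (EFin \o (fun w => one i w * excess N i w)).
  apply: (@eq_integrable _ _ _ _ _ measurableT
    (fun w => (gvar N * (one i w * fg i w))%:E + (one i w * fa i w)%:E)%E).
    by move=> w _ /=; rewrite -EFinD Ex.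
  exact: (integrableD measurableT (igg i) (ia i)).
have [iS eS] := Rintegral_sum (index_enum 'I_N.+1) measurableT ix.
have [iD eD] := Rintegral_sum (index_enum 'I_N.+1) measurableT idd.
have iZ : P.-integrable setT (EFin \o stopval N).
  exact: (@eq_integrable _ _ _ _ _ measurableT _ _ _ (integrableD measurableT i0 iD)).
split => //.
- by apply/measurable_EFinP; exact: measurable_int iZ.
- by apply/measurable_EFinP; exact: measurable_int iS.
rewrite [X in _ <= X](_ : _ = \int[P]_w (one 0%N w * f (t_ N 0%N) w)
    + \sum_(i < N.+1) \int[P]_w (one i w * fd i w)); last by rewrite -eD -RintegralD.
rewrite {1}/excess_sum eS.
have h0 : - A0 <= \int[P]_w (one 0%N w * f (t_ N 0%N) w).
  have -> : - A0 = \int[P]_w (cst (- A0) w).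
    by rewrite Rintegral_prob_cst.
  apply: le_Rintegral => //; first exact: finite_measure_integrable_cst.
  move=> w _; rewrite /one /=; have [wS|_] := boolP (w \in stay N 0); last first.
    by rewrite mul0r oppr_le0 /A0 le_max lexx.
  rewrite mul1r /f grid0 lerNl /A0 le_max; apply/orP; right; rewrite lerN2.
  have u0 : r0 ^+ 2 <= dotv (trans q w) (trans q w) by move: wS; rewrite inE => -[].
  have r0r : r0 <= rho e (trans q w).
    rewrite -(@ler_pXn2r _ 2) ?nnegrE ?sqrtr_ge0 ?(ltW r00)// rho_sqr.
    by rewrite (le_trans u0)// lerDl sqr_ge0.
  apply: lyapG_le => //; first by rewrite lt_min r00 c00.
  by rewrite le_min !ge_min lexx r0r orbT.
have hi (i : 'I_N.+1) : \int[P]_w (one i w * excess N i w) - C * sg ^+ 3 <=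
    \int[P]_w (one i w * fd i w).
  have -> : \int[P]_w (one i w * excess N i w) =
      gvar N * \int[P]_w (one i w * fg i w) + \int[P]_w (one i w * fa i w).
    rewrite -RintegralZl// -RintegralD//; apply: eq_Rintegral => w _.
    exact: Ex.
  have -> : \int[P]_w (one i w * fd i w) =
      \int[P]_w (one i w * fb i w) + \int[P]_w (one i w * fa i w).
    rewrite -RintegralD//; apply: eq_Rintegral => w _.
    by rewrite /fd /fb /fa; ring.
  rewrite addrAC lerD2r.
  have := HC (t_ N i) (t_ N i.+1) (stay N i) (trans (t_ N i)) (tge N i) (grid_lt q N i)
    (stay_adapted N i).
  rewrite gridS; apply=> //.
  - by move=> k; apply/meas_wrtP => //; exact: mtrans.
  - by move=> k; exact: mbinc.
  - by move=> w; exact: app_trans.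
  - by move=> w Sw; apply: Gd_rho; apply: (stay_in _).1; exact: mem_set.
have hs : \sum_(i < N.+1) (\int[P]_w (one i w * excess N i w) - C * sg ^+ 3) <=
  \sum_(i < N.+1) \int[P]_w (one i w * fd i w) by apply: ler_sum => i _; exact: hi.
move: hs; rewrite sumrB sumr_const card_ord => hs.
(* There are [N.+1] steps of length [sg ^+ 2 = N.+1%:R^-1]. *)
have e3 : C * sg ^+ 3 *+ N.+1 = C * sg.
  rewrite -mulr_natr exprS sqr_sqrtr ?invr_ge0// -!mulrA mulVf ?mulr1//.
by rewrite e3 in hs; rewrite -addrA -opprD (addrC A0) opprD addrA [leRHS]addrC lerD.
Qed.


(** At distance at most [e] from the face, [rho e] is at most [Num.sqrt 2 * e]. *)
Let ge := lyapG K (Num.sqrt 2 * e).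
Hypothesis ge0 : ge < 0.

Hypothesis excess_cvg : {ae P, forall w, forall dl, 0 < dl ->
  exists N0, forall N, (N0 <= N)%N -> - dl <= excess_sum N w}.

(** An event free of [N]: the stopped value is low on all fine enough grids. It is an increasing
    union of events, so the bounds on single grids pass to the limit. *)
Definition hit : set T := [set w | exists N0, forall N, (N0 <= N)%N -> stopval N w <= ge].

(** Markov's inequality for [stopval N], which is bounded above and at most [ge < 0] on the event
    [H N]. The negative part of [excess_sum] tends to 0 almost surely and boundedly, so its
    expectation vanishes, as does the Taylor error. *)
Lemma hit_bound : measurable hit /\
  (P hit * (- ge)%:E <= (Num.max 0 (lyapG K c0) + Num.max 0 (- lyapG K (Num.min r0 c0)))%:E)%E.
Proof.
set C0 := Num.max 0 (lyapG K c0); set A0 := Num.max 0 _.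
have [C C0' HC] := stopval_integral.
have [S S0 HS] := excess_sum_ge.
have mZ N : measurable_fun setT (stopval N) by case: (HC N).
pose H N := [set w | stopval N w <= ge].
have mH N : measurable (H N).
  rewrite (_ : H N = setT `&` stopval N @^-1` `]-oo, ge]%classic); first exact: mZ.
  by rewrite setTI; apply/seteqP; split => w /=; rewrite in_itv.
pose I k := \bigcap_(N in [set N | (k <= N)%N]) H N.
have mI k : measurable (I k) by apply: bigcap_measurable => // ; exists k => /=.
have hitE : hit = \bigcup_k I k.
  apply/seteqP; split => w [k h]; first by exists k => // N; exact: h.
  by move=> Iw; exists k => N kN; exact: Iw.
have mhit : measurable hit by rewrite hitE; exact: bigcupT_measurable.
split => //.
pose neg N w : R := Num.max 0 (- excess_sum N w).
have neg0 N w : 0 <= neg N w by rewrite /neg le_max lexx.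
have negS N w : neg N w <= S by rewrite /neg ge_max S0 lerNl HS.
have mneg N : measurable_fun setT (neg N).
  have [_ mS _ _ _] := HC N.
  apply: measurable_maxr; first exact: measurable_cst.
  exact: (measurableT_comp (@oppr_measurable R setT) mS).
have ineg N : P.-integrable setT (EFin \o neg N).
  by apply: (bounded_integrable P (K := S)) => // w; rewrite ger0_norm.
have HN N : fine (P (H N)) * (- ge) <= C0 + A0 + C * Num.sqrt N.+1%:R^-1 + \int[P]_w neg N w.
  have [_ _ iZ iS h] := HC N.
  have iH : P.-integrable setT (EFin \o (\1_(H N) : T -> R)).
    exact: integrable_indic.
  have icst : P.-integrable setT (EFin \o cst C0) by exact: finite_measure_integrable_cst.
  have igH : P.-integrable setT (EFin \o (fun w => ge * \1_(H N) w)).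
    by apply: integrable_EFinZl.
  have E1 : \int[P]_w (\1_(H N) w : R) = fine (P (H N)).
    by rewrite /Rintegral integral_indic// setIT.
  have h1 : \int[P]_w stopval N w <= C0 + ge * fine (P (H N)).
    rewrite -E1 -(Rintegral_prob_cst P C0) -RintegralZl// -RintegralD//.
    apply: le_Rintegral => //.
      exact: (integrableD measurableT icst igH).
    move=> w _; rewrite indicE /=; have [wH|_] := boolP (w \in H N).
      rewrite mulr1; move: wH; rewrite inE /H/= => /le_trans; apply.
      by rewrite lerDr /C0 le_max lexx.
    by rewrite mulr0 addr0 stopval_le.
  have h2 : - (\int[P]_w neg N w) <= \int[P]_w excess_sum N w.
    have -> : - (\int[P]_w neg N w) = \int[P]_w (- 1 * neg N w) by rewrite RintegralZl// mulN1r.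
    apply: le_Rintegral => //; first exact: integrable_EFinZl.
    by move=> w _; rewrite mulN1r lerNl /neg le_max lexx orbT.
  have := le_trans (lerD (lerD h2 (lexx (- A0))) (lexx (- (C * Num.sqrt N.+1%:R^-1)))) (le_trans h h1).
  by move: (\int[P]_w neg N w) => z; rewrite mulrN mulrC; lra.
have negc : (\int[P]_w (neg N w)%:E)%E @[N --> \oo] --> 0%E.
  have -> : 0%E = (\int[P]_w (cst 0 w)%:E)%E :> \bar R by rewrite integral0_eq.
  have [] // := @dominated_convergence _ _ _ P setT measurableT
    (fun N w => (neg N w)%:E) (fun w => (cst 0 w)%:E) (cst S%:E).
  - by move=> N; apply/measurable_EFinP.
  - by apply/measurable_EFinP; exact: measurable_cst.
  - apply: filterS excess_cvg => w h _; apply/cvg_EFin; first exact: nearW.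
    apply/cvgrPdist_le => dl dl0; have [N0 hN0] := h _ dl0; exists N0 => // N /= N0N.
    by rewrite sub0r normrN ger0_norm// /neg ge_max (ltW dl0) lerNl hN0.
  - exact: finite_measure_integrable_cst.
  - by apply: aeW => w N _ /=; rewrite lee_fin ger0_norm.
have u0 : C * Num.sqrt (N.+1%:R^-1 : R) + \int[P]_w neg N w @[N --> \oo] --> (0 : R).
  have -> : (0 : R) = C * Num.sqrt 0 + 0 by rewrite sqrtr0 mulr0 addr0.
  apply: cvgD; last exact: (fine_cvg negc).
  apply: cvgMr; apply: continuous_cvg; first exact: sqrt_continuous.
  exact: cvg_harmonic.
have PI k : fine (P (I k)) * (- ge) <= C0 + A0.
  apply/ler_addgt0Pr => dl dl0.
  have [N0 _ hN0] := cvgr_lt _ u0 _ dl0.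
  have := HN (maxn k N0); have := hN0 (maxn k N0) (leq_maxr _ _) => /=.
  have : fine (P (I k)) <= fine (P (H (maxn k N0))).
    rewrite fine_le ?fin_num_measure// le_measure ?inE// => w; apply => /=.
    exact: leq_maxl.
  have g0 : 0 <= - ge by rewrite oppr_ge0 ltW.
  move=> /(ler_wpM2r g0).
  by move: (\int[P]_w _) => z; lra.
have : P \o I @ \oo --> P hit.
  rewrite hitE; apply: nondecreasing_cvg_mu => //; first by rewrite -hitE.
  move=> k l kl; apply/subsetPset => w Iw N /= lN; apply: Iw => /=.
  exact: leq_trans kl lN.
move=> cvI; have g0 : 0 < - ge by rewrite oppr_gt0.
rewrite -lee_pdivlMr//; rewrite -(cvg_lim _ cvI)//.
apply: lime_le; first by apply/cvg_ex; exists (P hit).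
apply: nearW => k /=; rewrite lee_pdivlMr//.
by have := PI k; rewrite -lee_fin EFinM fineK// fin_num_measure.
Qed.

End Hitting.

(** * Estimates along a single path *)

Lemma dotv_diff_le (R : realType) (d : nat) (x y v : 'I_d -> R) (N : R) : norm1 v <= N ->
  `|dotv x v - dotv y v| <= norm1 (x - y) * N.
Proof.
move=> vN; rewrite -[_ - _](dotvBl x y v) dotvC.
apply: le_trans (dotv_norm1 (M := N) _ _) _; last by rewrite mulrC.
by move=> k; apply: le_trans (normr_norm1 _ _) vN.
Qed.

Section PathContinuity.
Variables (R : realType) (d : nat) (x : R -> 'I_d -> R).
Hypothesis cx : forall k, {within `[0, +oo[%classic, continuous (fun t => x t k)}.

Lemma path_continuous (t th : R) : 0 <= t -> 0 < th ->
  \forall s \near t, 0 <= s -> norm1 (x s - x t) <= th.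
Proof.
move=> t0 th0.
have h k : \forall s \near t, 0 <= s -> `|x s k - x t k| <= th / d.+1%:R.
  have := @cx k; move=> /subspace_continuousP/(_ t).
  rewrite /= in_itv/= andbT => /(_ t0) /cvgrPdist_le H.
  have thd : 0 < th / d.+1%:R by exact: divr_gt0.
  have {}H : \forall s \near t, `[0, +oo[%classic s -> `|x t k - x s k| <= th / d.+1%:R.
    exact: (H _ thd).
  apply: filterS H => s hs s0.
  by rewrite distrC; apply: hs; rewrite /= in_itv/= s0.
have : \forall s \near t, forall k, 0 <= s -> `|x s k - x t k| <= th / d.+1%:R.
  exact: (@filter_forall R 'I_d (fun k s => 0 <= s -> `|x s k - x t k| <= th / d.+1%:R) (nbhs t)).
apply: filterS => s hs s0; rewrite /norm1.
apply: le_trans (_ : \sum_(k < d) th / d.+1%:R <= _).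
  by apply: ler_sum => k _; exact: hs.
rewrite sumr_const card_ord -[leLHS]mulr_natr -mulrA ler_piMr ?(ltW th0)//.
by rewrite mulrC ler_pdivrMr// mul1r ler_nat.
Qed.

Lemma path_uniformly_continuous (p q th : R) : 0 <= p -> 0 < th -> exists2 eta, 0 < eta &
  forall s r, p <= s <= q -> p <= r <= q -> `|s - r| <= eta -> norm1 (x s - x r) <= th.
Proof.
move=> p0 th0.
have c := @segment_compact R p q; move/compact_near_coveringP/near_covering_withinP: c.
move/(_ R (0 : R)^'+ (fun eta s => forall r, p <= r <= q ->
   `|s - r| <= eta -> norm1 (x s - x r) <= th) _).
have L t : `[p, q]%classic t -> \forall s \near t & eta \near (0 : R)^'+,
    `[p, q]%classic s -> forall r, p <= r <= q -> `|s - r| <= eta -> norm1 (x s - x r) <= th.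
  rewrite /= in_itv/= => /andP[pt tq].
  have t0 := le_trans p0 pt.
  have th2 : 0 < th / 2 by rewrite divr_gt0.
  have /nbhs_ballP[e /= e0 he] := path_continuous t0 th2.
  exists (ball t (e / 2), [set eta | eta < e / 2]) => /=.
    split; first by apply: nbhsx_ballx; rewrite divr_gt0.
    by apply: nbhs_right_lt; rewrite divr_gt0.
  move=> [s eta] /= [st etae]; rewrite in_itv/= => /andP[ps _] r /andP[pr rq] sr.
  have s0 := le_trans p0 ps.
  have hs : norm1 (x s - x t) <= th / 2.
    by apply: he => //; apply: le_ball st; move: e0; lra.
  have hr : norm1 (x r - x t) <= th / 2.
    apply: he; last exact: le_trans pr.
    rewrite /ball/= in st *; apply: le_lt_trans (ler_distD s _ _) _.
    by move: st; lra.
  have -> : x s - x r = (x s - x t) + (fun k => (- 1) * (x r - x t) k).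
    by apply/funext => k; rewrite !fctE; ring.
  apply: le_trans (norm1D _ _) _; rewrite norm1Z normrN1 mul1r; move: hs hr; lra.
move=> /(_ L) H.
near ((0 : R)^'+) => eta.
exists eta; first by near: eta; exact: nbhs_right_gt.
suff he : `[p, q]%classic `<=` (fun s => forall r, p <= r <= q ->
    `|s - r| <= eta -> norm1 (x s - x r) <= th).
  by move=> s r spq rpq; apply: he => //; rewrite /= in_itv.
by near: eta; exact: H.
Unshelve. all: by end_near.
Qed.

End PathContinuity.

(** The term [2 * al * c * r * h] is the only one without the small factor [th]; the gain absorbs
    it, because [gv >= h / 8]. *)
Lemma excess_arith (R : realType) (al amax c q th h dW r g gv yA D C nA nB nA' nB' : R) :
  0 <= al -> al <= amax -> 0 <= c -> 0 <= q -> 0 <= th -> 0 <= h -> 0 <= C ->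
  0 <= g -> 2 * al * c * r <= 8^-1 * g -> h / 8 <= gv ->
  - (c * (r + q * th) * h) - q * th * dW <= yA ->
  2 * al * yA - C * nA' * (nA' + nB') <= D ->
  0 <= nA -> nA <= dW -> nA <= 2 * th -> nB <= th -> 0 <= nA' -> 0 <= nB' ->
  nA' <= q * nA -> nB' <= q * nB ->
  - ((2 * amax * c * q + (2 * amax * q + 3 * C * q ^+ 2)) * th * (h + dW)) <= g * gv + D.
Proof.
move=> al0 al1 c0 q0 th0 h0 C0 g0 hg hgv hy hD nA0 nAW nA2 nBt nA'0 nB'0 hA hB.
have dW0 : 0 <= dW by exact: le_trans nAW.
have e1 : 2 * al * c * r * h <= g * gv.
  apply: le_trans (_ : g * (h / 8) <= _); last by rewrite ler_wpM2l.
  by have := ler_wpM2r h0 hg; lra.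
have al2 : 0 <= 2 * al by rewrite mulr_ge0.
have e2 := ler_wpM2l al2 hy.
have e3 : al * (c * q * th * h) <= amax * (c * q * th * h) by rewrite ler_wpM2r//; nneg.
have e4 : al * (q * th * dW) <= amax * (q * th * dW) by rewrite ler_wpM2r//; nneg.
have e5 : C * nA' * (nA' + nB') <= C * (q * dW) * (q * (3 * th)).
  apply: ler_pM; [nneg|exact: addr_ge0| |].
    by rewrite ler_wpM2l// (le_trans hA)// ler_wpM2l.
  apply: le_trans (lerD hA hB) _; rewrite -mulrDr ler_wpM2l//; lra.
have e6 : 0 <= amax * c * q * th * dW by have am := le_trans al0 al1; nneg.
have e7 : 0 <= amax * q * th * h by have am := le_trans al0 al1; nneg.
have e8 : 0 <= C * q ^+ 2 * th * h by nneg.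
move: e1 e2 e3 e4 e5 hD; lra.
Qed.

Section Pathwise.
Context (R : realType) (dT : measure_display) (T : measurableType dT).
Context (d m : nat) (B X : R -> T -> 'I_d -> R).
Variables (n : 'I_m -> 'I_d -> R) (a : 'I_m -> R) (phi : 'I_m -> R -> \bar R).
Variable J : {set 'I_m}.
Variables (Q : 'I_d -> 'I_d -> R) (x0 : 'I_d -> R).
Hypothesis Qsym : forall k l, Q k l = Q l k.
Hypothesis Qidem : forall k l, \sum_j Q k j * Q j l = Q k l.
Hypothesis QJ : forall j, j \in J -> app Q (n j) = n j.
Hypothesis Qtr : 2 <= \sum_k Q k k.
Hypothesis x0J : inH n a J x0.
Variables (K c0 e r0 Mv q eta M C1 Nn : R).
Hypotheses (K0 : 0 <= K) (c00 : 0 < c0) (e0 : 0 < e) (ec0 : e <= c0) (q0 : 0 <= q)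
  (eta0 : 0 < eta) (C10 : 0 <= C1) (Nn0 : 0 <= Nn).
Hypothesis nN : forall i, norm1 (n i) <= Nn.
Hypothesis Kc0 : K * c0 <= 1.
Hypothesis CK : 4 * (C1 * Nn) <= 8^-1 * K.
Hypothesis HC1 : forall (x y : 'I_d -> R) r, inDbar n a x ->
  (forall i, i \notin J -> eta / 2 <= dotv x (n i) - a i) ->
  (forall i, dotv x (n i) - a i <= M + 1) ->
  (forall j, j \in J -> dotv y (n j) = dotv x (n j) - a j) ->
  (forall i, `|dotv y (n i)| <= r) ->
  dotv y (gradPhi n a phi x) <= C1 * r.

Notation trans := (trans X Q x0).
Notation t_ := (grid q).

(** The last condition stops the walk once it is within distance [e] of the face; the bound [c0 / 2]
    on [rho] leaves room below the cut-off for a step. *)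
Definition region t : set T := [set w |
  [/\ forall i, i \notin J -> eta <= dotv (X t w) (n i) - a i,
      forall i, dotv (X t w) (n i) - a i <= M,
      rho e (trans t w) <= c0 / 2 & e ^+ 2 < dotv (trans t w) (trans t w)]].

Let rho_drift y : rho e y <= c0 / 2 ->
  2 * lyap_alpha K (rho e y) * (C1 * Nn) * rho e y <= 8^-1 * lyap_gain Q K e y /\
  0 <= lyap_gain Q K e y.
Proof.
move=> ry; apply: (lyap_drift (c := 8^-1)) => //.
- by apply: lt_le_trans e0 _; exact: rho_ge.
- by rewrite dotvv_ge0 rho_sqr lerDl sqr_ge0.
- exact: mulr_ge0.
- apply: le_trans Kc0; rewrite ler_wpM2l//; apply: le_trans ry _.
  by rewrite ler_pdivrMr// ler_peMr ?(ltW c00)// ler1n.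
Qed.

Lemma region_gain t w : region t w -> 0 <= lyap_gain Q K e (trans t w).
Proof. by move=> [_ _ /rho_drift[]]. Qed.

Lemma dotv_trans t w j : j \in J -> dotv (trans t w) (n j) = dotv (X t w) (n j) - a j.
Proof.
move=> jJ; rewrite /trans (dotv_app Qsym) QJ// -(x0J jJ).
exact: dotvBl.
Qed.

Lemma trans_eq0 t w : (forall v, (forall j, j \in J -> dotv v (n j) = 0) -> app Q v = 0) ->
  inH n a J (X t w) -> trans t w = 0.
Proof.
move=> Qker Ht; apply: Qker => j jJ.
transitivity (dotv (X t w) (n j) - dotv x0 (n j)); first exact: dotvBl.
by rewrite Ht// x0J// subrr.
Qed.

Let qq := \sum_k \sum_l `|Q k l|.
Let qq0 : 0 <= qq. Proof. by apply: sumr_ge0 => k _; exact: sumr_ge0. Qed.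

Section OnePath.
Variable w : T.
Notation x := (X^~ w).
Notation b := (B^~ w).
Hypothesis Dx : forall t, 0 <= t -> inDbar n a (x t).
Variable W : R -> R.
Hypothesis Wvar : forall s t, 0 <= s -> s <= t -> norm1 (driftinc x b s t) <= W t - W s.
Hypothesis Wdrift : forall s t (c : 'I_d -> R) C0 o, 0 <= s -> s <= t -> 0 <= o ->
  (forall r, s < r <= t ->
    dotv c (gradPhi n a phi (x r)) <= C0 + o * norm1 (gradPhi n a phi (x r))) ->
  (forall r v, s < r <= t -> inward_normal n a (x r) v -> - o <= dotv c v) ->
  - (C0 * (t - s)) - o * (W t - W s) <= dotv c (driftinc x b s t).

(** The path moves by at most [th] during the step, so the margins [eta] and [M] degrade to
    [eta / 2] and [M + 1], those assumed in [HC1]. Replacing the moving transversal component by its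
    initial value costs [qq * th]. *)
Lemma trans_drift s t th : 0 <= s -> s <= t -> 0 <= th -> th * Nn <= eta / 2 -> th * Nn <= 1 ->
  (forall r, s < r <= t -> norm1 (x r - x s) <= th) -> region s w ->
  - (C1 * (Nn * (rho e (trans s w) + qq * th)) * (t - s)) - qq * th * (W t - W s)
    <= dotv (trans s w) (driftinc x b s t).
Proof.
move=> s0 st th0 th1 th2 xth [wall bdd _ _].
have near_wall i r : s < r <= t -> `|dotv (x r) (n i) - dotv (x s) (n i)| <= th * Nn.
  move=> sr; apply: le_trans (dotv_diff_le _ _ (nN i)) _.
  by rewrite ler_wpM2r//; exact: xth.
have ndiff r : s < r <= t -> norm1 (trans r w - trans s w) <= qq * th.
  move=> sr; rewrite /trans -appB.
  have -> : X r w - x0 - (X s w - x0) = x r - x s by apply/funext => k; rewrite !fctE; ring.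
  by apply: le_trans (norm1_app _ _) _; rewrite ler_wpM2l//; exact: xth.
have dot_near r v M' : s < r <= t -> 0 <= M' -> (forall k, `|v k| <= M') ->
    `|dotv (trans r w) v - dotv (trans s w) v| <= qq * th * M'.
  move=> sr M'0 vM; rewrite -[_ - _](dotvBl (trans r w) (trans s w) v) dotvC.
  apply: le_trans (dotv_norm1 _ vM) _.
  by rewrite mulrC ler_wpM2r//; exact: ndiff.
have s0r r : s < r <= t -> 0 <= r by move=> /andP[/ltW sr _]; exact: le_trans sr.
have wall2 r i : s < r <= t -> i \notin J -> eta / 2 <= dotv (x r) (n i) - a i.
  move=> sr iJ; have := wall i iJ; have := near_wall i r sr; rewrite ler_norml => /andP[+ _].
  by move: th1; lra.
apply: Wdrift => //; first by rewrite mulr_ge0.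
- move=> r sr; set g := gradPhi n a phi (x r).
  have h1 : dotv (trans r w) g <= C1 * (Nn * (rho e (trans s w) + qq * th)).
    apply: HC1 => //.
    + exact: Dx (s0r _ sr).
    + by move=> i; exact: wall2.
    + move=> i; have := bdd i; have := near_wall i r sr; rewrite ler_norml => /andP[_ +].
      by move: th2; lra.
    + by move=> j; exact: dotv_trans.
    + move=> i; apply: le_trans (dotv_rho e _ _) _; rewrite mulrC; apply: ler_pM => //.
      * exact: norm1_ge0.
      * exact: sqrtr_ge0.
      have := rho_lip (trans s w) (trans r w - trans s w) e0.
      rewrite [trans s w + _]addrC subrK ler_norml => /andP[_ +].
      by have := ndiff r sr; lra.
  have := dot_near r g (norm1 g) sr (norm1_ge0 _) (normr_norm1 _).
  by rewrite ler_norml => /andP[+ _]; move: h1; lra.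
- move=> r v sr nv.
  have v1 k : `|v k| <= 1.
    by apply: coord_le_sqrt => //; rewrite expr1n; case: nv => ->.
  have := dot_near r v 1 sr ler01 v1; rewrite mulr1 ler_norml => /andP[_ +].
  have : 0 <= dotv v (trans r w).
    apply: (inward_normal_push (eta := eta / 2) _ (Dx (s0r _ sr)) _ _ nv).
    + by rewrite divr_gt0.
    + by move=> i; exact: wall2.
    + by move=> j; exact: dotv_trans.
  by rewrite dotvC; lra.
Qed.


Hypothesis cx : forall k, {within `[0, +oo[%classic, continuous (fun t => X t w k)}.
Hypothesis cb : forall k, {within `[0, +oo[%classic, continuous (fun t => B t w k)}.

Notation S N := (excess_sum B X Q x0 K c0 e r0 Mv q region N w).

(** The error is an oscillation [th] times the increments of time and of [W]. Summed over the grid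
    it is at most [C * th] times a fixed total, hence small by uniform continuity. *)
Lemma excess_step_ge : exists2 C, 0 <= C & forall N i th, 0 <= th ->
  th * Nn <= eta / 2 -> th * Nn <= 1 ->
  (forall r, t_ N i < r <= t_ N i.+1 -> norm1 (x r - x (t_ N i)) <= th) ->
  norm1 (binc B q N i w) <= th ->
  region (t_ N i) w ->
  - (C * th * (N.+1%:R^-1 + (W (t_ N i.+1) - W (t_ N i)))) <= excess B X Q x0 K c0 e q N i w.
Proof.
have [C C0 HC] := lyap_drift_step d K0 c00 e0 ec0.
pose amax := (e^-1 + K) / (2 * e).
have amax0 : 0 <= amax by rewrite divr_ge0 ?addr_ge0 ?invr_ge0 ?mulr_ge0// ltW.
pose Ca := 2 * amax * (C1 * Nn) * qq; pose Cb := 2 * amax * qq + 3 * C * qq ^+ 2.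
have Ca0 : 0 <= Ca by rewrite /Ca; nneg.
have Cb0 : 0 <= Cb by rewrite /Cb; nneg.
exists (Ca + Cb); first exact: addr_ge0.
move=> N i th th0 th1 th2 xth bth G; have [_ _ ry _] := G.
set s := t_ N i in xth G ry *; set t := t_ N i.+1 in xth *.
have s0 : 0 <= s by apply: le_trans q0 _; exact: grid_ge.
have st : s <= t by exact: ltW (grid_lt _ _ _).
have := trans_drift s0 st th0 th1 th2 xth G.
rewrite gridS -/(ainc B X q N i w).
set h := N.+1%:R^-1; set dW := W t - W s; set A := ainc B X q N i w.
have dW0 : norm1 A <= dW by exact: Wvar.
have h0 : 0 <= h by rewrite invr_ge0.
have [g1 g2] := rho_drift ry.
have A2 : norm1 A <= 2 * th.
  rewrite (_ : A = (x t - x s) + (fun k => (- 1) * binc B q N i w k)); last first.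
    by apply/funext => k; rewrite /A /ainc /driftinc /binc -/s -/t !fctE; ring.
  apply: le_trans (norm1D _ _) _; rewrite norm1Z normrN1 mul1r.
  have : norm1 (x t - x s) <= th by apply: xth; rewrite lexx (grid_lt q N i).
  by move: bth; lra.
set y := trans s w in ry g1 g2 *; set ry' := rho e y in ry g1 *.
have /andP[al0 al1] := lyap_alpha_bound K0 c00 e0 ec0 (rho_ge y e0).
have := HC y (app Q (binc B q N i w)) (app Q A) ry.
rewrite -trans_step -/(fmid B X Q x0 K c0 e q N i w).
rewrite -(dotv_app Qsym) (app_trans X x0 Qidem).
have nA := norm1_app Q A; have nb := norm1_app Q (binc B q N i w).
rewrite (mulrA C1) => hD hy.
apply: (excess_arith al0 al1 (mulr_ge0 C10 Nn0) qq0 th0 h0 C0 g2 g1 (gvar_ge R N) hy hD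
  (norm1_ge0 _) dW0 A2 bth (norm1_ge0 _) (norm1_ge0 _) nA nb).
Qed.


Lemma excess_sum_ge_near dl : 0 < dl ->
  exists N0, forall N, (N0 <= N)%N -> - dl <= S N.
Proof.
move=> dl0; have [C C0 HC] := excess_step_ge.
have W0 s t : 0 <= s -> s <= t -> 0 <= W t - W s.
  by move=> s0 st; apply: le_trans (norm1_ge0 _) (Wvar s0 st).
have q1 : q <= q + 1 by rewrite lerDl.
pose V := 1 + (W (q + 1) - W q).
have V0 : 0 < V by rewrite ltr_wpDr// W0.
have CV : 0 < C * V + 1 by rewrite ltr_wpDl// mulr_ge0// ltW.
have N1 : 0 < Nn + 1 by rewrite ltr_wpDl.
(* The first entry gives total error at most [dl], the second keeps the margins during a step; the
   added units avoid division by 0. *)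
pose th := Num.min (dl / (C * V + 1)) (Num.min (eta / 2) 1 / (Nn + 1)).
have th0 : 0 < th by rewrite lt_min !divr_gt0// lt_min ltr01 divr_gt0.
have thN : th * Nn <= Num.min (eta / 2) 1.
  apply: le_trans (_ : th * (Nn + 1) <= _); first by rewrite ler_wpM2l ?(ltW th0)// lerDl.
  by rewrite -ler_pdivlMr// /th ge_min lexx orbT.
move: thN; rewrite le_min => /andP[th1 th2].
have thdl : C * th * V <= dl.
  apply: le_trans (_ : th * (C * V + 1) <= _).
    by rewrite mulrC mulrA (mulrC V) mulrC ler_wpM2l ?(ltW th0)// lerDl.
  by rewrite -ler_pdivlMr// /th ge_min lexx.
have [e1 e10 h1] := path_uniformly_continuous cx (q + 1) q0 th0.
have [e2 e20 h2] := path_uniformly_continuous cb (q + 1) q0 th0.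
have e12 : 0 < Num.min e1 e2 by rewrite lt_min e10.
have [N0 _ hN0] := near_infty_natSinv_lt (PosNum e12).
exists N0 => N /hN0 /=; rewrite lt_min => /andP[/ltW hN1 /ltW hN2].
have in01 i s : (i < N.+1)%N -> t_ N i <= s <= t_ N i.+1 -> q <= s <= q + 1.
  move=> iN /andP[h3 h4]; rewrite (le_trans (grid_ge q N i) h3)/=.
  apply: le_trans h4 _; rewrite /grid lerD2l ler_pdivrMr// mul1r ler_nat.
  exact: iN.
have mesh i s : t_ N i <= s <= t_ N i.+1 -> `|s - t_ N i| <= N.+1%:R^-1.
  move=> /andP[h3 h4]; rewrite ger0_norm ?subr_ge0// -(gridS q N i) lerB//.
have tel : \sum_(i < N.+1) (W (t_ N i.+1) - W (t_ N i)) = W (q + 1) - W q.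
  rewrite -(big_mkord xpredT (fun i => W (t_ N i.+1) - W (t_ N i))) telescope_sumr//.
  by rewrite grid0 /grid divff.
have -> : - dl = \sum_(i < N.+1) - (dl / V * (N.+1%:R^-1 + (W (t_ N i.+1) - W (t_ N i)))).
  rewrite sumrN -mulr_sumr big_split/= tel sumr_const card_ord -[X in X + _]mulr_natr.
  by rewrite mulVf// -/V divfK// gt_eqF.
apply: ler_sum => i _.
have dW0 : 0 <= N.+1%:R^-1 + (W (t_ N i.+1) - W (t_ N i)).
  apply: addr_ge0; first by rewrite invr_ge0.
  by apply: W0; [exact: le_trans (grid_ge _ _ _)|exact: ltW (grid_lt _ _ _)].
have [wS|_] := boolP (w \in _); last first.
  by rewrite mul0r oppr_le0 mulr_ge0// divr_ge0// ltW.
have [G _] := stay_in wS; rewrite mul1r.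
have ti : t_ N i <= t_ N i <= t_ N i.+1 by rewrite lexx (ltW (grid_lt _ _ _)).
have ti1 : t_ N i <= t_ N i.+1 <= t_ N i.+1 by rewrite lexx (ltW (grid_lt _ _ _)).
apply: le_trans (HC N i th (ltW th0) th1 th2 _ _ G).
- by rewrite lerN2 ler_wpM2r// ler_pdivlMr.
- move=> r /andP[/ltW r1 r2]; have rr : t_ N i <= r <= t_ N i.+1 by rewrite r1.
  apply: h1; [exact: in01 rr|exact: in01 ti|exact: le_trans (mesh _ _ rr) hN1].
- apply: h2; [exact: in01 ti1|exact: in01 ti|exact: le_trans (mesh _ _ ti1) hN2].
Qed.


(** On a fine grid, continuity puts the last grid point before [t] within [e] of the face. The walk
    therefore stops at some point no later than that, and necessarily because of its distance, since
    all other conditions of [stay] persist up to [t]. *)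
Lemma path_hit t : q < t < q + 1 -> inH n a J (x t) ->
  (forall v, (forall j, j \in J -> dotv v (n j) = 0) -> app Q v = 0) ->
  (forall s, q <= s <= t -> [/\ forall i, i \notin J -> eta <= dotv (x s) (n i) - a i,
     forall i, dotv (x s) (n i) - a i <= M &
     dotv (trans s w) (trans s w) <= (c0 / 4) ^+ 2]) ->
  r0 ^+ 2 <= dotv (trans q w) (trans q w) -> e <= c0 / 4 -> e < r0 ->
  (forall N, \sum_(j < N.+1) norm1 (ainc B X q N j w) <= Mv) ->
  hit B X Q x0 K c0 e r0 Mv q region w.
Proof.
move=> /andP[qt tq1] Ht Qker near_t far e4 er VM.
have t0 : 0 <= t by exact: le_trans q0 (ltW qt).
have tr0 : trans t w = 0 by exact: trans_eq0.
have qq1 : 0 < qq + 1 by exact: (ltr_wpDl qq0 ltr01).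
have eq0 : 0 < e / (qq + 1) by exact: divr_gt0.
have /nbhs_ballP[ep /= ep0 hep] := path_continuous cx t0 eq0.
have [N0 _ hN0] := near_infty_natSinv_lt (PosNum ep0).
exists N0 => N /hN0 /= hN.
pose u i := dotv (trans (t_ N i) w) (trans (t_ N i) w).
have tq0 : 0 <= (t - q) * N.+1%:R by rewrite mulr_ge0// subr_ge0 ltW.
(* Index of the last grid point not after [t]. *)
have /andP[lo hi] := truncn_itv tq0.
set i0 := Num.truncn _ in lo hi.
have i0N : (i0 <= N)%N.
  rewrite -ltnS -(ltr_nat R); apply: le_lt_trans lo _.
  apply: (@lt_le_trans _ _ (1 * N.+1%:R)); last by rewrite mul1r.
  by rewrite ltr_pM2r ?ltr0n//; move: tq1; lra.
have ti0 : t_ N i0 <= t by rewrite /grid -lerBrDl ler_pdivrMr.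
have ti1 : t < t_ N i0.+1 by rewrite /grid -ltrBlDl ltr_pdivlMr.
have ge_t i : 0 <= t_ N i by apply: le_trans q0 _; exact: grid_ge.
have ui0 : u i0 <= e ^+ 2.
  have h : norm1 (x (t_ N i0) - x t) <= e / (qq + 1).
    apply: hep => //; rewrite /ball/= ger0_norm ?subr_ge0//.
    by apply: lt_trans hN; rewrite -(gridS q N i0) ltrD2r.
  apply: le_trans (dotvv_norm1 _) _; rewrite lerXn2r ?nnegrE ?norm1_ge0 ?(ltW e0)//.
  have -> : trans (t_ N i0) w = app Q (x (t_ N i0) - x t).
    rewrite -[LHS]subr0 -tr0 /trans -appB; congr app.
    by apply/funext => k; rewrite !fctE; ring.
  apply: le_trans (norm1_app _ _) _.
  apply: le_trans (ler_wpM2l qq0 h) _.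
  by rewrite mulrCA ler_piMr ?(ltW e0)// ler_pdivrMr// mul1r lerDl.
have ex : exists i, u i <= e ^+ 2 by exists i0.
(* [j] is the first grid index within distance [e]; it is positive because the start is at distance
   at least [r0 > e]. *)
case: (ex_minnP ex) => j uj jmin.
have ji0 : (j <= i0)%N by exact: jmin.
have ults i : (i < j)%N -> e ^+ 2 < u i.
  by move=> ij; rewrite ltNge; apply/negP => /jmin; rewrite leqNgt ij.
have j0 : (0 < j)%N.
  rewrite lt0n; apply/eqP => jz; move: uj; rewrite jz /u grid0 leNgt.
  by rewrite (lt_le_trans _ far)// ltrXn2r ?nnegrE ?(ltW e0)// ?er// (ltW r00).
rewrite /stopval (@stopped_eq _ _ _ _ j).
- rewrite /lyap; apply: lyapG_le => //.
    by rewrite lt_min c00 andbT; apply: lt_le_trans e0 (rho_ge _ e0).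
  rewrite ge_min; apply/orP; left.
  rewrite -(@ler_pXn2r _ 2) ?nnegrE ?sqrtr_ge0 ?mulr_ge0 ?(ltW e0)//.
  rewrite rho_sqr exprMn sqr_sqrtr//.
  by move: uj; rewrite /u; lra.
- by rewrite j0 ltnW// ltnS (leq_trans ji0).
- move=> i ij; apply: stayP => // k ki.
  have kN : (k < j)%N by exact: leq_ltn_trans ki ij.
  have tk : q <= t_ N k <= t.
    by rewrite grid_ge (le_trans _ ti0)// grid_le// ltnW// (leq_trans kN).
  split.
    have [h1 h2 h3] := near_t _ tk; split => //; last exact: ults.
    rewrite -(@ler_pXn2r _ 2) ?nnegrE ?sqrtr_ge0 ?divr_ge0 ?(ltW c00)// rho_sqr.
    have : e ^+ 2 <= (c0 / 4) ^+ 2 by rewrite lerXn2r ?nnegrE ?divr_ge0 ?(ltW e0) ?(ltW c00).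
    by move: h3 (sqr_ge0 c0); rewrite !expr_div_n; lra.
  apply: le_trans (VM N).
  have kN1 : (k <= N.+1)%N by rewrite ltnW// ltnS (leq_trans _ i0N)// ltnW// (leq_trans kN).
  rewrite -(big_mkord xpredT (fun l => norm1 (ainc B X q N l w))).
  rewrite -(big_mkord xpredT (fun l => norm1 (ainc B X q N l w))).
  by rewrite [leRHS](@big_cat_nat _ _ _ k)//= lerDl sumr_ge0// => l _; exact: norm1_ge0.
- move=> i /andP[ji _]; apply/negP => wi.
  have wj : w \in stay B X Q x0 r0 Mv q region N j.
    apply: (@decreasing_pred (fun i => w \in stay B X Q x0 r0 Mv q region N i) _ i) => //.
    by move=> l; exact: stay_dec.
  by have [[_ _ _ +] _] := stay_in wj; rewrite ltNge uj.
Qed.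

End OnePath.

End Pathwise.

(** * Exceptional sets *)

Section Negligible.
Context (R : realType) (dT : measure_display) (T : measurableType dT) (P : probability T R).

Lemma negligible_bigcup_count (I : countType) (A : I -> set T) :
  (forall i, P.-negligible (A i)) -> P.-negligible (\bigcup_i A i).
Proof.
move=> nA.
have -> : \bigcup_i A i = \bigcup_k (if @unpickle I k is Some i then A i else set0).
  apply/seteqP; split => w.
    by move=> [i _ Aiw]; exists (pickle i) => //; rewrite pickleK.
  by move=> [k _]; case: unpickle => // i Aiw; exists i.
by apply: negligible_bigcup => k; case: unpickle => // *; exact: negligible_set0.
Qed.

Lemma negligible_small (A : set T) : (forall ep : R, 0 < ep ->
  exists E, [/\ measurable E, A `<=` E & (P E <= ep%:E)%E]) -> P.-negligible A.
Proof.
move=> h.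
have h' (j : nat) : exists E, [/\ measurable E, A `<=` E & (P E <= (j.+1%:R^-1)%:E)%E].
  by apply: h; rewrite invr_gt0.
have [E hE] := choice h'.
have mE : measurable (\bigcap_j E j) by apply: bigcapT_measurable => j; have [] := hE j.
exists (\bigcap_j E j); split => //; last by move=> w Aw j _; have [_ + _] := hE j; apply.
apply/eqP; rewrite -measure_le0; apply/lee_addgt0Pr => ep ep0; rewrite add0e.
have [N0 _ hN0] := near_infty_natSinv_lt (PosNum ep0).
have [mN _ PN] := hE N0.
apply: (@le_trans _ _ (P (E N0))).
  by apply: le_measure; rewrite ?inE// => w; apply.
by apply: le_trans PN _; rewrite lee_fin ltW//; exact: (hN0 N0 (leqnn _)).
Qed.

End Negligible.

Lemma measurable_forall (d : measure_display) (E : measurableType d) (I : finType)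
  (A : I -> set E) : (forall i, measurable (A i)) -> measurable [set w | forall i, A i w].
Proof.
move=> mA; rewrite (_ : [set w | _] = \bigcap_(i in setT) A i).
  by apply: fin_bigcap_measurable => //; exact: finite_finset.
by apply/seteqP; split => w h i; [move=> _; exact: h|exact: h].
Qed.

Section RegionAdapted.
Context (R : realType) (dE : measure_display) (E : measurableType dE).
Context (d m : nat) (n : 'I_m -> 'I_d -> R) (a : 'I_m -> R) (J : {set 'I_m}).

Lemma measurable_region (X : R -> E -> 'I_d -> R) (Q : 'I_d -> 'I_d -> R) (x0 : 'I_d -> R)
  (c0 e eta M t : R) : (forall k, measurable_fun setT (fun w => X t w k)) ->
  measurable (region X n a J Q x0 c0 e eta M t).
Proof.
move=> mX.
have mT k : measurable_fun setT (fun w => trans X Q x0 t w k).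
  by apply: measurable_app => l; apply: measurable_funB => //; exact: measurable_cst.
have mw i : measurable_fun setT (fun w => dotv (X t w) (n i) - a i).
  apply: measurable_funB; last exact: measurable_cst.
  by apply: measurable_dotv => // k; exact: measurable_cst.
have le_m (f : E -> R) : measurable_fun setT f -> forall c, measurable [set w | c <= f w].
  move=> mf c; rewrite (_ : [set w | _] = setT `&` f @^-1` `[c, +oo[%classic); first exact: mf.
  by rewrite setTI; apply/seteqP; split => w /=; rewrite in_itv/= andbT.
have ge_m (f : E -> R) : measurable_fun setT f -> forall c, measurable [set w | f w <= c].
  move=> mf c; rewrite (_ : [set w | _] = setT `&` f @^-1` `]-oo, c]%classic); first exact: mf.
  by rewrite setTI; apply/seteqP; split => w /=; rewrite in_itv.
have lt_m (f : E -> R) : measurable_fun setT f -> forall c, measurable [set w | c < f w].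
  move=> mf c; rewrite (_ : [set w | _] = setT `&` f @^-1` `]c, +oo[%classic); first exact: mf.
  by rewrite setTI; apply/seteqP; split => w /=; rewrite in_itv/= andbT.
rewrite (_ : region _ _ _ _ _ _ _ _ _ _ _ =
  [set w | forall i, i \notin J -> eta <= dotv (X t w) (n i) - a i] `&`
  [set w | forall i, dotv (X t w) (n i) - a i <= M] `&`
  [set w | rho e (trans X Q x0 t w) <= c0 / 2] `&`
  [set w | e ^+ 2 < dotv (trans X Q x0 t w) (trans X Q x0 t w)]).
  apply: measurableI; last by apply: lt_m; exact: measurable_dotv.
  apply: measurableI; last by apply: ge_m; exact: measurable_rho.
  apply: measurableI; last by apply: measurable_forall => i; exact: ge_m.
  apply: measurable_forall => i; case: (i \in J).
    by rewrite (_ : (fun w => _) = setT)//; apply/seteqP; split.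
  rewrite (_ : (fun w => _) = [set w | eta <= dotv (X t w) (n i) - a i]); first exact: le_m.
  by apply/seteqP; split => w //=; apply.
by apply/seteqP; split => w; [move=> [? ? ? ?]; do 3?split|move=> [[[? ?] ?] ?]; split].
Qed.

End RegionAdapted.

(** The logarithm is unbounded below at 0, while [K * r] stays bounded for [r <= Num.sqrt 2 * c]. *)
Lemma lyapG_small (R : realType) (K c A : R) : 0 <= K -> 0 < c ->
  exists e, [/\ 0 < e, e <= c & lyapG K (Num.sqrt 2 * e) <= - A].
Proof.
move=> K0 c0; pose s2 : R := Num.sqrt 2.
have s20 : 0 < s2 by rewrite sqrtr_gt0.
pose z := expR (- A - K * (s2 * c)).
exists (Num.min c (z / s2)).
have e0 : 0 < Num.min c (z / s2) by rewrite lt_min c0 divr_gt0// expR_gt0.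
split => //; first by rewrite ge_min lexx.
rewrite /lyapG; set e := Num.min _ _ in e0 *.
have ec : e <= c by rewrite ge_min lexx.
have ez : s2 * e <= z by rewrite mulrC -ler_pdivlMr// ge_min lexx orbT.
have l : ln (s2 * e) <= - A - K * (s2 * c).
  by rewrite -[leRHS]expRK ler_ln ?posrE ?expR_gt0 ?mulr_gt0.
have : K * (s2 * e) <= K * (s2 * c) by rewrite ler_wpM2l// ler_wpM2l// ltW.
by rewrite -/s2; move: l; lra.
Qed.

(** * Hits with prescribed margins, starting time and variation *)

Section NearHits.
Context (R : realType) (dT : measure_display) (T : measurableType dT) (P : probability T R).
Context (F : R -> set (set T)) (d m : nat) (B X : R -> T -> 'I_d -> R).
Variables (phi : 'I_m -> R -> \bar R) (n : 'I_m -> 'I_d -> R) (a : 'I_m -> R).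
Hypothesis filF : filtration F.
Hypothesis BM : brownian P F B.
Hypothesis XA : forall t k, 0 <= t -> meas_wrt (F t) (fun w => X t w k).
Hypothesis Hphi : forall i, admissible_phi (phi i).
Hypothesis good : {ae P, forall w, good_path n a phi (fun t => X t w) (fun t => B t w)}.
Variable J : {set 'I_m}.
Variables (Q : 'I_d -> 'I_d -> R) (x0 : 'I_d -> R).
Hypothesis Qsym : forall k l, Q k l = Q l k.
Hypothesis Qidem : forall k l, \sum_j Q k j * Q j l = Q k l.
Hypothesis QJ : forall j, j \in J -> app Q (n j) = n j.
Hypothesis Qker : forall v, (forall j, j \in J -> dotv v (n j) = 0) -> app Q v = 0.
Hypothesis Qtr : 2 <= \sum_k Q k k.
Hypothesis x0J : inH n a J x0.

(** All random quantities in the estimate are replaced by deterministic parameters, over which a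
    countable union is taken later. The radius [c0 / 4] leaves room for the regularization inside
    [rho e <= c0 / 2]. *)
Definition near_hit (c0 eta M q r0 Mv : R) : set T := [set w |
  [/\ good_path n a phi (fun t => X t w) (fun t => B t w),
    exists t, [/\ q < t < q + 1, inH n a J (X t w) & forall s, q <= s <= t ->
      [/\ forall i, i \notin J -> eta <= dotv (X s w) (n i) - a i,
        forall i, dotv (X s w) (n i) - a i <= M &
        dotv (trans X Q x0 s w) (trans X Q x0 s w) <= (c0 / 4) ^+ 2]],
    r0 ^+ 2 <= dotv (trans X Q x0 q w) (trans X Q x0 q w) &
    forall N, \sum_(j < N.+1) norm1 (ainc B X q N j w) <= Mv]].

(** [c0] is fixed by [eta] and [M] before [q], [r0] and [Mv], because the starting time is chosen
    only once the path is known to stay within a radius depending on [c0]. *)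
Lemma near_hit_negligible (eta M : R) : 0 < eta -> eta <= M ->
  exists2 c0, 0 < c0 & forall q r0 Mv, 0 <= q -> 0 < r0 -> 0 <= Mv ->
    P.-negligible (near_hit c0 eta M q r0 Mv).
Proof.
move=> eta0 etaM.
have eta20 : 0 < eta / 2 by rewrite divr_gt0.
have etaM1 : eta / 2 <= M + 1 by lra.
have [C1 C10 HC1] := drift_bound n a J Hphi eta20 etaM1.
pose Nn := \sum_i norm1 (n i).
have Nn0 : 0 <= Nn by apply: sumr_ge0 => i _; exact: norm1_ge0.
have nN i : norm1 (n i) <= Nn.
  by rewrite /Nn (bigD1 i)//= lerDl sumr_ge0// => j _; exact: norm1_ge0.
(* 32 is 4 from [lyap_drift] times 8 from [gauss_var_ge]; then [c0 = K^-1] gives [K * c0 <= 1]. *)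
pose K := 32 * (C1 * Nn) + 1.
have K0 : 0 < K by rewrite ltr_wpDl// mulr_ge0// mulr_ge0.
have CK : 4 * (C1 * Nn) <= 8^-1 * K by rewrite /K; lra.
pose c0 := K^-1.
have c00 : 0 < c0 by rewrite invr_gt0.
have Kc0 : K * c0 <= 1 by rewrite /c0 divff// gt_eqF.
exists c0 => // q r0 Mv q0 r00 Mv0.
apply: negligible_small => ep ep0.
set C := Num.max 0 (lyapG K c0) + Num.max 0 (- lyapG K (Num.min r0 c0)).
have C0 : 0 <= C by rewrite addr_ge0// le_max lexx.
have cmin : 0 < Num.min (c0 / 4) (r0 / 2) by rewrite lt_min !divr_gt0.
(* [C] does not involve [e], so [e] can be chosen afterwards to make the level lower than
   [- (C / ep + 1)]; the probability is then at most [C / (C / ep + 1) <= ep]. *)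
have [e [e0 + ge]] := lyapG_small (C / ep + 1) (ltW K0) cmin.
rewrite le_min => /andP[ec er].
have ec0 : e <= c0 by apply: le_trans ec _; rewrite ler_pdivrMr// ler_peMr ?ler1n ?(ltW c00).
have er0 : e < r0 by apply: le_lt_trans er _; rewrite ltr_pdivrMr// ltr_pMr// ltr1n.
have Ce0 : 0 < C / ep + 1 by rewrite ltr_wpDl// divr_ge0// ltW.
have ge0 : lyapG K (Num.sqrt 2 * e) < 0.
  by apply: le_lt_trans ge _; rewrite oppr_lt0.
pose reg := region X n a J Q x0 c0 e eta M.
have regF t : 0 <= t -> F t (reg t).
  move=> t0; have [sF _ _] := filF; rewrite -(sigma_algebra_id (sF t)).
  apply: (@measurable_region R _ (g_sigma_algebraType (F t))) => k.
  by apply/meas_wrtP => //; exact: XA.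
have cvg_ex : {ae P, forall w, forall dl, 0 < dl -> exists N0, forall N, (N0 <= N)%N ->
    - dl <= excess_sum B X Q x0 K c0 e r0 Mv q reg N w}.
  apply: filterS good => w [cx cb Dx _ [W [Wvar Wdrift]]] dl dl0.
  exact: (excess_sum_ge_near Qsym Qidem QJ Qtr x0J r0 Mv (ltW K0) c00 e0 ec0 q0 eta0 C10 Nn0
    nN Kc0 CK HC1 Dx Wvar Wdrift cx cb dl0).
have [mhit Phit] := hit_bound filF BM XA Qsym Qidem (ltW K0) c00 e0 ec0 r00 Mv0 q0 regF
  (fun t w => (fun '(And4 _ _ h _) => h)) (fun t w => region_gain Qtr (ltW K0) c00 e0 C10 Nn0 Kc0 CK (t := t) (w := w)) ge0 cvg_ex.
exists (hit B X Q x0 K c0 e r0 Mv q reg); split => //.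
  move=> w [[cx cb Dx _ _] [t [qt Ht near_t]] far VM].
  exact: (path_hit x0J (ltW K0) c00 e0 q0 cx qt Ht Qker near_t far ec er0 VM).
move: Phit; rewrite -/C.
have fP : (P (hit B X Q x0 K c0 e r0 Mv q reg)) \is a fin_num by exact: fin_num_measure.
rewrite -(fineK fP) -EFinM !lee_fin => Phit.
have p0 : 0 <= fine (P (hit B X Q x0 K c0 e r0 Mv q reg)) by rewrite fine_ge0.
have : fine (P (hit B X Q x0 K c0 e r0 Mv q reg)) * (C / ep + 1) <= C.
  by apply: le_trans Phit; rewrite ler_wpM2l// lerNr.
rewrite -ler_pdivlMr// => /le_trans; apply.
rewrite ler_pdivrMr// mulrDr mulr1 mulrC divfK ?gt_eqF// lerDl ltW//.
Qed.

End NearHits.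

Lemma dist_lower (R : realType) (x y a b c : R) :
  `|x - y| <= c -> b + c <= y - a -> b <= x - a.
Proof. by rewrite ler_norml => /andP[+ _]; lra. Qed.

Lemma dist_upper (R : realType) (x y a b c : R) :
  `|x - y| <= c -> y - a + c <= b -> x - a <= b.
Proof. by rewrite ler_norml => /andP[_ +]; lra. Qed.

(** * Countable reduction for a given set of active walls *)

Section ActiveWalls.
Context (R : realType) (dT : measure_display) (T : measurableType dT) (P : probability T R).
Context (F : R -> set (set T)) (d m : nat) (B X : R -> T -> 'I_d -> R).
Variables (phi : 'I_m -> R -> \bar R) (n : 'I_m -> 'I_d -> R) (a : 'I_m -> R).
Hypothesis filF : filtration F.
Hypothesis BM : brownian P F B.
Hypothesis XA : forall t k, 0 <= t -> meas_wrt (F t) (fun w => X t w k).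
Hypothesis Hphi : forall i, admissible_phi (phi i).
Hypothesis good : {ae P, forall w, good_path n a phi (fun t => X t w) (fun t => B t w)}.
Hypothesis nu : forall i, unitv (n i).

(** As [J] is exactly the active set, each other wall has a positive gap at [t]. Gap and bound are
    made rational first, since they determine [c0]; then starting time, initial distance and
    variation. *)
Lemma active_walls_negligible (J : {set 'I_m}) (i1 i2 : 'I_m) : i1 \in J -> i2 \in J ->
  n i1 <> n i2 -> n i1 <> - n i2 ->
  P.-negligible [set w | good_path n a phi (fun t => X t w) (fun t => B t w) /\
    exists t, 0 < t /\ forall i, (i \in J) = (dotv (X t w) (n i) == a i)].
Proof.
move=> J1 J2 n12 n12'.
have [[x0 x0J]|no] := pselect (exists x, inH n a J x); last first.
  apply: negligibleS (negligible_set0 _) => w [_ [t [_ ht]]].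
  by apply: no; exists (X t w) => j; rewrite ht => /eqP.
have [Q [Qsym Qidem QJ Qker Qtr']] := orthogonal_projection n J.
have Qtr := Qtr' _ _ J1 J2 (nu i1) (nu i2) n12 n12'.
pose Nn := \sum_i norm1 (n i).
have Nn0 : 0 <= Nn by apply: sumr_ge0 => i _; exact: norm1_ge0.
have nN i : norm1 (n i) <= Nn.
  by rewrite /Nn (bigD1 i)//= lerDl sumr_ge0// => j _; exact: norm1_ge0.
pose qq := \sum_k \sum_l `|Q k l|.
have qq0 : 0 <= qq by apply: sumr_ge0 => k _; exact: sumr_ge0.
(* The factor 2 leaves the gap [eta = k.+1%:R^-1] on a whole time interval before [t]. *)
pose far (kl : nat * nat) := [set w | good_path n a phi (fun t => X t w) (fun t => B t w) /\
  exists t, [/\ 0 < t, inH n a J (X t w),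
    forall i, i \notin J -> 2 * kl.1.+1%:R^-1 <= dotv (X t w) (n i) - a i &
    forall i, dotv (X t w) (n i) - a i <= kl.2%:R]].
apply: (@negligibleS _ _ _ _ (\bigcup_kl far kl)).
  move=> w [gw [t [t0 ht]]].
  have [_ _ Dx _ _] := gw.
  pose g i := if i \in J then 1 else dotv (X t w) (n i) - a i.
  have g0 i : 0 < g i.
    rewrite /g; have [//|iJ] := boolP (i \in J).
    by rewrite subr_gt0 lt_neqAle (Dx _ (ltW t0)) andbT eq_sym -ht.
  have [c c_gt0 cg] := finite_pos_lb g0.
  have c2 : 0 < c / 2 by rewrite divr_gt0.
  have [k _ hk] := near_infty_natSinv_lt (PosNum c2).
  pose S := \sum_i `|dotv (X t w) (n i) - a i|.
  have S0 : 0 <= S by exact: sumr_ge0.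
  have /andP[_ /ltW hl] := truncn_itv S0.
  exists (k, (Num.truncn S).+1) => //; split => //; exists t; split => //=.
  - by move=> j; rewrite ht => /eqP.
  - move=> i iJ; have := cg i; rewrite /g (negbTE iJ); apply: le_trans.
    by rewrite mulrC -ler_pdivlMr// ltW//; exact: (hk k (leqnn _)).
  - move=> i; apply: le_trans hl; apply: le_trans (ler_norm _) _.
    by rewrite /S (bigD1 i)//= lerDl sumr_ge0.
apply: negligible_bigcup_count => -[k l].
pose eta : R := k.+1%:R^-1; pose M : R := l%:R + 1.
have eta0 : 0 < eta by rewrite invr_gt0.
have etaM : eta <= M.
  by apply: (@le_trans _ _ 1); rewrite ?lerDr// invf_le1 ?ler1n// ltr0n.
have [c0 c00 neg] := near_hit_negligible filF BM XA Hphi good Qsym Qidem QJ Qker Qtr x0J eta0 etaM.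
pose A (idx : rat * nat * nat) := if 0 <= idx.1.1 then
  near_hit B X phi n a J Q x0 c0 eta M (ratr idx.1.1) idx.1.2.+1%:R^-1 idx.2%:R else set0.
apply: (@negligibleS _ _ _ _ (\bigcup_idx A idx)); last first.
  apply: negligible_bigcup_count => -[[q p] v]; rewrite /A /=.
  case: ifP => [q0|_]; last exact: negligible_set0.
  by apply: neg; rewrite ?ler0q// invr_gt0.
move=> w [gw [t [t0 Ht wallt bddt]]].
have [cx cb Dx dense [W [Wvar _]]] := gw.
pose th := Num.min eta (Num.min 1 (c0 / 4)) / (Nn + qq + 1).
have den : 0 < Nn + qq + 1 by rewrite ltr_wpDl// addr_ge0.
have mn : 0 < Num.min eta (Num.min 1 (c0 / 4)) by rewrite !lt_min eta0 ltr01 divr_gt0.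
have th0 : 0 < th by rewrite divr_gt0.
have thm z : 0 <= z -> z <= Nn + qq + 1 -> th * z <= Num.min eta (Num.min 1 (c0 / 4)).
  move=> z0 zl; apply: le_trans (_ : th * (Nn + qq + 1) <= _); last by rewrite /th divfK// gt_eqF.
  by rewrite ler_wpM2l// ltW.
have : th * Nn <= Num.min eta (Num.min 1 (c0 / 4)) by apply: thm => //; rewrite -addrA lerDl addr_ge0.
rewrite !le_min => /and3P[th1 th2 _].
have : th * qq <= Num.min eta (Num.min 1 (c0 / 4)).
  by apply: thm => //; rewrite addrAC lerDr addr_ge0.
rewrite !le_min => /and3P[_ _ th3].
have /nbhs_ballP[ep /= ep0 hep] := path_continuous cx (ltW t0) th0.
(* After [lo] the path is close to its position at [t], and [t] is less than one unit away, the
   length covered by the grid. *)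
pose lo := Num.max 0 (t - Num.min ep 1).
have lo0 : 0 <= lo by rewrite le_max lexx.
have lot : lo < t by rewrite gt_max t0 gtrBl lt_min ep0 ltr01.
have [r /andP[lor rt] Dr] := dense _ _ lo0 lot.
have r0 : 0 <= r by exact: le_trans lo0 (ltW lor).
pose gap := dotv (X r w) (n i1) - a i1.
have gap0 : 0 < gap by rewrite subr_gt0; exact: Dr.
have gapN : 0 < gap / 2 / (Nn + 1) by rewrite !divr_gt0// ltr_wpDl.
have /nbhs_ballP[ep2 /= ep20 hep2] := path_continuous cx r0 gapN.
have rmin : r < Num.min t (r + ep2) by rewrite lt_min rt ltrDl.
(* An interior time need not be rational; a rational time close after [r] is still strictly off wall
   [i1], which is all that is required. *)
have [q] := rat_in_itvoo rmin; rewrite in_itv/= lt_min => /and3P[rq qt qr].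
have q0 : 0 <= ratr q :> R by exact: le_trans r0 (ltW rq).
have qgap : 0 < dotv (X (ratr q) w) (n i1) - a i1.
  have h : norm1 (X (ratr q) w - X r w) <= gap / 2 / (Nn + 1).
    apply: hep2 => //; by rewrite /ball/= ltr0_norm ?subr_lt0// opprB ltrBlDl.
  have h3 : norm1 (X (ratr q) w - X r w) * Nn <= gap / 2.
    apply: le_trans (_ : gap / 2 / (Nn + 1) * (Nn + 1) <= _); last first.
      by rewrite divfK// gt_eqF// ltr_wpDl.
    by apply: ler_pM => //; [exact: norm1_ge0|rewrite lerDl].
  apply: lt_le_trans (dist_lower (b := gap / 2) (le_trans (dotv_diff_le _ _ (nN i1)) h3) _).
    by rewrite divr_gt0.
  by rewrite -splitr.
set y := trans X Q x0 (ratr q) w.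
(* The product of [y] with [n i1] is the distance to that wall, which is positive at time [q]. *)
have y0 : 0 < dotv y y.
  rewrite lt_neqAle dotvv_ge0 andbT; apply/eqP => yy.
  have yk k' : `|y k'| <= 0 by apply: coord_le_sqrt => //; rewrite -yy expr0n.
  have := dotv_norm1 (n i1) yk; rewrite mul0r normr_le0 (dotv_trans X Qsym QJ x0J) ?J1// => /eqP h.
  by move: qgap; rewrite h ltxx.
have y1 : 0 < Num.min 1 (dotv y y) by rewrite lt_min ltr01.
have [p _ hp] := near_infty_natSinv_lt (PosNum y1).
have := hp p (leqnn _); rewrite /= lt_min => /andP[/ltW p1 /ltW p2].
have q1 : ratr q <= ratr q + 1 :> R by rewrite lerDl.
have V0 : 0 <= W (ratr q + 1) - W (ratr q).
  by apply: le_trans (norm1_ge0 _) (Wvar _ _ q0 q1).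
have /andP[_ /ltW hv] := truncn_itv V0.
exists (q, p, (Num.truncn (W (ratr q + 1) - W (ratr q))).+1) => //.
rewrite /A /= -(ler0q R) q0; split => //.
- exists t; split => //.
    rewrite qt/=; have : t - 1 <= lo by rewrite le_max lerD2l lerN2 ge_min lexx !orbT.
    by move=> h; rewrite -ltrBlDr; exact: le_lt_trans h (lt_trans lor rq).
  move=> s /andP[qs st].
  have s0 : 0 <= s by exact: le_trans q0 qs.
  have xs : norm1 (X s w - X t w) <= th.
    apply: hep => //; rewrite /ball/= ger0_norm ?subr_ge0//.
    have : t - ep <= lo by rewrite le_max lerD2l lerN2 ge_min lexx orbT.
    move=> h; rewrite ltrBlDr -ltrBlDl.
    exact: le_lt_trans h (lt_trans lor (lt_le_trans rq qs)).
  have near i : `|dotv (X s w) (n i) - dotv (X t w) (n i)| <= th * Nn.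
    by apply: le_trans (dotv_diff_le _ _ (nN i)) _; rewrite ler_wpM2r.
  split.
  + move=> i iJ; apply: dist_lower (near i) (le_trans _ (wallt i iJ)).
    by rewrite /= -/eta mulr_natl mulr2n lerD2l.
  + move=> i; apply: dist_upper (near i) _.
    exact: lerD (bddt i) th2.
  + apply: le_trans (dotvv_norm1 _) _.
    rewrite lerXn2r ?nnegrE ?norm1_ge0 ?divr_ge0 ?(ltW c00)//.
    have tr0 : trans X Q x0 t w = 0 by exact: trans_eq0 x0J t w Qker Ht.
    have -> : trans X Q x0 s w = app Q (X s w - X t w).
      rewrite -[LHS]subr0 -tr0 /trans -appB; congr app.
      by apply/funext => k'; rewrite !fctE; ring.
    apply: le_trans (norm1_app _ _) _; apply: le_trans th3; rewrite mulrC.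
    exact: (ler_wpM2r qq0 xs).
- apply: le_trans p2; rewrite expr2 ler_piMr// invr_ge0 ler0n.
- move=> N; apply: le_trans hv.
  apply: le_trans (_ : \sum_(j < N.+1) (W (grid (ratr q) N j.+1) - W (grid (ratr q) N j)) <= _).
    apply: ler_sum => j _; apply: Wvar; first exact: le_trans q0 (grid_ge _ _ _).
    exact: ltW (grid_lt _ _ _).
  rewrite -(big_mkord xpredT (fun i => W (grid (ratr q) N i.+1) - W (grid (ratr q) N i))).
  by rewrite telescope_sumr// grid0 /grid divff.
Qed.

End ActiveWalls.

Theorem theorem4 (R : realType) (dT : measure_display) (T : measurableType dT)
  (P : probability T R) (F : R -> set (set T)) (d m : nat)
  (B : R -> T -> 'I_d -> R)
  (phi : 'I_m -> R -> \bar R) (n : 'I_m -> 'I_d -> R) (a : 'I_m -> R)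
  (X : R -> T -> 'I_d -> R) (L : R -> T -> R) :
  filtration F -> usual_conditions P F -> brownian P F B ->
  (forall i, admissible_phi (phi i)) ->
  (forall i, unitv (n i)) ->
  (forall i j, i != j -> n i <> n j) ->
  (exists x, inD n a x) ->
  mvsde_solution P F n a phi B X L ->
  forall J : {set 'I_m}, (2 <= #|J|)%N ->
  P [set w | forall t, 0 < t -> ~ inH n a J (X t w)] = 1%E.
Proof.
move=> filF [_ complete] BM Hphi nu ninj [z Dz] sol J J2.
have good := mvsde_good_path BM (ex_intro _ z Dz) sol.
have [XA _ _] := sol.
(* The active set at the hitting time is random but takes finitely many values; those without two
   distinct non-opposite normals are given the empty event and have to be excluded. *)
pose act (J' : {set 'I_m}) := if [exists i1, exists i2, [&& i1 != i2, i1 \in J', i2 \in J'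
    & ~~ `[< n i1 = - n i2 >]]] then
  [set w | good_path n a phi (fun t => X t w) (fun t => B t w) /\
    exists t, 0 < t /\ forall i, (i \in J') = (dotv (X t w) (n i) == a i)] else set0.
have negl : P.-negligible (~` [set w | forall t, 0 < t -> ~ inH n a J (X t w)]).
  apply: (@negligibleS _ _ _ _
      (~` [set w | good_path n a phi (fun t => X t w) (fun t => B t w)] `|` \bigcup_J' act J')).
    move=> w /= /existsNP[t /not_implyP[t0 /contrapT Ht]].
    have [gw|] := pselect (good_path n a phi (fun t => X t w) (fun t => B t w)); last by left.
    right; exists [set i | dotv (X t w) (n i) == a i]%SET => //.
    rewrite /act ifT; first by split => //; exists t; split => // i; rewrite inE.
    have /card_gt1P[i1 [i2 [J1 J2' i12]]] := J2.
    apply/existsP; exists i1; apply/existsP; exists i2.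
    rewrite i12 !inE (Ht _ J1) (Ht _ J2') !eqxx /=; apply/asboolPn => e12.
    (* Two active walls with opposite normals would force [a i1 = - a i2], contradicting the
       interior point [z]. *)
    have dN x : dotv x (n i1) = - dotv x (n i2).
      by rewrite e12 /dotv -sumrN; apply: eq_bigr => k _; rewrite fctE mulrN.
    have := Dz i1; have := Dz i2; have := dN z; have := dN (X t w).
    by rewrite (Ht _ J1) (Ht _ J2'); lra.
  apply: negligibleU; first exact: good.
  apply: negligible_bigcup_count => J'; rewrite /act.
  case: ifP => [/existsP[i1 /existsP[i2 /and4P[i12 J1 J2' /asboolPn nn]]]|_]; last first.
    exact: negligible_set0.
  exact: (active_walls_negligible filF BM XA Hphi good nu J1 J2' (ninj _ _ i12) nn).
(* The event quantifies over uncountably many times; its measurability comes from completeness, as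
   its complement lies in a null set. *)
have [N [mN PN sub]] := negl.
have mc : measurable (~` [set w | forall t, 0 < t -> ~ inH n a J (X t w)]).
  by case: filF => _ /(_ 0) + _; apply; exact: complete sub.
have mE : measurable [set w | forall t, 0 < t -> ~ inH n a J (X t w)].
  by rewrite -[X in measurable X]setCK; exact: measurableC.
rewrite -[X in P X]setCK probability_setC//.
by rewrite (proj1 (negligibleP P mc) negl) sube0.
Qed.
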